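(* Suppose that Assumptions A and B (stated in the context) hold and that the functions are fully observed, i.e. $X_{i,M_N}=X_i$ for all $i,N$, with $I_1=I_2$. Put $\sigma^2:=\mathbb{E}\|W\|^2$, where $\|W\|=\sup_{x\in[0,1],u\in I_2}|W(x)(u)|$, and suppose $\sigma^2>0$. Then, for a fixed, sufficiently large constant $C>0$, $$\limsup_{N\to\infty}\bigg\|\frac{\sum_{i=1}^N\{X_i-\mathbb{E}[X_i]\}}{\sqrt{N\log(\log(N))}}\bigg\|\le C\sigma\qquad\text{almost surely.}$$
   Context: Notation. $|\cdot|$ denotes the maximum norm on $\mathbb{R}^d$, $d\ge 1$. $I_2\subset I_1$ are non-empty intervals, each either compact or equal to $\mathbb{R}$. For compact $I$, $\mathcal{C}_0(I,\mathbb{R}^d)$ is the space of continuous functions $I\to\mathbb{R}^d$; $\mathcal{C}_0(\mathbb{R},\mathbb{R}^d)$ is the space of continuous functions $f:\mathbb{R}\to\mathbb{R}^d$ with $\lim_{y\to\infty}\sup_{|u|>y}|f(u)|=0$. Components are written $f[1],\dots,f[d]$; $\|f\|$ is the supremum of $|f|$ over its domain. A function on $I_1$ is identified with its restriction to $I_2$ when compared with a function on $I_2$. Sparse estimators. $(X_n)_{n\in\mathbb{N}}$ is a sequence of random functions in $\mathcal{C}_0(I_1,\mathbb{R}^d)$. For each $M\in\mathbb{N}$, $(\delta_{n,M})_{n}$ are random variables in a metric space $\mathcal{S}_M$, $\mathscr{A}_M:\mathcal{C}_0(I_1,\mathbb{R}^d)\times\mathcal{S}_M\to\mathcal{C}_0(I_2,\mathbb{R}^d)$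 is a deterministic measurable map, and $X_{n,M}:=\mathscr{A}_M(X_n,\delta_{n,M})$. $(M_N)_{N}$ is a sequence of natural numbers with $M_N\to\infty$ as $N\to\infty$. Mixing and stationarity. For a sequence $(Y_n)$ the $\alpha$-mixing coefficients are $\alpha_Y(k)=\sup|\mathbb{P}(A\cap B)-\mathbb{P}(A)\mathbb{P}(B)|$, over $m\ge1$, $A\in\sigma(Y_i:1\le i\le m)$, $B\in\sigma(Y_i:i\ge m+k)$; $(Y_n)$ is $\alpha$-mixing if $\alpha_Y(k)\to0$. $(X_n)$ is weakly stationary if its mean functions do not depend on $n$ and $\mathrm{Cov}(X_n[k](u),X_{n+h}[\ell](v))$ does not depend on $n$. Assumption A. (i) $(X_n)$ is weakly stationary; for every $M$ the sequence $(X_n,\delta_{n,M})_n$ is $\alpha$-mixing with coefficients $\alpha_{X,\delta,M}$, and there are $C_1,\nu>0$ with $\sup_M\alpha_{X,\delta,M}(n)\le C_1n^{-\nu}$ for all $n$. (ii) $J>4$ and $\xi>1/2$ are constants with $3+\frac{9}{J-4}<\nu$, and for some $C_2>0$: $\sup_n\mathbb{E}\|X_n\|^J\le C_2$ and $\sup_n\sup_{u\ne v}\mathbb{E}\big(|X_n(u)-X_n(v)|/|u-v|^\xi\big)^J\le C_2$. (iii) There are $C_3,\gamma>0$ such that, for all $N$, $\sup_n\mathbb{E}\|X_n-X_{n,M_N}\|^J\le C_3N^{-\gamma}$, and $\sup_{n,N}\sup_{u\ne v}\mathbb{E}\big(|X_{n,M_N}(u)-X_{n,M_N}(v)|/|u-v|^\xi\big)^J\le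 C_3$. Assumption B. One of the following holds. (i) (Fixed domain) $I_2$ is a fixed compact interval. (ii) (Increasing domain) $I_1=\mathbb{R}$, $I_2=I_2(N)$ depends on $N$ with $I_2(N)\subset I_2(N+1)$, and $|I_2(N)|\le C_4N^\rho$ for a sufficiently small $\rho>0$, where how small $\rho$ has to be depends only on the constants $C_i,J,\nu,\xi,\gamma$ of Assumption A. (iii) (Infinite domain) $I_1=I_2=\mathbb{R}$ and there are $\kappa,C_5>0$ such that for all $y>0$: $\sup_n\mathbb{E}\sup_{|u|>y}|X_n(u)|^2\le C_5\exp(-y^\kappa)$ and $\sup_{n,M}\mathbb{E}\sup_{|u|>y}|X_{n,M}(u)|^2\le C_5\exp(-y^\kappa)$. (In the fully observed case $I_1=I_2$, scenario (ii) cannot occur.) Long-run variance kernel: for $u,v\in I_2$, $1\le k,\ell\le d$, $c[k,\ell](u,v)=\mathrm{Cov}(X_1[k](u),X_1[\ell](v))+\sum_{n\ge2}\{\mathrm{Cov}(X_1[k](u),X_n[\ell](v))+\mathrm{Cov}(X_n[k](u),X_1[\ell](v))\}$. Brownian motion: $W=\{W(x):x\in[0,1]\}$ is the process with $W(0)=0$, continuous sample paths in $\mathcal{C}_0(I_2,\mathbb{R}^d)$, and stationary, independent, centered Gaussian increments, with $\mathrm{Cov}(W(1)[k](u),W(1)[\ell](v))=c[k,\ell](u,v)$. *)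

(* Defs.v *)
From HB Require Import structures.
From mathcomp Require Import all_boot all_order all_algebra.
From mathcomp Require Import all_classical all_reals all_analysis.

Set Implicit Arguments.
Unset Strict Implicit.
Unset Printing Implicit Defensive.

Import Order.TTheory GRing.Theory Num.Theory.
Import numFieldNormedType.Exports.

Local Open Scope classical_set_scope.
Local Open Scope ring_scope.

(** Sequences are indexed from 0: [X n] is the mathematician's X_(n+1), and
    the families indexed by M (metric spaces, observation maps) start at
    M = 0. *)

Section function_space.
Context {R : realType} (I : set R) (d : nat).

(* The norm on 'rV[R]_d is the maximum norm.  The point 0 is added so that a
   supremum over the empty set is 0. *)
Definition supnorm (D : set I) (f : I -> 'rV[R]_d) : \bar R :=
  ereal_sup (0%E |` [set `|f u|%:E | u in D]).

Definition tail (y : R) : set I := [set u | y < `|val u|].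

(* [C0], used as a type, carries the topology of the supremum norm (as a
   subspace of the space of all functions on I with the topology of uniform
   convergence); the condition at infinity is only imposed when I is the real
   line. *)
Definition C0 : set {uniform I -> 'rV[R]_d} :=
  [set f | continuous (f : I -> 'rV[R]_d) /\
    (I = setT -> supnorm (tail y) f @[y --> +oo] --> 0%E)].

End function_space.

Arguments C0 {R} I d : simpl never.

Section random_elements.

Definition borel (E : topologicalType) : set (set E) := <<s @open E >>.

Definition prod_sigma (E F : Type) (G : set (set E)) (H : set (set F)) :
    set (set (E * F)) :=
  <<s [set A `*` B | A in G & B in H] >>.

Definition random_element disp (T : measurableType disp) (E : Type)
    (G : set (set E)) (Y : T -> E) : Prop :=
  forall B, G B -> measurable (Y @^-1` B).

(* The sigma-algebra generated by (Y_i : i in D). *)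
Definition sigma_gen (T E : Type) (G : set (set E)) (Y : nat -> T -> E)
    (D : set nat) : set (set T) :=
  <<s \bigcup_(i in D) preimage_set_system setT (Y i) G >>.

Context {R : realType} disp (T : measurableType disp) (P : probability T R).

Definition alpha_coef (E : Type) (G : set (set E)) (Y : nat -> T -> E)
    (k : nat) : \bar R :=
  ereal_sup [set z | exists m A B,
    [/\ sigma_gen G Y [set i | (i <= m)%N] A,
        sigma_gen G Y [set i | (m + k <= i)%N] B &
        z = `|P (A `&` B) - P A * P B|%E]].

Definition alpha_mixing (E : Type) (G : set (set E)) (Y : nat -> T -> E) :=
  alpha_coef G Y k @[k --> \oo] --> 0%E.

Definition cov (Y Z : T -> R) : R := fine (covariance P Y Z).

Context (I : set R) (d : nat).

(* The real random variable X[k](u). *)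
Definition coord (X : T -> C0 I d) (k : 'I_d) (u : I) : T -> R :=
  fun w => val (X w) u ord0 k.

Definition mean (X : T -> C0 I d) (u : I) : 'rV[R]_d :=
  \row_k fine 'E_P[coord X k u].

Definition weakly_stationary (X : nat -> T -> C0 I d) : Prop :=
  (forall n u, mean (X n) u = mean (X 0%N) u) /\
  (forall n h k l u v,
     cov (coord (X n) k u) (coord (X (n + h)%N) l v) =
     cov (coord (X 0%N) k u) (coord (X h) l v)).

(* The long-run covariance kernel c[k,l](u,v). *)
Definition longrun_cov (X : nat -> T -> C0 I d) (k l : 'I_d) (u v : I) : R :=
  cov (coord (X 0%N) k u) (coord (X 0%N) l v) +
  limn (fun N => \sum_(1 <= n < N)
    (cov (coord (X 0%N) k u) (coord (X n) l v) +
     cov (coord (X n) k u) (coord (X 0%N) l v))).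

(* E (|Z(u) - Z(v)| / |u - v|^xi)^J *)
Definition holder_moment (Z : T -> C0 I d) (xi J : R) (u v : I) : \bar R :=
  (\int[P]_w (((`|val (Z w) u - val (Z w) v| / `|val u - val v| `^ xi) `^ J)
    %:E))%E.

(* X_(n,M) = A_M (X_n, delta_(n,M)) *)
Definition sparse (S : nat -> metricType R)
    (A : forall M, C0 I d * S M -> C0 I d)
    (X : nat -> T -> C0 I d) (delta : forall M, nat -> T -> S M)
    (M n : nat) : T -> C0 I d :=
  fun w => A M (X n w, delta M n w).

Record sparse_model (S : nat -> metricType R)
    (A : forall M, C0 I d * S M -> C0 I d)
    (X : nat -> T -> C0 I d) (delta : forall M, nat -> T -> S M)
    (Mseq : nat -> nat) : Prop := {
  sm_X : forall n, random_element (@borel (C0 I d)) (X n) ;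
  sm_delta : forall M n, random_element (@borel (S M)) (delta M n) ;
  sm_A : forall M B, borel B ->
    prod_sigma (@borel (C0 I d)) (@borel (S M)) (A M @^-1` B) ;
  sm_Mseq : Mseq @ \oo --> \oo }.

(* [XM M n] stands for X_(n,M); powers of norms are taken in \bar R. *)
Record assumptionA (S : nat -> metricType R)
    (X : nat -> T -> C0 I d) (delta : forall M, nat -> T -> S M)
    (XM : nat -> nat -> T -> C0 I d) (Mseq : nat -> nat)
    (J xi nu gamma C1 C2 C3 : R) : Prop := {
  A_const_pos : [/\ 0 < C1, 0 < nu, 0 < C2, 0 < C3 & 0 < gamma] ;
  A_stationary : weakly_stationary X ;
  A_mixing : forall M,
    alpha_mixing (prod_sigma (@borel (C0 I d)) (@borel (S M)))
      (fun n w => (X n w, delta M n w)) ;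
  A_rate : forall M n, (0 < n)%N ->
    (alpha_coef (prod_sigma (@borel (C0 I d)) (@borel (S M)))
       (fun n w => (X n w, delta M n w)) n <= (C1 * n%:R `^ (- nu))%:E)%E ;
  A_exponents : [/\ 4 < J, 1 / 2 < xi & 3 + 9 / (J - 4) < nu] ;
  A_moment : forall n,
    (\int[P]_w (supnorm setT (val (X n w)) `^ J) <= C2%:E)%E ;
  A_holder : forall n u v, u != v ->
    (holder_moment (X n) xi J u v <= C2%:E)%E ;
  A_approx : forall N n, (0 < N)%N ->
    (\int[P]_w (supnorm setT
        (fun u => (val (X n w) u - val (XM (Mseq N) n w) u)%R) `^ J)
      <= (C3 * N%:R `^ (- gamma))%:E)%E ;
  A_approx_holder : forall N n u v, (0 < N)%N -> u != v ->
    (holder_moment (XM (Mseq N) n) xi J u v <= C3%:E)%E }.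

Definition tail_decay (Z : T -> C0 I d) (kappa C5 : R) : Prop :=
  forall y : R, 0 < y ->
    (\int[P]_w (supnorm (tail y) (val (Z w)) ^+ 2)
      <= (C5 * expR (- (y `^ kappa)))%:E)%E.

(* The alternatives "fixed domain" and "infinite domain".  An increasing domain
   I_2(N), N >= 1, of compact intervals inside I_1 = R is incompatible with
   I_1 = I_2, the only situation considered here. *)
Definition assumptionB (X : nat -> T -> C0 I d)
    (XM : nat -> nat -> T -> C0 I d) : Prop :=
  (exists a b : R, a <= b /\ I = `[a, b]%classic) \/
  (I = setT /\ exists kappa C5 : R, [/\ 0 < kappa, 0 < C5,
    (forall n, tail_decay (X n) kappa C5) &
    (forall M n, tail_decay (XM M n) kappa C5)]).

End random_elements.

Section brownian_motion.
Context {R : realType} disp (T : measurableType disp) (P : probability T R).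

(* [normal_prob m 0] is not a point mass in the library. *)
Definition centered_normal (Z : T -> R) : Prop :=
  exists s : R, forall B : set R, measurable B ->
    P (Z @^-1` B) = if s == 0 then \d_(0 : R) B else normal_prob 0 s B.

Context (I : set R) (d : nat).

Definition centered_gaussian (Z : T -> I -> 'rV[R]_d) : Prop :=
  forall (m : nat) (a : 'I_m -> R) (u : 'I_m -> I) (k : 'I_m -> 'I_d),
    centered_normal (fun w => \sum_(j < m) a j * Z w (u j) ord0 (k j)).

(* Events about increments use Borel sets of the ambient space of all
   functions; their traces on C0 are exactly the Borel sets of C0. *)
Definition incr (W : R -> T -> C0 I d) (s t : R) :
    T -> {uniform I -> 'rV[R]_d} :=
  fun w u => val (W t w) u - val (W s w) u.

(* Only the values W x with x in [0, 1] matter. *)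
Record brownian_motion (c : 'I_d -> 'I_d -> I -> I -> R)
    (W : R -> T -> C0 I d) : Prop := {
  bm_measurable : forall x, 0 <= x <= 1 ->
    random_element (@borel (C0 I d)) (W x) ;
  bm_0 : forall w u, val (W 0 w) u = 0 ;
  bm_continuous : forall w, {within `[0, 1], continuous (fun x => W x w)} ;
  bm_stationary : forall s t h, 0 <= s -> 0 <= t -> 0 <= h ->
    s + h <= 1 -> t + h <= 1 ->
    forall B, borel B ->
      P (incr W s (s + h) @^-1` B) = P (incr W t (t + h) @^-1` B) ;
  bm_independent : forall (n : nat) (t : nat -> R),
    0 <= t 0%N -> t n <= 1 -> (forall i, (i < n)%N -> t i <= t i.+1) ->
    forall B : nat -> set {uniform I -> 'rV[R]_d},
      (forall i, borel (B i)) ->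
      P (\bigcap_(i in [set i | (i < n)%N])
           (incr W (t i) (t i.+1) @^-1` B i)) =
      (\prod_(i < n) P (incr W (t i) (t i.+1) @^-1` B i))%E ;
  bm_gaussian : forall s t, 0 <= s -> s <= t -> t <= 1 ->
    centered_gaussian (incr W s t) ;
  bm_cov : forall k l u v,
    cov P (coord (W 1) k u) (coord (W 1) l v) = c k l u v }.

(* sigma^2 = E ||W||^2, possibly infinite a priori. *)
Definition bm_sigma2 (W : R -> T -> C0 I d) : \bar R :=
  (\int[P]_w (ereal_sup
     [set supnorm setT (val (W x w)) | x in `[0%R, 1%R]%classic] ^+ 2))%E.

End brownian_motion.

(* Main.v *)
(** The Brownian motion matters only through c[k,k](u,u) <= sigma^2.  The
    coordinates are centered real processes x_i(r) with bounded fourth moments,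
    increments of size |r - s|^xi and mixing rate n^(-nu), nu > 3, so that by
    Davydov's inequality the covariances at lag h are summable, of order
    h^(-3/2), and a sum of n terms has second moment <= 3 sigma^2 n for n large.

    Along N = 2^k the maxima of partial sums satisfy a Gaussian-type exponential
    inequality: the summands are truncated and grouped in alternating blocks of
    a small power of N, and the exponential of a block sum is decoupled one
    block at a time, stopped at its first large value, so that the decoupling
    errors stay polynomially small.  This covers finite nets and the coarse
    levels of a dyadic chaining in r; on the fine levels, where the Hoelder
    bound with xi > 1/2 beats the number of grid points, Rademacher-Menshov and
    Chebyshev are enough.  Borel-Cantelli in k gives the bound, uniformly on
    [-l_k, l_k] with l_k polynomial in k, and on the line the tail hypothesis
    disposes of the complement. *)

Require Import Defs.
From HB Require Import structures.
From mathcomp Require Import all_boot all_order all_algebra.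
From mathcomp Require Import ring lra zify.
From mathcomp Require Import all_classical all_reals all_analysis.
From mathcomp Require Import measurable_realfun.
Set Implicit Arguments.
Unset Strict Implicit.
Unset Printing Implicit Defensive.
Import Order.TTheory GRing.Theory Num.Theory.
Import numFieldNormedType.Exports.
Local Open Scope classical_set_scope.
Local Open Scope ring_scope.

(** The constant has to be absolute, whereas the moment, Hoelder and mixing constants of the model
    are arbitrary. Only sigma may therefore enter at leading order, and every model constant is
    pushed to a place where it does not count: into how large n must be before the variance bound 3
    sigma^2 n holds, into the factor of a summable probability bound, or into the starting level of
    the chaining, which is chosen after all constants so that the increments together contribute at
    most sigma times the scale.

    On the line a second obstacle appears: the net in [-l_k, l_k] has a number of points polynomial
    in k, and a union bound over it would need a threshold growing with the degree of that
    polynomial. Points beyond a fixed distance Y are therefore treated apart. There the tail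
    hypothesis makes the variance rate as small as the degree requires, at the same threshold; the
    net points within Y are bounded in number, uniformly in k. *)

Lemma measurable_set_le {R : realType} d (T : measurableType d) (f g : T -> R) :
  measurable_fun setT f -> measurable_fun setT g -> measurable [set w | f w <= g w].
Proof.
move=> mf mg; have := measurable_fun_ler mf mg measurableT (Y := [set true]).
by rewrite setTI; apply.
Qed.

Lemma measurable_set_lt {R : realType} d (T : measurableType d) (f g : T -> R) :
  measurable_fun setT f -> measurable_fun setT g -> measurable [set w | f w < g w].
Proof.
move=> mf mg; have := measurable_fun_ltr mf mg measurableT (Y := [set true]).
by rewrite setTI; apply.
Qed.

(** * Expectation, probability and fourth moments *)

Section expectation.
Context {R : realType} disp {T : measurableType disp} (P : probability T R).
Implicit Types (f g : T -> R) (A B : set T).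

Definition integ f := P.-integrable setT (EFin \o f).
Definition Ex f : R := (\int[P]_w f w)%R.
Definition pr A : R := fine (P A).

Lemma integ_mf f : integ f -> measurable_fun setT f.
Proof. by move/measurable_int => /measurable_EFinP. Qed.

Lemma integ_le f g : measurable_fun setT f -> integ g ->
  (forall w, `|f w| <= g w) -> integ f.
Proof.
move=> mf ig fg; apply: le_integrable ig => //; first exact/measurable_EFinP.
by move=> w _ /=; rewrite lee_fin (le_trans (fg w))// ler_norm.
Qed.

Lemma integ_cst c : integ (fun=> c).
Proof. exact: finite_measure_integrable_cst. Qed.

Lemma integ_bnd f M : measurable_fun setT f -> (forall w, `|f w| <= M) -> integ f.
Proof. by move=> mf fM; apply: integ_le fM => //; exact: integ_cst. Qed.

Lemma integD f g : integ f -> integ g -> integ (fun w => f w + g w).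
Proof. by move=> If Ig; have := integrableD measurableT If Ig. Qed.

Lemma integN f : integ f -> integ (fun w => - f w).
Proof. by move=> If; have := integrableN If. Qed.

Lemma integZ c f : integ f -> integ (fun w => c * f w).
Proof. by move=> If; have := integrableZl measurableT c If. Qed.

Lemma integ_sum (I : Type) (s : seq I) (F : I -> T -> R) :
  (forall i, integ (F i)) -> integ (fun w => \sum_(i <- s) F i w).
Proof.
move=> IF; elim: s => [|i s IH].
  by under eq_fun do rewrite big_nil; exact: integ_cst.
by under eq_fun do rewrite big_cons; exact: integD.
Qed.

Lemma Ex_ext f g : f =1 g -> Ex f = Ex g.
Proof. by move=> /funext ->. Qed.

Lemma Ex_cst c : Ex (fun=> c) = c.
Proof. by rewrite /Ex Rintegral_cst//= probability_setT mulr1. Qed.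

Lemma ExD f g : integ f -> integ g -> Ex (fun w => f w + g w) = Ex f + Ex g.
Proof. exact: RintegralD. Qed.

Lemma ExB f g : integ f -> integ g -> Ex (fun w => f w - g w) = Ex f - Ex g.
Proof. exact: RintegralB. Qed.

Lemma ExZ c f : integ f -> Ex (fun w => c * f w) = c * Ex f.
Proof. exact: RintegralZl. Qed.

Lemma ExN f : integ f -> Ex (fun w => - f w) = - Ex f.
Proof.
move=> If; rewrite -mulN1r -ExZ//.
by apply: Ex_ext => w; rewrite mulN1r.
Qed.

Lemma Ex_sum (I : Type) (s : seq I) (F : I -> T -> R) :
  (forall i, integ (F i)) ->
  Ex (fun w => \sum_(i <- s) F i w) = \sum_(i <- s) Ex (F i).
Proof.
move=> IF; elim: s => [|i s IH].
  by under Ex_ext do rewrite big_nil; rewrite Ex_cst big_nil.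
under Ex_ext do rewrite big_cons.
by rewrite ExD ?IH ?big_cons//; exact: integ_sum.
Qed.

Lemma Ex_le f g : integ f -> integ g -> (forall w, f w <= g w) -> Ex f <= Ex g.
Proof. by move=> If Ig fg; apply: le_Rintegral. Qed.

Lemma Ex_ge0 f : (forall w, 0 <= f w) -> 0 <= Ex f.
Proof. by move=> f0; apply: Rintegral_ge0. Qed.

Lemma Ex_norm f : integ f -> `|Ex f| <= Ex (fun w => `|f w|).
Proof. by move=> If; apply: le_normr_Rintegral. Qed.

Lemma integ_norm f : integ f -> integ (fun w => `|f w|).
Proof.
move=> If; apply: (@integ_le _ (fun w => `|f w|)) => //.
- by apply: measurableT_comp => //; exact: integ_mf.
- by have := integrable_norm If.
- by move=> w; rewrite normr_id.
Qed.

Lemma EFin_Ex f : integ f -> (Ex f)%:E = (\int[P]_w (f w)%:E)%E.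
Proof. by move=> If; rewrite /Ex /Rintegral fineK//; exact: integrable_fin_num. Qed.

Lemma pr_ge0 A : 0 <= pr A. Proof. by rewrite /pr fine_ge0. Qed.

Lemma EFin_pr A : measurable A -> (pr A)%:E = P A.
Proof. by move=> mA; rewrite /pr fineK// fin_num_measure. Qed.

Lemma pr_mono A B : measurable A -> measurable B -> A `<=` B -> pr A <= pr B.
Proof.
by move=> mA mB AB; rewrite -lee_fin !EFin_pr// le_measure ?inE.
Qed.

Lemma integ_indic A : measurable A -> integ (\1_A).
Proof. by move=> mA; apply: integrable_indic. Qed.

Lemma Ex_indic A : measurable A -> Ex (\1_A) = pr A.
Proof. by move=> mA; rewrite /Ex /Rintegral integral_indic// setIT. Qed.

Lemma markov_ge f c : 0 < c -> integ f -> (forall w, 0 <= f w) ->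
  pr [set w | c < f w] <= Ex f / c.
Proof.
move=> c0 If f0; have mA : measurable [set w | c < f w].
  by apply: measurable_set_lt => //; exact: integ_mf If.
rewrite ler_pdivlMr// mulrC -Ex_indic// -ExZ; last exact: integ_indic.
apply: Ex_le => // [|w]; first by apply: integZ; exact: integ_indic.
rewrite indicE; case: (boolP (w \in _)) => [|_]; rewrite ?mulr0// mulr1 inE /= => /ltW//.
Qed.

Lemma pr_bigcup_le (A : nat -> set T) c : (forall i, measurable (A i)) ->
  (forall n, \sum_(i < n) pr (A i) <= c) -> pr (\bigcup_i A i) <= c.
Proof.
move=> mA H; have mU : measurable (\bigcup_i A i) by exact: bigcup_measurable.
rewrite -lee_fin EFin_pr//.
apply: (le_trans (measure_sigma_subadditive P mA mU (@subset_refl _ _))) => //.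
apply: lime_le; first by apply: is_cvg_nneseries => *; exact: measure_ge0.
apply: nearW => n; rewrite big_mkord.
rewrite (eq_bigr (fun i : 'I_n => (pr (A i))%:E)); last by move=> i _; rewrite EFin_pr.
by rewrite sumEFin lee_fin; exact: H.
Qed.

Lemma pr_bigsetU_le n (A : nat -> set T) : (forall i, measurable (A i)) ->
  pr (\big[setU/set0]_(i < n) A i) <= \sum_(i < n) pr (A i).
Proof.
move=> mA; rewrite -lee_fin EFin_pr; last by apply: bigsetU_measurable.
apply: (le_trans (Boole_inequality P _)) => //.
rewrite (eq_bigr (fun i : 'I_n => (pr (A i))%:E)) ?sumEFin//.
by move=> i _; rewrite EFin_pr.
Qed.

Lemma pr_setU_le A B : measurable A -> measurable B -> pr (A `|` B) <= pr A + pr B.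
Proof.
move=> mA mB; rewrite -lee_fin EFinD !EFin_pr//; last exact: measurableU.
exact: measureU2.
Qed.

(** Of the moments of order J > 4 only the fourth is kept: it makes products of two variables
    integrable and survives sums, truncation and centering. *)
Definition L4 f := measurable_fun setT f /\ integ (fun w => f w ^+ 4).

Lemma L4_mf f : L4 f -> measurable_fun setT f. Proof. by case. Qed.

Lemma L4_le f g : L4 g -> measurable_fun setT f -> (forall w, `|f w| <= `|g w|) -> L4 f.
Proof.
move=> [mg Ig] mf fg; split => //; apply: integ_le Ig _ => [|w].
  exact: measurable_funX.
rewrite normrX -[leRHS]ger0_norm ?exprn_even_ge0// normrX.
by rewrite lerXn2r ?nnegrE// fg.
Qed.

Lemma pow4D_le (a b : R) : (a + b) ^+ 4 <= 8 * (a ^+ 4 + b ^+ 4).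
Proof.
have h (x y : R) : (x + y) ^+ 2 <= 2 * (x ^+ 2 + y ^+ 2).
  by have := sqr_ge0 (x - y); nra.
rewrite (exprM _ 2 2) (exprM a 2 2) (exprM b 2 2).
have := h (a ^+ 2) (b ^+ 2); have := h a b; have := sqr_ge0 (a + b).
set X := (a + b) ^+ 2; set Y := a ^+ 2 + b ^+ 2; move=> X0 XY.
have : X ^+ 2 <= (2 * Y) ^+ 2 by rewrite lerXn2r ?nnegrE// (le_trans X0).
nra.
Qed.

Lemma L4D f g : L4 f -> L4 g -> L4 (fun w => f w + g w).
Proof.
move=> [mf If] [mg Ig]; have mfg := measurable_funD mf mg.
split => //; apply: (@integ_le _ (fun w => 8 * (f w ^+ 4 + g w ^+ 4))).
- exact: measurable_funX.
- by apply: integZ; exact: integD.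
- by move=> w; rewrite ger0_norm ?exprn_even_ge0// pow4D_le.
Qed.

Lemma L4Z c f : L4 f -> L4 (fun w => c * f w).
Proof.
move=> [mf If]; split; first exact: measurable_funM.
have := integZ (c ^+ 4) If; congr integ.
by apply/funext => w; rewrite exprMn.
Qed.

Lemma L4N f : L4 f -> L4 (fun w => - f w).
Proof. by move=> /(L4Z (-1)); congr L4; apply/funext => w; rewrite mulN1r. Qed.

Lemma L4B f g : L4 f -> L4 g -> L4 (fun w => f w - g w).
Proof. by move=> Lf /L4N Lg; exact: L4D. Qed.

Lemma L4_cst c : L4 (fun=> c).
Proof. by split; [exact: measurable_cst|exact: integ_cst]. Qed.

Lemma L4_sum (I : Type) (s : seq I) (F : I -> T -> R) :
  (forall i, L4 (F i)) -> L4 (fun w => \sum_(i <- s) F i w).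
Proof.
move=> IF; elim: s => [|i s IH].
  by under eq_fun do rewrite big_nil; exact: L4_cst.
by under eq_fun do rewrite big_cons; exact: L4D.
Qed.

Lemma L4_mul f g : L4 f -> L4 g -> integ (fun w => f w * g w).
Proof.
move=> [mf If] [mg Ig].
apply: (@integ_le _ (fun w => 1 + (f w ^+ 4 + g w ^+ 4))).
- exact: measurable_funM.
- by apply: integD; [exact: integ_cst|exact: integD].
- move=> w; rewrite (exprM (f w) 2 2) (exprM (g w) 2 2) ler_norml.
  have := sqr_ge0 (f w + g w); have := sqr_ge0 (f w - g w).
  have := sqr_ge0 (f w ^+ 2 - 1); have := sqr_ge0 (g w ^+ 2 - 1).
  by move=> *; apply/andP; split; nra.
Qed.

Lemma L4_int f : L4 f -> integ f.
Proof.
move=> Lf; have := L4_mul Lf (L4_cst 1); congr integ.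
by apply/funext => w; rewrite mulr1.
Qed.

Lemma L4_sqr f : L4 f -> integ (fun w => f w ^+ 2).
Proof. by move=> Lf; have := L4_mul Lf Lf. Qed.

Lemma L4_pow4 f : L4 f -> integ (fun w => f w ^+ 4). Proof. by case. Qed.

(** The arithmetic-mean form of Cauchy-Schwarz. Wherever it is applied both second moments have the
    same bound, so nothing is lost. *)
Lemma Ex_CS1 f g : L4 f -> L4 g ->
  `|Ex (fun w => f w * g w)| <= (Ex (fun w => f w ^+ 2) + Ex (fun w => g w ^+ 2)) / 2.
Proof.
move=> Lf Lg; have If := L4_sqr Lf; have Ig := L4_sqr Lg; have Ifg := L4_mul Lf Lg.
apply: (le_trans (Ex_norm Ifg)).
rewrite mulrC -ExD// -ExZ; last exact: integD.
apply: Ex_le => [||w]; [exact: integ_norm|by apply: integZ; exact: integD|].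
have := sqr_ge0 (f w + g w); have := sqr_ge0 (f w - g w).
by rewrite ler_norml => *; apply/andP; split; nra.
Qed.

Lemma Ex_sqr f : L4 f -> Ex f ^+ 2 <= Ex (fun w => f w ^+ 2).
Proof.
move=> Lf; have If := L4_int Lf; have Iff := L4_sqr Lf.
rewrite -subr_ge0; suff -> : Ex (fun w => f w ^+ 2) - Ex f ^+ 2 =
   Ex (fun w => (f w - Ex f) ^+ 2) by apply: Ex_ge0 => w; rewrite sqr_ge0.
rewrite (@Ex_ext (fun w => (f w - Ex f) ^+ 2) (fun w => f w ^+ 2 + (- (2 * Ex f) * f w + Ex f ^+ 2))); last first.
  by move=> w; ring.
rewrite !ExD ?ExZ ?Ex_cst//; first by ring.
all: by repeat (apply: integD || apply: integZ || apply: integ_cst || exact: If).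
Qed.

Lemma Ex_sqr4 f : L4 f -> Ex (fun w => f w ^+ 2) <= 1 + Ex (fun w => f w ^+ 4).
Proof.
move=> Lf; have I4 := L4_pow4 Lf; have I2 := L4_sqr Lf.
rewrite -[X in X + _](Ex_cst 1) -ExD//; last exact: integ_cst.
apply: Ex_le => // [|w]; first by apply: integD => //; exact: integ_cst.
by have := sqr_ge0 (f w ^+ 2 - 1); rewrite (exprM (f w) 2 2); nra.
Qed.

End expectation.

(** * Covariance inequalities under mixing *)

Section mixing.
Context {R : realType} disp {T : measurableType disp} (P : probability T R).
Implicit Types (G H : set (set T)) (f g : T -> R).
Local Notation Ex := (Ex P).
Local Notation pr := (pr P).
Local Notation integ := (integ P).
Local Notation L4 := (L4 P).

Definition smeas G (f : T -> R) :=
  @measurable_fun _ _ (g_sigma_algebraType G) R setT f.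

Definition submeas G := <<s G >> `<=` @measurable _ T.

Definition mix_le G H (a : R) := forall A B, <<s G >> A -> <<s H >> B ->
  `|pr (A `&` B) - pr A * pr B| <= a.

Lemma smeas_meas G f : submeas G -> smeas G f -> measurable_fun setT f.
Proof. by move=> sG mf _ B mB; apply: sG; exact: mf. Qed.

Lemma smeas_sub G H f : <<s G >> `<=` <<s H >> -> smeas G f -> smeas H f.
Proof. by move=> sG mf _ B mB; apply: sG; exact: mf. Qed.

(** The sum counts the integers from 1 to n that are at most y; it is the integer part of y. *)
Lemma count_le_bounds (n : nat) (y : R) : 0 <= y <= n%:R ->
  \sum_(j < n) (j.+1%:R <= y)%R%:R <= y <= \sum_(j < n) (j.+1%:R <= y)%R%:R + 1.
Proof.
elim: n => [|n IH] /andP[y0 yn].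
  by rewrite big_ord0 y0 add0r (le_trans yn).
rewrite big_ord_recr /=.
have [yn'|ny] := leP y n%:R.
  have -> : (n.+1%:R <= y) = false.
    by apply/negbTE; rewrite -ltNge (le_lt_trans yn')// ltr_nat.
  by rewrite addr0 IH// y0.
have E : \sum_(j < n) (j.+1%:R <= y)%R%:R = n%:R :> R.
  rewrite (eq_bigr (fun=> 1)) ?sumr_const ?card_ord// => j _.
  by rewrite (_ : (_ <= _) = true)//; apply: le_trans (ltW ny); rewrite ler_nat.
rewrite E; move: yn ny; rewrite -natr1; case: (leP (n%:R + 1) y) => /= *; apply/andP; split; lra.
Qed.

Section unit_interval.
Variables (G H : set (set T)) (a : R) (F K : T -> R).
Hypotheses (sG : submeas G) (sH : submeas H) (GH : mix_le G H a).
Hypotheses (mF : smeas G F) (mK : smeas H K).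
Hypotheses (F01 : forall w, 0 <= F w <= 1) (K01 : forall w, 0 <= K w <= 1).

Let lev (f : T -> R) n j := [set w | j.+1%:R <= n%:R * f w].
Let disc f n w := \sum_(j < n) n%:R^-1 * \1_(lev f n j) w : R.

Let lev_meas G' f n j : smeas G' f -> <<s G' >> (lev f n j).
Proof.
move=> mf.
apply: (@measurable_set_le R _ (g_sigma_algebraType G')); first exact: measurable_cst.
exact: measurable_funM.
Qed.

Let disc_bounds f n w : (0 < n)%N -> 0 <= f w <= 1 ->
  disc f n w <= f w <= disc f n w + n%:R^-1.
Proof.
move=> n0 /andP[f0 f1]; have nR : 0 < n%:R :> R by rewrite ltr0n.
have := @count_le_bounds n (n%:R * f w).
have -> : disc f n w = n%:R^-1 * \sum_(j < n) (j.+1%:R <= n%:R * f w)%R%:R.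
  rewrite /disc -mulr_sumr; congr (_ * _); apply: eq_bigr => j _.
  rewrite indicE; congr (_%:R); congr nat_of_bool.
  by apply/idP/idP; rewrite inE.
rewrite mulr_ge0 ?ler0n//= -[leRHS]mulr1 ler_pM2l// f1 => /(_ isT)/andP[h1 h2].
apply/andP; split; first by rewrite mulrC ler_pdivrMr// [leRHS]mulrC.
by rewrite -[X in _ + X]mulr1 -mulrDr [leRHS]mulrC ler_pdivlMr// mulrC.
Qed.

(* F is approximated from below by n^-1 times the sum of the indicators of its
   levels [j/n <= F], and K likewise. *)
Lemma unit_mix : Ex (fun w => F w * K w) <= Ex F * Ex K + a.
Proof.
have mF' := smeas_meas sG mF; have mK' := smeas_meas sH mK.
have iF : integ F.
  by apply: (@integ_bnd _ _ _ _ _ 1) => // w; have /andP[? ?] := F01 w; rewrite ger0_norm.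
have iK : integ K.
  by apply: (@integ_bnd _ _ _ _ _ 1) => // w; have /andP[? ?] := K01 w; rewrite ger0_norm.
have mA n j : <<s G >> (lev F n j) by exact: lev_meas.
have mB n j : <<s H >> (lev K n j) by exact: lev_meas.
have mA' n j : measurable (lev F n j) by apply: sG.
have mB' n j : measurable (lev K n j) by apply: sH.
have mAB n i j : measurable (lev F n i `&` lev K n j) by exact: measurableI.
have iA n j : integ (fun w => n%:R^-1 * \1_(lev F n j) w).
  by apply: integZ; exact: integ_indic.
have iB n j : integ (fun w => n%:R^-1 * \1_(lev K n j) w).
  by apply: integZ; exact: integ_indic.
have ExF0 : 0 <= Ex F by apply: Ex_ge0 => w; have /andP[] := F01 w.
apply/ler_addgt0Pr => e e0.
have [n ngt0 n3] : exists2 n, (0 < n)%N & 3 / n%:R <= e :> R.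
  exists (Num.truncn (3 / e)).+1 => //.
  by rewrite ler_pdivrMr// mulrC -ler_pdivrMr// ltW//; exact: truncnS_gt.
have n0 : 0 < n%:R :> R by rewrite ltr0n.
have iFK : integ (fun w => F w * K w).
  apply: (@integ_bnd _ _ _ _ _ 1) => [|w]; first exact: measurable_funM.
  have /andP[? ?] := F01 w; have /andP[? ?] := K01 w.
  by rewrite ger0_norm ?mulr_ge0// mulr_ile1.
have dF : Ex (disc F n) = \sum_(j < n) n%:R^-1 * pr (lev F n j).
  rewrite /disc Ex_sum//; apply: eq_bigr => j _.
  by rewrite ExZ ?Ex_indic//; exact: integ_indic.
have dK : Ex (disc K n) = \sum_(j < n) n%:R^-1 * pr (lev K n j).
  rewrite /disc Ex_sum//; apply: eq_bigr => j _.
  by rewrite ExZ ?Ex_indic//; exact: integ_indic.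
have E w : disc F n w * disc K n w =
   \sum_(i < n) \sum_(j < n) (n%:R^-1 * n%:R^-1) * \1_(lev F n i `&` lev K n j) w.
  rewrite /disc mulr_suml; apply: eq_bigr => i _.
  by rewrite mulr_sumr; apply: eq_bigr => j _; rewrite indicI /= mulrACA.
have iAB i j : integ (fun w => (n%:R^-1 * n%:R^-1) * \1_(lev F n i `&` lev K n j) w).
  by apply: integZ; exact: integ_indic.
have iABs i : integ (fun w => \sum_(j < n) (n%:R^-1 * n%:R^-1) * \1_(lev F n i `&` lev K n j) w).
  exact: integ_sum.
have dFK : Ex (fun w => disc F n w * disc K n w) =
   \sum_(i < n) \sum_(j < n) (n%:R^-1 * n%:R^-1) * pr (lev F n i `&` lev K n j).
  rewrite (Ex_ext _ E) Ex_sum//; apply: eq_bigr => i _.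
  rewrite Ex_sum//; apply: eq_bigr => j _.
  by rewrite ExZ ?Ex_indic//; exact: integ_indic.
have idF : integ (disc F n) by apply: integ_sum.
have idK : integ (disc K n) by apply: integ_sum.
have idFK : integ (fun w => disc F n w * disc K n w).
  by rewrite (funext E); exact: integ_sum.
(* In the product of [disc F n w + n%:R^-1] and [disc K n w + n%:R^-1] each of the three extra terms
   is at most 1/n; hence the 3 in the choice of [n]. *)
have le1 : Ex (fun w => F w * K w) <= Ex (fun w => disc F n w * disc K n w) + 3 / n%:R.
  rewrite -[X in _ + X](Ex_cst P) -ExD//; last exact: integ_cst.
  apply: Ex_le => // [|w]; first by apply: integD => //; exact: integ_cst.
  have /andP[f1 f2] := disc_bounds ngt0 (F01 w).
  have /andP[k1 k2] := disc_bounds ngt0 (K01 w).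
  have /andP[f3 f4] := F01 w; have /andP[k3 k4] := K01 w.
  have ge0 f : 0 <= disc f n w.
    by apply: sumr_ge0 => j _; rewrite mulr_ge0// ?invr_ge0 ?ler0n// indicE ler0n.
  have F0 := ge0 F; have K0 := ge0 K.
  have n1 : n%:R^-1 <= 1 :> R by rewrite invf_le1// ler1n.
  have n1' : 0 < n%:R^-1 :> R by rewrite invr_gt0.
  move: f1 f2 k1 k2; rewrite -/n; set x := disc F n w; set y := disc K n w; set z := n%:R^-1.
  move=> f1 f2 k1 k2.
  have := ler_pM f3 k3 f2 k2.
  have : x * z <= z by exact: ler_piMl (ltW n1') (le_trans f1 f4).
  have : z * y <= z by exact: ler_piMr (ltW n1') (le_trans k1 k4).
  have : z * z <= z by exact: ler_piMr (ltW n1') n1.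
  rewrite mulrDl !mulrDr; lra.
have le2 : Ex (fun w => disc F n w * disc K n w) <= Ex (disc F n) * Ex (disc K n) + a.
  rewrite dFK dF dK.
  (* As an average over the n^2 pairs of levels, [a] can be compared pair by pair with the mixing
     error. *)
  have -> : a = \sum_(i < n) \sum_(j < n) (n%:R^-1 * n%:R^-1) * a.
    rewrite !sumr_const card_ord -[RHS]mulr_natr -[X in X * _]mulr_natr.
    by field; rewrite lt0r_neq0.
  rewrite mulr_suml -big_split; apply: ler_sum => i _ /=.
  rewrite mulr_sumr -big_split; apply: ler_sum => j _ /=.
  rewrite mulrACA -mulrDr ler_wpM2l ?mulr_ge0 ?invr_ge0 ?ler0n//.
  by have := GH (mA n i) (mB n j); rewrite ler_norml => /andP[_]; rewrite lerBlDl.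
have le3 : Ex (disc F n) * Ex (disc K n) <= Ex F * Ex K.
  apply: ler_pM.
  - by apply: Ex_ge0 => w; apply: sumr_ge0 => j _; rewrite mulr_ge0// ?invr_ge0 ?ler0n// indicE ler0n.
  - by apply: Ex_ge0 => w; apply: sumr_ge0 => j _; rewrite mulr_ge0// ?invr_ge0 ?ler0n// indicE ler0n.
  - by apply: Ex_le => // w; have /andP[] := disc_bounds ngt0 (F01 w).
  - by apply: Ex_le => // w; have /andP[] := disc_bounds ngt0 (K01 w).
lra.
Qed.

End unit_interval.

(** Affine maps carry X and Y into [0, 1]. Shifts leave the covariance unchanged, and undoing the
    scalings by 2x and 2y produces the factor 4xy. *)
Lemma bounded_mix_le G H a (X Y : T -> R) x y : submeas G -> submeas H ->
  mix_le G H a -> smeas G X -> smeas H Y -> 0 < x -> 0 < y ->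
  (forall w, `|X w| <= x) -> (forall w, `|Y w| <= y) ->
  Ex (fun w => X w * Y w) - Ex X * Ex Y <= 4 * x * y * a.
Proof.
move=> sG sH GH mX mY x0 y0 Xx Yy.
have iX : integ X by apply: integ_bnd Xx; exact: smeas_meas mX.
have iY : integ Y by apply: integ_bnd Yy; exact: smeas_meas mY.
have iXY : integ (fun w => X w * Y w).
  apply: (@integ_bnd _ _ _ _ _ (x * y)) => [|w].
    by apply: measurable_funM; [exact: smeas_meas mX|exact: smeas_meas mY].
  by rewrite normrM ler_pM.
pose F w := (2 * x)^-1 * (X w + x); pose K w := (2 * y)^-1 * (Y w + y).
have F01 w : 0 <= F w <= 1.
  have := Xx w; rewrite ler_norml => /andP[? ?].
  rewrite /F [_^-1 * _]mulrC; apply/andP; split.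
    by rewrite divr_ge0//; lra.
  by rewrite ler_pdivrMr ?mulr_gt0//; lra.
have K01 w : 0 <= K w <= 1.
  have := Yy w; rewrite ler_norml => /andP[? ?].
  rewrite /K [_^-1 * _]mulrC; apply/andP; split.
    by rewrite divr_ge0//; lra.
  by rewrite ler_pdivrMr ?mulr_gt0//; lra.
have mF : smeas G F.
  apply: measurable_funM; first exact: measurable_cst.
  by apply: measurable_funD => //; exact: measurable_cst.
have mK : smeas H K.
  apply: measurable_funM; first exact: measurable_cst.
  by apply: measurable_funD => //; exact: measurable_cst.
have := unit_mix sG sH GH mF mK F01 K01.
have -> : Ex F = (2 * x)^-1 * (Ex X + x).
  by rewrite ExZ ?ExD ?Ex_cst//; [exact: integ_cst|apply: integD => //; exact: integ_cst].
have -> : Ex K = (2 * y)^-1 * (Ex Y + y).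
  by rewrite ExZ ?ExD ?Ex_cst//; [exact: integ_cst|apply: integD => //; exact: integ_cst].
have iR : integ (fun w => y * X w + (x * Y w + x * y)).
  by apply: integD; [exact: integZ|apply: integD; [exact: integZ|exact: integ_cst]].
rewrite (@Ex_ext _ _ _ P (fun w => F w * K w)
  (fun w => ((2 * x)^-1 * (2 * y)^-1) * (X w * Y w + (y * X w + (x * Y w + x * y))))); last first.
  by move=> w; rewrite /F /K; ring.
rewrite ExZ; last exact: integD.
rewrite !ExD ?ExZ ?Ex_cst//.
all: try by repeat (apply: integD || apply: integZ || apply: integ_cst || assumption).
move=> h; rewrite -subr_ge0.
have -> : 4 * x * y * a - (Ex (fun w => X w * Y w) - Ex X * Ex Y) = 4 * x * y *
  ((2 * x)^-1 * (Ex X + x) * ((2 * y)^-1 * (Ex Y + y)) + a - (2 * x)^-1 * (2 * y)^-1 *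
   (Ex (fun w => X w * Y w) + (y * Ex X + (x * Ex Y + x * y)))).
  by field; rewrite !lt0r_neq0.
by rewrite mulr_ge0 ?subr_ge0// !mulr_ge0// ltW.
Qed.

(** The lower bound is the upper bound for [- X], which is measurable for the same sigma-algebra. *)
Lemma bounded_mix G H a (X Y : T -> R) x y : submeas G -> submeas H ->
  mix_le G H a -> smeas G X -> smeas H Y -> 0 < x -> 0 < y ->
  (forall w, `|X w| <= x) -> (forall w, `|Y w| <= y) ->
  `|Ex (fun w => X w * Y w) - Ex X * Ex Y| <= 4 * x * y * a.
Proof.
move=> sG sH GH mX mY x0 y0 Xx Yy.
have iX : integ X by apply: integ_bnd Xx; exact: smeas_meas mX.
have iXY : integ (fun w => X w * Y w).
  apply: (@integ_bnd _ _ _ _ _ (x * y)) => [|w].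
    by apply: measurable_funM; [exact: smeas_meas mX|exact: smeas_meas mY].
  by rewrite normrM ler_pM.
rewrite ler_norml; apply/andP; split; last exact: bounded_mix_le GH _ _ _ _ _ _.
have mX' : smeas G (fun w => - X w) by exact: measurableT_comp.
have Nx w : `|- X w| <= x by rewrite normrN.
have := bounded_mix_le sG sH GH mX' mY x0 y0 Nx Yy.
rewrite ExN// (@Ex_ext _ _ _ P _ (fun w => - (X w * Y w))); last by move=> w; rewrite mulNr.
by rewrite ExN//; lra.
Qed.

End mixing.

Section davydov.
Context {R : realType} disp {T : measurableType disp} (P : probability T R).
Implicit Types (G H : set (set T)) (f g : T -> R).
Local Notation Ex := (Ex P).
Local Notation integ := (integ P).
Local Notation L4 := (L4 P).

Definition trunc (x : R) f w := if `|f w| <= x then f w else 0.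

Lemma trunc_meas d (T' : measurableType d) (x : R) (f : T' -> R) :
  measurable_fun setT f -> measurable_fun setT (fun w => if `|f w| <= x then f w else 0).
Proof.
move=> mf; apply: measurable_fun_ifT => //; apply: measurable_fun_ler => //.
exact: measurableT_comp.
Qed.

Lemma trunc_smeas G x f : smeas G f -> smeas G (trunc x f).
Proof. exact: trunc_meas. Qed.

Lemma trunc_le (x : R) f w : 0 <= x -> `|trunc x f w| <= x.
Proof. by move=> x0; rewrite /trunc; case: ifP => //; rewrite normr0. Qed.

Lemma L4_trunc x f : L4 f -> L4 (trunc x f).
Proof.
move=> Lf; apply: (L4_le Lf); first by apply: trunc_meas; case: Lf.
by move=> w; rewrite /trunc; case: ifP => //; rewrite normr0.
Qed.

(** Where f is cut off, |f| > x, so three of the four factors |f| can be traded for x. *)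
Lemma tail_pow3 (x : R) f w : 0 < x -> `|f w - trunc x f w| * x ^+ 3 <= f w ^+ 4.
Proof.
move=> x0; rewrite /trunc; case: (leP `|f w| x) => [_|xf].
  by rewrite subrr normr0 mul0r exprn_even_ge0.
rewrite subr0 -[leRHS]ger0_norm ?exprn_even_ge0// normrX (exprS `|f w|) ler_wpM2l//.
by rewrite lerXn2r ?nnegrE// ltW.
Qed.

Lemma tail_pow2 (x : R) f w : 0 < x -> (f w - trunc x f w) ^+ 2 * x ^+ 2 <= f w ^+ 4.
Proof.
move=> x0; rewrite /trunc; case: (leP `|f w| x) => [_|xf].
  by rewrite subrr expr0n mul0r exprn_even_ge0.
rewrite subr0 (exprD _ 2 2) ler_wpM2l ?sqr_ge0//.
by rewrite -[leRHS]real_normK ?num_real// lerXn2r ?nnegrE// ltW.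
Qed.

Lemma Ex_tail1 x f : 0 < x -> L4 f ->
  Ex (fun w => `|f w - trunc x f w|) <= Ex (fun w => f w ^+ 4) / x ^+ 3.
Proof.
move=> x0 Lf; have L4t := L4B Lf (L4_trunc x Lf).
rewrite ler_pdivlMr ?exprn_gt0// mulrC -ExZ; last exact/integ_norm/(L4_int L4t).
apply: Ex_le => [||w]; [exact/integZ/integ_norm/(L4_int L4t)|exact: L4_pow4|].
by rewrite mulrC; exact: tail_pow3.
Qed.

Lemma Ex_tail2 x f : 0 < x -> L4 f ->
  Ex (fun w => (f w - trunc x f w) ^+ 2) <= Ex (fun w => f w ^+ 4) / x ^+ 2.
Proof.
move=> x0 Lf; have L4t := L4B Lf (L4_trunc x Lf).
rewrite ler_pdivlMr ?exprn_gt0// mulrC -ExZ; last exact: L4_sqr L4t.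
apply: Ex_le => [||w]; [by apply: integZ; exact: L4_sqr L4t|exact: L4_pow4|].
by rewrite mulrC; exact: tail_pow2.
Qed.

Definition covr f g := Ex (fun w => f w * g w) - Ex f * Ex g.

Lemma covrDl f g h : L4 f -> L4 g -> L4 h ->
  covr (fun w => f w + g w) h = covr f h + covr g h.
Proof.
move=> Lf Lg Lh; rewrite /covr (@Ex_ext _ _ _ P _ (fun w => f w * h w + g w * h w)).
  by rewrite !ExD; try (exact: L4_mul || exact: L4_int); ring.
by move=> w; rewrite mulrDl.
Qed.

Lemma covrC f g : covr f g = covr g f.
Proof.
rewrite /covr [Ex f * _]mulrC; congr (_ - _).
by apply: Ex_ext => w; rewrite mulrC.
Qed.

Lemma covr_le f g x b : 0 < x -> 0 <= b -> L4 f -> L4 g -> (forall w, `|f w| <= x) ->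
  Ex (fun w => `|g w|) <= b / x -> `|covr f g| <= b + b.
Proof.
move=> x0 b0 Lf Lg fx gb; have Ig := L4_int Lg.
have Efg : `|Ex (fun w => f w * g w)| <= b.
  apply: (le_trans (Ex_norm (L4_mul Lf Lg))).
  apply: (@le_trans _ _ (x * Ex (fun w => `|g w|))).
    rewrite -ExZ; last exact: integ_norm.
    apply: Ex_le => [||w]; [exact/integ_norm/L4_mul|exact/integZ/integ_norm|].
    by rewrite normrM ler_wpM2r.
  by rewrite mulrC -ler_pdivlMr.
have Ef : `|Ex f| <= x.
  apply: (le_trans (Ex_norm (L4_int Lf))); rewrite -[leRHS](Ex_cst P).
  by apply: Ex_le => //; [exact/integ_norm/L4_int|exact: integ_cst].
have Eg : `|Ex f * Ex g| <= b.
  rewrite normrM -[leRHS](divfK (lt0r_neq0 x0)) mulrC ler_pM//.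
  exact: le_trans (Ex_norm Ig) gb.
by apply: (le_trans (ler_normB _ _)); exact: lerD.
Qed.

Lemma covr_le2 f g b : L4 f -> L4 g -> Ex (fun w => f w ^+ 2) <= b ->
  Ex (fun w => g w ^+ 2) <= b -> `|covr f g| <= b + b.
Proof.
move=> Lf Lg fb gb; apply: (le_trans (ler_normB _ _)); apply: lerD.
  by apply: (le_trans (Ex_CS1 Lf Lg)); lra.
have := Ex_sqr Lf; have := Ex_sqr Lg.
have := sqr_ge0 (Ex f + Ex g); have := sqr_ge0 (Ex f - Ex g).
by move=> *; rewrite ler_norml; apply/andP; split; nra.
Qed.

(* Both variables are truncated at the level x with x^2 = b / s. *)
Lemma davydov G H a s b X Y : submeas G -> submeas H -> mix_le P G H a ->
  0 < s -> 0 < b -> a <= s ^+ 2 -> smeas G X -> smeas H Y -> L4 X -> L4 Y ->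
  Ex (fun w => X w ^+ 4) <= b ^+ 2 -> Ex (fun w => Y w ^+ 4) <= b ^+ 2 ->
  `|covr X Y| <= 10 * b * s.
Proof.
move=> sG sH GH s0 b0 as2 mX mY LX LY X4 Y4.
pose x := Num.sqrt (b / s); have x0 : 0 < x by rewrite sqrtr_gt0 divr_gt0.
have x2 : x ^+ 2 = b / s by rewrite sqr_sqrtr// ltW// divr_gt0.
have LX' := L4_trunc x LX; have LY' := L4_trunc x LY.
have LX2 := L4B LX LX'; have LY2 := L4B LY LY'.
have bs : b ^+ 2 / x ^+ 2 = b * s by rewrite x2; field; rewrite !lt0r_neq0.
have t1 f : L4 f -> Ex (fun w => f w ^+ 4) <= b ^+ 2 ->
    Ex (fun w => `|f w - trunc x f w|) <= b * s / x.
  move=> Lf f4; apply: (le_trans (Ex_tail1 x0 Lf)).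
  rewrite -bs -mulrA -invfM -exprSr ler_wpM2r// invr_ge0 exprn_ge0//.
  exact: ltW.
have t2 f : L4 f -> Ex (fun w => f w ^+ 4) <= b ^+ 2 ->
    Ex (fun w => (f w - trunc x f w) ^+ 2) <= b * s.
  move=> Lf f4; apply: (le_trans (Ex_tail2 x0 Lf)).
  by rewrite -bs ler_wpM2r// invr_ge0 exprn_ge0// ltW.
have bs0 : 0 <= b * s by rewrite mulr_ge0 ?ltW.
have E1 : `|covr (trunc x X) (trunc x Y)| <= 4 * (b * s).
  have := bounded_mix sG sH GH (trunc_smeas x mX) (trunc_smeas x mY) x0 x0
    (fun w => trunc_le X w (ltW x0)) (fun w => trunc_le Y w (ltW x0)).
  move/le_trans; apply.
  rewrite (_ : 4 * x * x * a = 4 * (x ^+ 2 * a)); last by ring.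
  rewrite ler_wpM2l// x2.
  rewrite (_ : b * s = b / s * s ^+ 2); last by field; rewrite lt0r_neq0.
  by rewrite ler_wpM2l// divr_ge0// ltW.
have E2 := covr_le x0 bs0 LX' LY2 (fun w => trunc_le X w (ltW x0)) (t1 _ LY Y4).
have E3 := covr_le x0 bs0 LY' LX2 (fun w => trunc_le Y w (ltW x0)) (t1 _ LX X4).
have E4 := covr_le2 LX2 LY2 (t2 _ LX X4) (t2 _ LY Y4).
have split f : f = (fun w => trunc x f w + (f w - trunc x f w)).
  by apply/funext => w; rewrite addrC subrK.
(* Bilinearity gives four covariances. In units of b s, the bounded pair costs 4 and each of the
   three terms with a tail costs 2, which makes 10. *)
have -> : covr X Y = covr (trunc x X) (trunc x Y) +
    covr (trunc x X) (fun w => Y w - trunc x Y w) +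
    (covr (trunc x Y) (fun w => X w - trunc x X w) +
     covr (fun w => X w - trunc x X w) (fun w => Y w - trunc x Y w)).
  rewrite {1}(split X) covrDl//; congr (_ + _).
    by rewrite covrC {1}(split Y) covrDl// covrC; congr (_ + _); rewrite covrC.
  rewrite covrC {1}(split Y) covrDl//; congr (_ + _).
  by rewrite covrC.
rewrite -mulrA; move: E1 E2 E3 E4 bs0; set v := b * s.
rewrite !ler_norml => /andP[? ?] /andP[? ?] /andP[? ?] /andP[? ?] ?.
by apply/andP; split; lra.
Qed.

End davydov.

(** * Summable covariances and second moments of partial sums *)

Section covariance_sums.
Context {R : realType}.

(* The square root of the mixing rate C / h^3; by Davydov it bounds the
   covariances at lag h. *)
Definition cdecay (C : R) (h : nat) : R := Num.sqrt C / (h%:R * Num.sqrt h%:R).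

(** A discrete primitive of h^(-3/2). The factor 4 leaves room for the crude bound sqrt (h + 1) <=
    3/2 sqrt h, since 3/2 * 5/2 <= 4. *)
Lemma inv_sqrt_telescope (h : nat) : (0 < h)%N ->
  (h%:R * Num.sqrt h%:R)^-1 <= 4 * ((Num.sqrt h%:R)^-1 - (Num.sqrt h.+1%:R)^-1) :> R.
Proof.
move=> h0; set x := Num.sqrt h%:R; set y := Num.sqrt h.+1%:R.
have x1 : 1 <= x by rewrite -sqrtr1 ler_sqrt ?ler1n ?ler0n.
have xE : x ^+ 2 = h%:R by rewrite sqr_sqrtr.
have yE : y ^+ 2 = x ^+ 2 + 1 by rewrite xE sqr_sqrtr// natr1.
have y0 : 0 < y by rewrite sqrtr_gt0 ltr0n.
have x0 : 0 < x by apply: lt_le_trans x1.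
have xy : y <= 3 / 2 * x.
  rewrite leNgt; apply/negP => yx.
  have : 0 < (y - 3 / 2 * x) * (y + 3 / 2 * x) by apply: mulr_gt0; lra.
  nra.
rewrite -xE.
have xy' : y - x = (y + x)^-1.
  by apply/(mulIf (lt0r_neq0 (addr_gt0 y0 x0))); rewrite mulVf ?lt0r_neq0 ?addr_gt0//; nra.
have -> : x^-1 - y^-1 = (x * y * (y + x))^-1.
  by rewrite invfM -xy'; field; rewrite !lt0r_neq0.
rewrite ler_pdivlMr; last by rewrite !mulr_gt0// addr_gt0.
rewrite mulrC ler_pdivrMr ?mulr_gt0 ?exprn_gt0//.
have : y * y <= (3 / 2 * x) * y by rewrite ler_wpM2r// ltW.
nra.
Qed.

Lemma cdecay_sum_le (C : R) (m q : nat) : (0 < m)%N ->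
  \sum_(i < q) cdecay C (m + i) <= 4 * Num.sqrt C / Num.sqrt m%:R.
Proof.
move=> m0.
suff : \sum_(i < q) cdecay C (m + i) <=
    4 * Num.sqrt C * ((Num.sqrt m%:R)^-1 - (Num.sqrt (m + q)%:R)^-1).
  move/le_trans; apply; rewrite ler_wpM2l ?mulr_ge0 ?sqrtr_ge0//.
  by rewrite gerBl invr_ge0 sqrtr_ge0.
elim: q => [|q IH]; first by rewrite big_ord0 addn0 subrr mulr0.
rewrite big_ord_recr /=; have mq : (0 < m + q)%N by rewrite addn_gt0 m0.
have := ler_wpM2l (sqrtr_ge0 C) (inv_sqrt_telescope mq); rewrite addnS.
rewrite /cdecay in IH *; lra.
Qed.

Lemma cdecay_gt0 (C : R) h : 0 < C -> (0 < h)%N -> 0 < cdecay C h.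
Proof. by move=> C0 h0; rewrite divr_gt0 ?mulr_gt0 ?sqrtr_gt0 ?ltr0n. Qed.

(** This brings the mixing rate into the form a <= s^2 required by [davydov]; comparing h^(-nu) with
    h^(-3) is where nu > 3 enters. *)
Lemma cdecay_sqr (C nu : R) h : 0 < C -> 3 < nu -> (0 < h)%N ->
  C * h%:R `^ (- nu) <= cdecay C h ^+ 2.
Proof.
move=> C0 nu3 h0; have h1 : 1 <= h%:R :> R by rewrite ler1n.
have C0' := ltW C0; rewrite /cdecay expr_div_n sqr_sqrtr// ler_wpM2l//.
rewrite exprMn sqr_sqrtr// -exprSr powRN lef_pV2 ?posrE ?exprn_gt0 ?powR_gt0 ?ltr0n//.
by rewrite -powR_mulrn ?ler0n// ler_powR//; exact: ltW.
Qed.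

End covariance_sums.

Section sums.
Context {R : realType} disp {T : measurableType disp} (P : probability T R).
Local Notation Ex := (Ex P).
Local Notation integ := (integ P).
Local Notation L4 := (L4 P).
Implicit Types Z : nat -> T -> R.

Definition psum Z a q (w : T) : R := \sum_(i < q) Z (a + i)%N w.

Lemma psum0 Z a w : psum Z a 0 w = 0. Proof. by rewrite /psum big_ord0. Qed.

Lemma psumS Z a q w : psum Z a q.+1 w = psum Z a q w + Z (a + q)%N w.
Proof. by rewrite /psum big_ord_recr. Qed.

Lemma psum_split Z a p q w : psum Z a (p + q) w = psum Z a p w + psum Z (a + p) q w.
Proof.
rewrite /psum big_split_ord /=; congr (_ + _).
by apply: eq_bigr => i _; rewrite addnA.
Qed.

Lemma psum_blocks Z q n w : psum Z 0 (n * q) w = \sum_(i < n) psum Z (i * q) q w.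
Proof.
elim: n => [|n IH]; first by rewrite mul0n psum0 big_ord0.
by rewrite mulSn addnC psum_split big_ord_recr /= IH.
Qed.

Lemma L4_psum Z a q : (forall i, L4 (Z i)) -> L4 (psum Z a q).
Proof. by move=> LZ; apply: L4_sum. Qed.

Lemma Ex_psum_sqrS Z a q : (forall i, L4 (Z i)) ->
  Ex (fun w => psum Z a q.+1 w ^+ 2) = Ex (fun w => psum Z a q w ^+ 2) +
    (Ex (fun w => Z (a + q)%N w ^+ 2) +
     2 * \sum_(i < q) Ex (fun w => Z (a + i)%N w * Z (a + q)%N w)).
Proof.
move=> LZ; have LS := L4_psum a q LZ.
rewrite (@Ex_ext _ _ _ P _ (fun w => psum Z a q w ^+ 2 + (Z (a + q)%N w ^+ 2 +
    2 * \sum_(i < q) Z (a + i)%N w * Z (a + q)%N w))); last first.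
  by move=> w; rewrite psumS -mulr_suml -/(psum Z a q w); ring.
have Is : integ (fun w => \sum_(i < q) Z (a + i)%N w * Z (a + q)%N w).
  by apply: integ_sum => i; exact: L4_mul.
rewrite !ExD; [|exact: L4_sqr|exact: integZ|exact: L4_sqr|].
  by rewrite ExZ// Ex_sum// => i; exact: L4_mul.
by apply: integD; [exact: L4_sqr|exact: integZ].
Qed.

Lemma psum_sqr_le Z (v D : R) : (forall i, L4 (Z i)) -> (forall i, Ex (fun w => Z i w ^+ 2) <= v) ->
  (forall a q, \sum_(i < q) Ex (fun w => Z (a + i)%N w * Z (a + q)%N w) <= D) ->
  forall a q, Ex (fun w => psum Z a q w ^+ 2) <= q%:R * (v + 2 * D).
Proof.
move=> LZ Zv ZD a; elim=> [|q IH].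
  rewrite mul0r (@Ex_ext _ _ _ P _ (fun=> 0)) ?Ex_cst// => w.
  by rewrite psum0 expr0n.
rewrite Ex_psum_sqrS// -[q.+1%:R]natr1 [leRHS]mulrDl mul1r; apply: lerD => //; apply: lerD => //; exact: ler_wpM2l.
Qed.

End sums.

Lemma sum_rev_sub {R : realType} (F : nat -> R) q :
  \sum_(i < q) F (q - i)%N = \sum_(i < q) F i.+1.
Proof.
rewrite (reindex_inj rev_ord_inj) /=; apply: eq_bigr => i _.
by rewrite subKn.
Qed.

Section mixing_sequences.
Context {R : realType} disp {T : measurableType disp} (P : probability T R).
Local Notation Ex := (Ex P).
Local Notation integ := (integ P).
Local Notation L4 := (L4 P).
Implicit Types Z : nat -> T -> R.

(* [past a] is generated by the variables of index < a and [fut b] by those of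
   index >= b. *)
Definition mixing_system (past fut : nat -> set (set T)) (C nu : R) :=
  [/\ (forall n, submeas (past n)), (forall n, submeas (fut n)),
      (forall m n, (m <= n)%N -> <<s past m >> `<=` <<s past n >>),
      (forall m n, (m <= n)%N -> <<s fut n >> `<=` <<s fut m >>) &
      (forall a b, (a <= b)%N ->
         mix_le P (past a) (fut b) (C * (b - a).+1%:R `^ (- nu)))].

Definition adapted (past fut : nat -> set (set T)) Z :=
  forall i, smeas (past i.+1) (Z i) /\ smeas (fut i) (Z i).

Variables (past fut : nat -> set (set T)) (C nu : R).
Hypotheses (C0 : 0 < C) (nu3 : 3 < nu) (ms : mixing_system past fut C nu).

Section one_sequence.
Variables (Z : nat -> T -> R) (b : R).
Hypotheses (b0 : 0 < b) (aZ : adapted past fut Z) (LZ : forall i, L4 (Z i)).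
Hypotheses (Z0 : forall i, Ex (Z i) = 0) (Z4 : forall i, Ex (fun w => Z i w ^+ 4) <= b ^+ 2).

Lemma covar_le i j : (i < j)%N ->
  `|Ex (fun w => Z i w * Z j w)| <= 10 * b * cdecay C (j - i).
Proof.
move=> ij; case: ms => sp sf _ _ mx; have [aZi _] := aZ i; have [_ aZj] := aZ j.
have ji : (0 < j - i)%N by rewrite subn_gt0.
have := davydov (sp i.+1) (sf j) (mx _ _ ij) (cdecay_gt0 C0 ji) b0 _ aZi aZj (LZ i) (LZ j)
  (Z4 i) (Z4 j).
rewrite /covr !Z0 mulr0 subr0; apply.
(* [Z i] belongs to [past i.+1], so the gap is j - (i + 1); the successor in the mixing rate
   restores the lag j - i. *)
by rewrite -subSn// subSS; exact: cdecay_sqr.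
Qed.

(** Jensen's inequality, obtained from 2 z^2 <= b + z^4 / b. *)
Lemma sqr_le i : Ex (fun w => Z i w ^+ 2) <= b.
Proof.
have := Ex_sqr4 (L4Z (Num.sqrt b)^-1 (LZ i)).
have sb0 : 0 < Num.sqrt b by rewrite sqrtr_gt0.
have sb2 : Num.sqrt b ^+ 2 = b by rewrite sqr_sqrtr// ltW.
have LZi := L4Z (Num.sqrt b)^-1 (LZ i).
have h2 : 2 * Ex (fun w => Z i w ^+ 2) <= b + b^-1 * Ex (fun w => Z i w ^+ 4).
  rewrite -[X in X + _](Ex_cst P) -!ExZ//; [|exact: L4_pow4|exact: L4_sqr].
  rewrite -ExD; [|exact: integ_cst|by apply: integZ; exact: L4_pow4].
  apply: Ex_le => [||w]; first by apply: integZ; exact: L4_sqr.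
    by apply: integD; [exact: integ_cst|apply: integZ; exact: L4_pow4].
  rewrite (exprM _ 2 2) -subr_ge0.
  rewrite (_ : _ - _ = b^-1 * (Z i w ^+ 2 - b) ^+ 2); last by field; rewrite lt0r_neq0.
  by rewrite mulr_ge0 ?sqr_ge0// invr_ge0 ltW.
move=> _; have : b^-1 * Ex (fun w => Z i w ^+ 4) <= b^-1 * b ^+ 2.
  by rewrite ler_wpM2l// invr_ge0 ltW.
by rewrite expr2 mulKf ?lt0r_neq0//; lra.
Qed.

Lemma covar_sum_le a q :
  \sum_(i < q) Ex (fun w => Z (a + i)%N w * Z (a + q)%N w) <= 40 * b * Num.sqrt C.
Proof.
apply: (@le_trans _ _ (\sum_(i < q) 10 * b * cdecay C (q - i))).
  apply: ler_sum => i _; apply: (le_trans (ler_norm _)).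
  apply: (le_trans (covar_le _)); first by rewrite ltn_add2l.
  by rewrite subnDl.
rewrite -mulr_sumr (sum_rev_sub (cdecay C)).
have := cdecay_sum_le C q (ltn0Sn 0); rewrite sqrtr1 divr1.
under eq_bigr do rewrite add1n.
move=> h; apply: (le_trans (ler_wpM2l _ h)); first by rewrite mulr_ge0// ltW.
lra.
Qed.

(** Valid for every q, but with a model constant. It is proportional to [b], so for increments in
    the parameter, whose fourth moments are bounded by the square of [b * rho ^+ (2 * j)], it
    becomes small with their distance. *)
Lemma psum_sqr_le_unif a q :
  Ex (fun w => psum Z a q w ^+ 2) <= q%:R * ((1 + 80 * Num.sqrt C) * b).
Proof.
apply: (le_trans (psum_sqr_le LZ sqr_le covar_sum_le a q)).
by rewrite ler_wpM2l//; lra.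
Qed.

(** Lags up to H are bounded by the small second moment [e], longer lags by the mixing decay.
    Choosing first H and then e makes the variance rate as small as desired. *)
Lemma psum_sqr_le_small e H : 0 < e -> (forall i, Ex (fun w => Z i w ^+ 2) <= e) ->
  forall a q, Ex (fun w => psum Z a q w ^+ 2) <=
    q%:R * (e + 2 * (H%:R * e + 40 * b * Num.sqrt C / Num.sqrt H.+1%:R)).
Proof.
move=> e0 Ze; apply: psum_sqr_le => // a q.
have cle i j : `|Ex (fun w => Z i w * Z j w)| <= e.
  apply: (le_trans (Ex_CS1 (LZ i) (LZ j))).
  by have := Ze i; have := Ze j; lra.
pose F h := if (h <= H)%N then e else 10 * b * cdecay C h.
apply: (@le_trans _ _ (\sum_(i < q) F (q - i)%N)).
  apply: ler_sum => i _; apply: (le_trans (ler_norm _)); rewrite /F; case: ifP => // _.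
  apply: (le_trans (covar_le _)); first by rewrite ltn_add2l.
  by rewrite subnDl.
rewrite (sum_rev_sub F).
have tail0 : 0 <= 40 * b * Num.sqrt C / Num.sqrt H.+1%:R.
  by rewrite !mulr_ge0 ?invr_ge0 ?sqrtr_ge0// ltW.
have head p : (p <= H)%N -> \sum_(i < p) F i.+1 <= H%:R * e.
  move=> pH; rewrite (eq_bigr (fun=> e)) => [|i _]; last first.
    by rewrite /F (leq_trans (ltn_ord i)).
  by rewrite sumr_const card_ord -[_ *+ p]mulr_natl ler_wpM2r ?ler_nat// ltW.
have [qH|Hq] := leqP q H; first by apply: (le_trans (head _ qH)); rewrite lerDl.
rewrite -(subnKC (ltnW Hq)) big_split_ord /= lerD ?head//.
rewrite (eq_bigr (fun i : 'I_(q - H) => 10 * b * cdecay C (H.+1 + i))); last first.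
  by move=> i _; rewrite /F addSn ltnNge leq_addr.
rewrite -mulr_sumr; apply: (le_trans (ler_wpM2l _ (cdecay_sum_le C _ (ltn0Sn H)))).
  by rewrite mulr_ge0// ltW.
by rewrite !mulrA ler_wpM2r ?invr_ge0 ?sqrtr_ge0//; lra.
Qed.

Section stationary.
Variables (gam : nat -> R) (c sigma2 : R).
Hypothesis gamE : forall i h, Ex (fun w => Z i w * Z (i + h)%N w) = gam h.
Hypothesis gam_lim : gam 0%N + 2 * \sum_(1 <= h < n) gam h @[n --> \oo] --> c.
Hypotheses (s0 : 0 < sigma2) (cs : c <= sigma2).

(** The partial sum misses its limit only by the covariances of lag greater than m, whose sum is
    bounded by the decay; the 80 is 2 * 40. *)
Lemma gam_partial_le m :
  gam 0%N + 2 * \sum_(i < m) gam i.+1 <= sigma2 + 80 * b * Num.sqrt C / Num.sqrt m.+1%:R.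
Proof.
have gle h : (0 < h)%N -> `|gam h| <= 10 * b * cdecay C h.
  by move=> h0; rewrite -(gamE 0) (le_trans (covar_le _))// subn0.
rewrite -lerBlDr; apply: le_trans cs; rewrite -(cvg_lim _ gam_lim)//.
apply: limr_ge; first by apply/cvg_ex; exists c.
near=> n.
have mn : (m.+1 <= n)%N by near: n; exact: nbhs_infty_ge.
rewrite -(subnKC mn) (big_cat_nat (n := m.+1))//=; last by rewrite leq_addr.
rewrite big_add1 big_mkord /=.
suff : - \sum_(m.+1 <= i < m.+1 + (n - m.+1)) gam i <=
    40 * b * Num.sqrt C / Num.sqrt m.+1%:R by lra.
rewrite -sumrN -{1}[m.+1]add0n big_addn addKn big_mkord.
apply: (@le_trans _ _ (\sum_(i < n - m.+1) 10 * b * cdecay C (m.+1 + i))).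
  apply: ler_sum => i _; rewrite addnC.
  by apply: le_trans (gle _ _) => //; rewrite -normrN ler_norm.
rewrite -mulr_sumr; apply: (le_trans (ler_wpM2l _ (cdecay_sum_le C _ (ltn0Sn m)))).
  by rewrite mulr_ge0// ltW.
by rewrite !mulrA ler_wpM2r ?invr_ge0 ?sqrtr_ge0//; lra.
Unshelve. all: by end_near. Qed.

(** Passing from n to n + 1 summands adds a partial long-run sum, at most sigma2 + K / sqrt (n + 1).
    Hence the bound n sigma2 + 2 K sqrt n, and the hypothesis on q turns the second term into at
    most 2 q sigma2. That threshold involves only b, C and sigma2, so it will be uniform in the
    parameter of the process. *)
Lemma psum_sqr_le_longrun a q : 80 * b * Num.sqrt C <= sigma2 * Num.sqrt q%:R ->
  Ex (fun w => psum Z a q w ^+ 2) <= q%:R * (3 * sigma2).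
Proof.
move=> hq; set K := 80 * b * Num.sqrt C.
have K0 : 0 <= K by rewrite !mulr_ge0 ?sqrtr_ge0// ltW.
suff H n : Ex (fun w => psum Z a n w ^+ 2) <= n%:R * sigma2 + 2 * K * Num.sqrt n%:R.
  apply: (le_trans (H q)); rewrite -/K in hq.
  have -> : q%:R * (3 * sigma2) = q%:R * sigma2 + 2 * (sigma2 * Num.sqrt q%:R) * Num.sqrt q%:R.
    by rewrite -!mulrA -expr2 sqr_sqrtr ?ler0n//; ring.
  by rewrite lerD2l ler_wpM2r ?sqrtr_ge0// ler_wpM2l.
elim: n => [|n IH].
  rewrite mul0r sqrtr0 mulr0 addr0 (@Ex_ext _ _ _ P _ (fun=> 0)) ?Ex_cst// => w.
  by rewrite psum0 expr0n.
rewrite Ex_psum_sqrS//.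
have -> : Ex (fun w => Z (a + n)%N w ^+ 2) = gam 0%N.
  by rewrite -(gamE (a + n)); apply: Ex_ext => w; rewrite addn0.
rewrite (eq_bigr (fun i : 'I_n => gam (n - i)%N)) => [|i _]; last first.
  by rewrite -(gamE (a + i)) -addnA subnKC// ltnW.
rewrite (sum_rev_sub gam).
have := gam_partial_le n; rewrite -/K.
have : K / Num.sqrt n.+1%:R <= 2 * K * (Num.sqrt n.+1%:R - Num.sqrt n%:R).
  suff : (Num.sqrt n.+1%:R)^-1 <= 2 * (Num.sqrt n.+1%:R - Num.sqrt n%:R) :> R.
    by move/(ler_wpM2l K0); lra.
  set x := Num.sqrt n%:R; set y := Num.sqrt n.+1%:R.
  have y0 : 0 < y by rewrite sqrtr_gt0 ltr0n.
  have x0 : 0 <= x by rewrite sqrtr_ge0.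
  have xy : y ^+ 2 = x ^+ 2 + 1 by rewrite !sqr_sqrtr// natr1.
  rewrite -[y^-1]mul1r ler_pdivrMr//.
  have := sqr_ge0 (y - x); nra.
by rewrite -[n.+1%:R]natr1; lra.
Qed.

End stationary.
End one_sequence.

End mixing_sequences.

(** * Maximal inequalities *)

Section rademacher_menshov.
Context {R : realType} disp {T : measurableType disp} (P : probability T R).
Local Notation Ex := (Ex P).

(** The sum, over all dyadic subintervals of [a, a + 2^k) of all levels, of the squared sum over the
    subinterval. *)
Fixpoint dyadic_sqr (Z : nat -> T -> R) k a w : R :=
  psum Z a (2 ^ k)%N w ^+ 2 +
  if k is k'.+1 then dyadic_sqr Z k' a w + dyadic_sqr Z k' (a + 2 ^ k')%N w else 0.

Lemma dyadic_sqr_ge0 Z k a w : 0 <= dyadic_sqr Z k a w.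
Proof.
elim: k a => [|k IH] a /=; first by rewrite addr0 sqr_ge0.
by rewrite addr_ge0 ?sqr_ge0// addr_ge0.
Qed.

(** An initial segment splits into at most one dyadic interval per level, so Cauchy-Schwarz over k +
    1 levels gives the factor. *)
Lemma psum_sqr_dyadic Z k a n w : (n <= 2 ^ k)%N ->
  psum Z a n w ^+ 2 <= k.+1%:R * dyadic_sqr Z k a w.
Proof.
elim: k a n => [|k IH] a n nk /=.
  rewrite addr0 mul1r; case: n nk => [|[|//]] _ //.
  by rewrite psum0 expr0n sqr_ge0.
have D1 := dyadic_sqr_ge0 Z k a w; have D2 := dyadic_sqr_ge0 Z k (a + 2 ^ k)%N w.
have S0 := sqr_ge0 (psum Z a (2 ^ k.+1)%N w).
have k0 : 0 <= k%:R :> R by [].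
have [nk'|kn] := leqP n (2 ^ k)%N.
  apply: (le_trans (IH a n nk')); rewrite -!natr1.
  apply: ler_pM => //; nra.
have En : n = (2 ^ k + (n - 2 ^ k))%N by rewrite subnKC// ltnW.
rewrite En psum_split.
have h2 := IH (a + 2 ^ k)%N (n - 2 ^ k)%N.
have {}h2 : psum Z (a + 2 ^ k)%N (n - 2 ^ k)%N w ^+ 2 <= k.+1%:R * dyadic_sqr Z k (a + 2 ^ k)%N w.
  by apply: h2; rewrite leq_subLR addnn -mul2n -expnS.
have h1 : psum Z a (2 ^ k)%N w ^+ 2 <= dyadic_sqr Z k a w.
  by case: (k) => [|k'] /=; rewrite lerDl ?addr_ge0 ?dyadic_sqr_ge0.
move: h1 h2; set x := psum Z a (2 ^ k)%N w; set y := psum Z _ _ w.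
set d1 := dyadic_sqr Z k a w; set d2 := dyadic_sqr _ _ _ _ => h1 h2.
have k1 : 0 < k.+1%:R :> R by rewrite ltr0n.
(* The weights are those of Cauchy-Schwarz for one term against k + 1 terms: 1/(k+2) + (k+1)/(k+2) =
   1. *)
have : (x + y) ^+ 2 <= k.+2%:R * x ^+ 2 + k.+2%:R / k.+1%:R * y ^+ 2.
  rewrite -subr_ge0 (_ : _ - _ = (k.+1%:R * x - y) ^+ 2 / k.+1%:R); last first.
    by rewrite -[k.+2%:R]natr1; field; rewrite nat1r pnatr_eq0.
  by rewrite divr_ge0 ?sqr_ge0// ltW.
move/le_trans; apply.
rewrite mulrDr -[leLHS]add0r lerD//; first by rewrite mulr_ge0 ?sqr_ge0.
rewrite mulrDr lerD//; first by rewrite ler_wpM2l.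
by rewrite -mulrA ler_wpM2l// mulrC ler_pdivrMr// mulrC.
Qed.

Lemma integ_dyadic_sqr Z k a : (forall i, L4 P (Z i)) -> integ P (dyadic_sqr Z k a).
Proof.
move=> LZ; elim: k a => [|k IH] a /=.
  by apply: integD; [apply: L4_sqr; exact: L4_psum|exact: integ_cst].
by apply: integD; [apply: L4_sqr; exact: L4_psum|exact: integD].
Qed.

Lemma Ex_dyadic_sqr Z K : (forall i, L4 P (Z i)) ->
  (forall a q, Ex (fun w => psum Z a q w ^+ 2) <= q%:R * K) ->
  forall k a, Ex (dyadic_sqr Z k a) <= k.+1%:R * (2 ^ k)%N%:R * K.
Proof.
move=> LZ ZK; have Id := fun k a => integ_dyadic_sqr k a LZ.
have I2 a q : integ P (fun w => psum Z a q w ^+ 2) by apply: L4_sqr; exact: L4_psum.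
elim=> [|k IH] a /=.
  rewrite ExD ?Ex_cst ?addr0//; last exact: integ_cst.
  by rewrite mul1r.
rewrite !ExD//; last exact: integD.
apply: (le_trans (lerD (ZK _ _) (lerD (IH _) (IH _)))).
by rewrite expnS natrM -natr1; lra.
Qed.

(** One factor k + 1 comes from Cauchy-Schwarz, the other from the number of levels. This polynomial
    loss in k is harmless on the fine levels of the chaining, where a power of 2^k is gained. *)
Lemma rademacher_menshov Z K k x : (forall i, L4 P (Z i)) -> 0 < x ->
  (forall a q, Ex (fun w => psum Z a q w ^+ 2) <= q%:R * K) ->
  pr P [set w | exists2 n, (n <= 2 ^ k)%N & x < `|psum Z 0 n w|] <=
    k.+1%:R ^+ 2 * (2 ^ k)%N%:R * K / x ^+ 2.
Proof.
move=> LZ x0 ZK; have mZ n : measurable_fun setT (psum Z 0 n).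
  by have [] := L4_psum 0 n LZ.
have Id := integ_dyadic_sqr k 0 LZ.
have mS : measurable [set w | exists2 n, (n <= 2 ^ k)%N & x < `|psum Z 0 n w|].
  rewrite (_ : mkset _ = \bigcup_(n in [set n | (n <= 2 ^ k)%N]) [set w | x < `|psum Z 0 n w|]) //.
  apply: bigcup_measurable => n _; apply: measurable_set_lt => //.
  exact: measurableT_comp.
apply: (@le_trans _ _ (pr P [set w | x ^+ 2 / k.+1%:R < dyadic_sqr Z k 0 w])).
  apply: pr_mono => //; first by apply: measurable_set_lt => //; exact: integ_mf Id.
  move=> w [n nk xn] /=; rewrite ltr_pdivrMr ?ltr0n// mulrC.
  apply: lt_le_trans _ (psum_sqr_dyadic _ _ _ nk).
  by rewrite -[ltRHS]real_normK ?num_real// ltr_pXn2r ?nnegrE// ltW.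
apply: (le_trans (markov_ge _ Id _)); first by rewrite divr_gt0 ?exprn_gt0.
  by move=> w; exact: dyadic_sqr_ge0.
have k1 : k.+1%:R != 0 :> R by rewrite pnatr_eq0.
rewrite ler_pdivlMr ?exprn_gt0// (_ : _ * x ^+ 2 = k.+1%:R * Ex (dyadic_sqr Z k 0)).
  by rewrite expr2 -!mulrA ler_wpM2l// mulrA; exact: Ex_dyadic_sqr.
by move: (k.+1%:R) k1 => r r0; field; rewrite r0 lt0r_neq0.
Qed.

End rademacher_menshov.

(** * Exponential bounds for partial sums: stopping and blocks *)

Section stopping.
Context {R : realType}.

Section pointwise.
Context {d} {T : measurableType d} (U : nat -> T -> R) (t lam : R).

Definition partial i (w : T) : R := \sum_(j < i) U j w.

(* exp (t * partial sum), killed at the first passage above lam *)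
Fixpoint killed_exp i (w : T) : R :=
  if i is i'.+1 then
    if partial i w <= lam then killed_exp i' w * expR (t * U i' w) else 0
  else 1.

Fixpoint passed i (w : T) : R :=
  if i is i'.+1 then if partial i w <= lam then passed i' w else 1 else 0.

Hypotheses (t0 : 0 <= t) (lam0 : 0 <= lam).

Lemma partialS i w : partial i.+1 w = partial i w + U i w.
Proof. by rewrite /partial big_ord_recr. Qed.

Lemma killed_passed i w : (passed i w = 1 /\ killed_exp i w = 0) \/
  [/\ passed i w = 0, killed_exp i w = expR (t * partial i w) & partial i w <= lam].
Proof.
elim: i => [|i IH]; first by right; rewrite /partial big_ord0 mulr0 expR0.
rewrite [passed _ _]/= [killed_exp _ _]/=; case: leP => h; last by left.
case: IH => [[-> ->]|[-> -> _]]; first by left; rewrite mul0r.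
by right; rewrite -expRD partialS -mulrDr.
Qed.

Lemma killed_exp_ge0 i w : 0 <= killed_exp i w.
Proof. by case: (killed_passed i w) => [[_ ->]|[_ -> _]] //; rewrite expR_ge0. Qed.

Lemma killed_exp_le i w : killed_exp i w <= expR (t * lam).
Proof.
case: (killed_passed i w) => [[_ ->]|[_ -> h]]; first exact: expR_ge0.
by rewrite ler_expR ler_wpM2l.
Qed.

(** If the passage happens at this step, the exponential that is killed was above exp (t lam) and so
    pays for the new indicator; otherwise both sides agree. *)
Lemma killed_step i w :
  expR (t * lam) * passed i.+1 w + killed_exp i.+1 w <=
  expR (t * lam) * passed i w + killed_exp i w * expR (t * U i w).
Proof.
rewrite [passed i.+1 w]/= [killed_exp i.+1 w]/=; case: ifPn => // /negP/negP; rewrite -ltNge => h.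
case: (killed_passed i w) => [[-> ->]|[-> -> _]]; first by rewrite mul0r.
rewrite mulr1 addr0 mulr0 add0r -expRD ler_expR -mulrDr -partialS ler_wpM2l//.
exact: ltW.
Qed.

Lemma passed01 i w : 0 <= passed i w <= 1.
Proof. by case: (killed_passed i w) => [[-> _]|[-> _ _]]; rewrite ?ler01 ?lexx. Qed.

Lemma passed_eq1 i j w : (j <= i)%N -> lam < partial j w -> passed i w = 1.
Proof.
elim: i => [|i IH]; first by rewrite leqn0 => /eqP ->; rewrite /partial big_ord0 ltNge lam0.
rewrite leq_eqVlt => /predU1P[->|/IH{}IH lp] /=; first by rewrite leNgt => ->.
by case: ifP => // _; exact: IH.
Qed.

Lemma partial_meas i : (forall j, (j < i)%N -> measurable_fun setT (U j)) ->
  measurable_fun setT (partial i).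
Proof.
elim: i => [|i IH] mU.
  by rewrite (_ : partial 0 = cst 0)//; apply/funext => w; rewrite /partial big_ord0.
rewrite (_ : partial i.+1 = fun w => partial i w + U i w); last by apply/funext => w; rewrite partialS.
apply: measurable_funD; last exact: mU.
by apply: IH => j ji; apply: mU; exact: ltnW.
Qed.

Lemma killed_exp_meas i : (forall j, (j < i)%N -> measurable_fun setT (U j)) ->
  measurable_fun setT (killed_exp i).
Proof.
elim: i => [|i IH] mU; first exact: measurable_cst.
have mp := partial_meas mU.
apply: measurable_fun_ifT => //; first exact: measurable_fun_ler.
apply: measurable_funM; first by apply: IH => j ji; apply: mU; exact: ltnW.
by apply: measurableT_comp => //; apply: measurable_funM => //; exact: mU.
Qed.

Lemma passed_meas i : (forall j, (j < i)%N -> measurable_fun setT (U j)) ->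
  measurable_fun setT (passed i).
Proof.
elim: i => [|i IH] mU; first exact: measurable_cst.
have mp := partial_meas mU.
apply: measurable_fun_ifT => //; first exact: measurable_fun_ler.
by apply: IH => j ji; apply: mU; exact: ltnW.
Qed.

End pointwise.

Context disp {T : measurableType disp} (P : probability T R).
Local Notation Ex := (Ex P).
Local Notation integ := (integ P).

(* The exponential supermartingale argument: up to its first passage above lam
   the exponential stays below exp (t lam), so that each step costs a
   decorrelation error of only a * exp (t lam + t b). *)
Lemma stopping (U : nat -> T -> R) (Gp Gf : nat -> set (set T)) (r : nat)
    (a b c t lam : R) :
  0 <= a -> 0 <= b -> 0 <= c -> 0 <= t -> 0 <= lam ->
  (forall i, submeas (Gp i)) -> (forall i, submeas (Gf i)) ->
  (forall i, (0 < i)%N -> mix_le P (Gp i) (Gf i) a) ->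
  (forall i j, (j < i)%N -> smeas (Gp i) (U j)) ->
  (forall i, smeas (Gf i) (U i)) ->
  (forall i w, `|U i w| <= b) ->
  (forall i, Ex (fun w => expR (t * U i w)) <= expR c) ->
  pr P [set w | exists2 i, (i <= r)%N & lam < partial U i w] <=
  expR (r%:R * c - t * lam) + r%:R * a * expR (t * b + r%:R * c).
Proof.
move=> a0 b0 c0 t0 lam0 sp sf mx mp mf Ub Ec.
have mU i : measurable_fun setT (U i) by apply: smeas_meas (mf i).
have mg i : measurable_fun setT (killed_exp U t lam i) by exact: killed_exp_meas.
have mh i : measurable_fun setT (passed U lam i) by exact: passed_meas.
have me i : measurable_fun setT (fun w => expR (t * U i w)).
  by apply: measurableT_comp => //; exact: measurable_funM.
have ig i : integ (killed_exp U t lam i).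
  apply: (@integ_bnd _ _ _ _ _ (expR (t * lam))) => // w.
  by rewrite ger0_norm ?killed_exp_ge0// killed_exp_le.
have ih i : integ (passed U lam i).
  apply: (@integ_bnd _ _ _ _ _ 1) => // w.
  by have /andP[? ?] := passed01 U t lam0 i w; rewrite ger0_norm.
have eb i w : expR (t * U i w) <= expR (t * b).
  by rewrite ler_expR ler_wpM2l// (le_trans (ler_norm _)).
have ie i : integ (fun w => expR (t * U i w)).
  apply: (@integ_bnd _ _ _ _ _ (expR (t * b))) => // w.
  by rewrite ger0_norm ?expR_ge0.
have ige i : integ (fun w => killed_exp U t lam i w * expR (t * U i w)).
  apply: (@integ_bnd _ _ _ _ _ (expR (t * lam) * expR (t * b))).
    exact: measurable_funM.
  move=> w; rewrite ger0_norm ?mulr_ge0 ?killed_exp_ge0 ?expR_ge0//.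
  by rewrite ler_pM ?killed_exp_ge0 ?expR_ge0// killed_exp_le.
have decor i : Ex (fun w => killed_exp U t lam i w * expR (t * U i w)) <=
    Ex (killed_exp U t lam i) * expR c + a * (expR (t * lam) * expR (t * b)).
  have M0 : 0 <= a * (expR (t * lam) * expR (t * b)).
    by rewrite !mulr_ge0 ?expR_ge0.
  (* The first block has no past: the killed exponential is 1 and there is nothing to decouple. *)
  case: i => [|i].
    rewrite [X in X * _](_ : _ = 1) ?mul1r; last by rewrite -[RHS](Ex_cst P).
    apply: (@le_trans _ _ (expR c)); last by rewrite lerDl.
    by under Ex_ext do rewrite /= mul1r.
  have := @unit_mix _ _ _ P (Gp i.+1) (Gf i.+1) a
    (fun w => (expR (t * lam))^-1 * killed_exp U t lam i.+1 w)
    (fun w => (expR (t * b))^-1 * expR (t * U i.+1 w)) (sp _) (sf _) (mx i.+1 isT).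
  have mG : smeas (Gp i.+1) (fun w => (expR (t * lam))^-1 * killed_exp U t lam i.+1 w).
    apply: measurable_funM; first exact: measurable_cst.
    exact: (@killed_exp_meas _ (g_sigma_algebraType (Gp i.+1)) U t lam i.+1 (mp i.+1)).
  have mF : smeas (Gf i.+1) (fun w => (expR (t * b))^-1 * expR (t * U i.+1 w)).
    apply: measurable_funM; first exact: measurable_cst.
    apply: measurableT_comp => //; apply: measurable_funM; first exact: measurable_cst.
    exact: mf.
  have F01 w : 0 <= (expR (t * lam))^-1 * killed_exp U t lam i.+1 w <= 1.
    rewrite mulr_ge0 ?invr_ge0 ?expR_ge0 ?killed_exp_ge0// andTb.
    by rewrite [_^-1 * _]mulrC ler_pdivrMr ?expR_gt0// mul1r; exact: killed_exp_le.
  have K01 w : 0 <= (expR (t * b))^-1 * expR (t * U i.+1 w) <= 1.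
    rewrite mulr_ge0 ?invr_ge0 ?expR_ge0//=.
    by rewrite [_^-1 * _]mulrC ler_pdivrMr ?expR_gt0// mul1r.
  move=> /(_ mG mF F01 K01).
  rewrite !ExZ// (@Ex_ext _ _ _ P _ (fun w => (expR (t * lam))^-1 * (expR (t * b))^-1 *
     (killed_exp U t lam i.+1 w * expR (t * U i.+1 w)))) => [|w]; last by rewrite mulrACA.
  rewrite ExZ// => /(ler_wpM2l (mulr_ge0 (expR_ge0 (t * lam)) (expR_ge0 (t * b)))).
  have e1 := expR_gt0 (t * lam); have e2 := expR_gt0 (t * b).
  move: (expR (t * lam)) (expR (t * b)) e1 e2 => x y x0 y0.
  rewrite mulrDr [X in X <= _](_ : _ =
    Ex (fun w => killed_exp U t lam i.+1 w * expR (t * U i.+1 w))); last first.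
    by field; rewrite !lt0r_neq0.
  move/le_trans; apply; rewrite [a * _]mulrC lerD2r.
  rewrite [X in X <= _](_ : _ = Ex (killed_exp U t lam i.+1) * Ex (fun w => expR (t * U i.+1 w))).
    by rewrite ler_wpM2l// Ex_ge0// => w; exact: killed_exp_ge0.
  by field; rewrite !lt0r_neq0.
(* A potential with [Phi 0] equal to 1: by [killed_step] and [decor] each step multiplies it by at
   most exp c and adds one decorrelation error. *)
pose Phi i := expR (t * lam) * Ex (passed U lam i) + Ex (killed_exp U t lam i).
have ec1 : 1 <= expR c by rewrite -expR0 ler_expR.
have el0 := expR_gt0 (t * lam).
have PhiS i : Phi i.+1 <= expR c * Phi i + a * (expR (t * lam) * expR (t * b)).
  have step : Phi i.+1 <= expR (t * lam) * Ex (passed U lam i) +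
      Ex (fun w => killed_exp U t lam i w * expR (t * U i w)).
    rewrite /Phi -(ExZ (expR (t * lam)) (ih i.+1)) -ExD//; last exact: integZ.
    rewrite -(ExZ (expR (t * lam)) (ih i)) -ExD//; last exact: integZ.
    apply: Ex_le => [||w]; [by apply: integD => //; exact: integZ| |exact: killed_step].
    by apply: integD => //; exact: integZ.
  apply: (le_trans step); rewrite /Phi.
  have := decor i; have : 0 <= Ex (passed U lam i).
    by apply: Ex_ge0 => w; have /andP[] := passed01 U t lam0 i w.
  move/(mulr_ge0 (ltW el0)); nra.
have Phi_le i : Phi i <= expR (i%:R * c) * (1 + i%:R * (a * (expR (t * lam) * expR (t * b)))).
  elim: i => [|i IH].
    rewrite !mul0r expR0 addr0 mulr1 /Phi -[X in _ <= X]add0r lerD//.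
      by rewrite (_ : Ex _ = 0) ?mulr0//; rewrite -[RHS](Ex_cst P).
    by rewrite -[leRHS](Ex_cst P).
  apply: (le_trans (PhiS i)); rewrite -[i.+1%:R]natr1 [(_ + 1) * c]mulrDl mul1r expRD.
  have M0 : 0 <= a * (expR (t * lam) * expR (t * b)) by rewrite !mulr_ge0 ?expR_ge0.
  move: M0; set M := a * (expR (t * lam) * expR (t * b)) in IH * => M0.
  have := ler_wpM2l (ltW (expR_gt0 c)) IH.
  have : 1 <= expR (i%:R * c) * expR c.
    by rewrite -expRD -expR0 ler_expR addr_ge0// mulr_ge0.
  by move/(ler_wpM2l M0); lra.
have mB : measurable [set w | exists2 i, (i <= r)%N & lam < partial U i w].
  rewrite (_ : mkset _ = \bigcup_(i in [set i | (i <= r)%N]) [set w | lam < partial U i w])//.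
  apply: bigcup_measurable => i _; apply: measurable_set_lt => //.
  exact: partial_meas.
rewrite -(Ex_indic P mB) addrC.
apply: (@le_trans _ _ (Ex (passed U lam r))).
  apply: Ex_le => // [|w]; first exact: integ_indic.
  rewrite indicE; case: (boolP (w \in _)) => [|_].
    by rewrite inE => -[i ir li]; rewrite (passed_eq1 lam0 ir li).
  by have /andP[] := passed01 U t lam0 r w.
have Eg0 : 0 <= Ex (killed_exp U t lam r) by apply: Ex_ge0 => w; exact: killed_exp_ge0.
have : expR (t * lam) * Ex (passed U lam r) <= Phi r by rewrite /Phi lerDl.
(* Division by exp (t lam) gives the first term and cancels the exp (t lam) contained in every
   decorrelation error. *)
move/le_trans => /(_ _ (Phi_le r)); rewrite mulrC -ler_pdivlMr//.
move/le_trans; apply; rewrite expRB expRD.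
rewrite le_eqVlt; apply/orP; left; apply/eqP; field.
by rewrite lt0r_neq0.
Qed.

End stopping.

(** From exp (-x) >= 1 - x one gets exp x <= 1 / (1 - x), and (1 - x)(1 + x + 2 x^2) = 1 + x^2 (1 -
    2x) is at least 1 for x <= 1/2. *)
Lemma expR_le_quadratic {R : realType} (x : R) : `|x| <= 2^-1 -> expR x <= 1 + x + 2 * x ^+ 2.
Proof.
rewrite ler_norml => /andP[x1 x2]; have := expR_ge1Dx (- x); rewrite expRN => h.
have e0 := expR_gt0 x; have x0 : 0 < 1 - x by lra.
have : expR x <= (1 - x)^-1 by rewrite -[leLHS]invrK lef_pV2 ?posrE ?invr_gt0//; lra.
move/le_trans; apply; rewrite -[_^-1]mul1r ler_pdivrMr//.
have := sqr_ge0 x; nra.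
Qed.

Lemma sum_even_odd {R : realType} (F : nat -> R) m :
  \sum_(i < m) F i = \sum_(j < uphalf m) F (j * 2)%N + \sum_(j < m./2) F (1 + j * 2)%N.
Proof.
suff H k : \sum_(i < k.*2) F i = \sum_(j < k) F (j * 2)%N + \sum_(j < k) F (1 + j * 2)%N.
  have H2 (o : bool) k : \sum_(i < o + k.*2) F i =
      \sum_(j < o + k) F (j * 2)%N + \sum_(j < k) F (1 + j * 2)%N.
    case: o; last by rewrite !add0n.
    by rewrite !add1n big_ord_recr /= H big_ord_recr /= muln2 addrAC.
  by have := H2 (odd m) m./2; rewrite odd_double_half -uphalf_half.
elim: k => [|k IH]; first by rewrite !big_ord0 addr0.
by rewrite doubleS !big_ord_recr /= IH muln2 add1n; ring.
Qed.

Section blocks.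
Context {R : realType} disp {T : measurableType disp} (P : probability T R).
Local Notation Ex := (Ex P).
Local Notation integ := (integ P).
Local Notation L4 := (L4 P).
Implicit Types Z : nat -> T -> R.

(** Meant for the truncation remainders, which are not centered. The factor q^2 will be outweighed
    by 1 / tau^2, the truncation level being larger than the block length. *)
Lemma psum_sqr_trivial (Z : nat -> T -> R) (v : R) : (forall i, L4 (Z i)) ->
  (forall i, Ex (fun w => Z i w ^+ 2) <= v) ->
  forall a q, Ex (fun w => psum Z a q w ^+ 2) <= q%:R ^+ 2 * v.
Proof.
move=> LZ Zv a; elim=> [|q IH].
  rewrite expr0n mul0r (@Ex_ext _ _ _ P _ (fun=> 0)) ?Ex_cst// => w.
  by rewrite psum0 expr0n.
rewrite Ex_psum_sqrS//.
have : \sum_(i < q) Ex (fun w => Z (a + i)%N w * Z (a + q)%N w) <= q%:R * v.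
  rewrite (_ : q%:R * v = \sum_(i < q) v); last by rewrite sumr_const card_ord mulr_natl.
  apply: ler_sum => i _; apply: (le_trans (ler_norm _)).
  apply: (le_trans (Ex_CS1 (LZ _) (LZ _))).
  by have := Zv (a + i)%N; have := Zv (a + q)%N; lra.
by have := Zv (a + q)%N; rewrite -[q.+1%:R]natr1; lra.
Qed.

Lemma psum_norm_le (Z : nat -> T -> R) (v : R) a q w :
  (forall i, `|Z i w| <= v) -> `|psum Z a q w| <= q%:R * v.
Proof.
move=> Zv; apply: (le_trans (ler_norm_sum _ _ _)).
rewrite (_ : q%:R * v = \sum_(i < q) v); last by rewrite sumr_const card_ord mulr_natl.
exact: ler_sum.
Qed.

Variables (past fut : nat -> set (set T)) (C nu : R).
Hypotheses (C0 : 0 < C) (nu3 : 3 < nu) (ms : mixing_system P past fut C nu).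

Lemma psum_smeas G Z a q : (forall i, (i < q)%N -> smeas G (Z (a + i)%N)) -> smeas G (psum Z a q).
Proof.
elim: q => [|q IH] mZ.
  rewrite (_ : psum Z a 0 = cst 0); first exact: measurable_cst.
  by apply/funext => w; rewrite psum0.
rewrite (_ : psum Z a q.+1 = fun w => psum Z a q w + Z (a + q)%N w).
  apply: measurable_funD; last exact: mZ.
  by apply: IH => i iq; apply: mZ; exact: ltnW.
by apply/funext => w; rewrite psumS.
Qed.

Section truncated.
Variables (B : R) (p q : nat) (tau V t lam : R).
Hypotheses (B0 : 0 <= B) (q0 : (0 < q)%N) (tau0 : 0 < tau) (V0 : 0 <= V) (t0 : 0 <= t)
  (lam0 : 0 <= lam) (tqtau : t * (q%:R * tau) <= 2^-1).

(** Bound for the logarithm of the Laplace transform of one truncated block: the bias left by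
    truncation, then 2 t^2 times a second moment, itself split into the full block and the
    truncation remainder. *)
Let c := t * (q%:R * (B / tau ^+ 3)) +
  2 * t ^+ 2 * (2 * (q%:R * V) + 2 * (q%:R ^+ 2 * (B / tau ^+ 2))).

Let err := expR (p%:R * c - t * lam) + p%:R * (C * q%:R `^ (- nu)) * expR (1 + p%:R * c).

Definition centered4 Z := [/\ adapted past fut Z, (forall i, L4 (Z i)),
  (forall i, Ex (Z i) = 0), (forall i, Ex (fun w => Z i w ^+ 4) <= B) &
  (forall a, Ex (fun w => psum Z a q w ^+ 2) <= q%:R * V)].

Definition tpsum Z s := psum (fun i => trunc tau (Z i)) s q.

Lemma Ex_exp_tpsum Z s : centered4 Z -> Ex (fun w => expR (t * tpsum Z s w)) <= expR c.
Proof.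
move=> [aZ LZ Z0 Z4 ZV].
have LT i : L4 (trunc tau (Z i)) by exact: L4_trunc.
pose Y i w := Z i w - trunc tau (Z i) w.
have LY i : L4 (Y i) by exact: L4B.
have LU : L4 (tpsum Z s) by exact: L4_psum.
have LS : L4 (psum Z s q) by exact: L4_psum.
have LR : L4 (psum Y s q) by exact: L4_psum.
have UE w : tpsum Z s w = psum Z s q w - psum Y s q w.
  rewrite /tpsum /psum -sumrB; apply: eq_bigr => i _.
  by rewrite /Y opprB addrC subrK.
(* The untruncated block is centered, so the mean of the truncated one is minus the mean of the
   remainder. *)
have EU : Ex (tpsum Z s) <= q%:R * (B / tau ^+ 3).
  rewrite (Ex_ext _ UE) ExB; [|exact: L4_int|exact: L4_int].
  rewrite [Ex (psum Z s q)]Ex_sum; last by move=> i; exact: L4_int.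
  rewrite big1 ?sub0r// -ExN; last exact: L4_int.
  apply: (@le_trans _ _ (Ex (fun w => \sum_(i < q) `|Y (s + i)%N w|))).
    apply: Ex_le => [||w]; first exact/integN/L4_int.
      by apply: integ_sum => i; apply: integ_norm; exact: L4_int.
    by apply: (le_trans (ler_norm _)); rewrite normrN; exact: ler_norm_sum.
  rewrite Ex_sum => [|i]; last by apply: integ_norm; exact: L4_int.
  rewrite (_ : q%:R * _ = \sum_(i < q) (B / tau ^+ 3)); last first.
    by rewrite sumr_const card_ord mulr_natl.
  apply: ler_sum => i _; apply: (le_trans (Ex_tail1 tau0 (LZ _))).
  by rewrite ler_wpM2r// invr_ge0 exprn_ge0// ltW.
have ER : Ex (fun w => psum Y s q w ^+ 2) <= q%:R ^+ 2 * (B / tau ^+ 2).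
  apply: psum_sqr_trivial => // i; apply: (le_trans (Ex_tail2 tau0 (LZ _))).
  by rewrite ler_wpM2r// invr_ge0 exprn_ge0// ltW.
have EU2 : Ex (fun w => tpsum Z s w ^+ 2) <= 2 * (q%:R * V) + 2 * (q%:R ^+ 2 * (B / tau ^+ 2)).
  have I1 := L4_sqr LS; have I2 := L4_sqr LR.
  apply: (@le_trans _ _ (Ex (fun w => 2 * psum Z s q w ^+ 2 + 2 * psum Y s q w ^+ 2))).
    apply: Ex_le => [||w]; [exact: L4_sqr|by apply: integD; exact: integZ|].
    by rewrite UE; have := sqr_ge0 (psum Z s q w + psum Y s q w); nra.
  rewrite ExD ?ExZ//; try exact: integZ.
  by have := ZV s; lra.
have I1 := L4_int LU; have I2 := L4_sqr LU.
have Ub w : `|t * tpsum Z s w| <= 2^-1.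
  rewrite normrM ger0_norm// (le_trans _ tqtau)// ler_wpM2l//.
  by apply: psum_norm_le => i; apply: trunc_le; exact: ltW.
apply: (@le_trans _ _ (Ex (fun w => 1 + (t * tpsum Z s w + (2 * t ^+ 2) * tpsum Z s w ^+ 2)))).
  apply: Ex_le => [||w].
  - apply: (@integ_bnd _ _ _ _ _ (expR (2^-1))).
      by apply: measurableT_comp => //; apply: measurable_funM => //; case: LU.
    move=> w; rewrite ger0_norm ?expR_ge0// ler_expR.
    exact: le_trans (ler_norm _) (Ub w).
  - by apply: integD; [exact: integ_cst|apply: integD; exact: integZ].
  - apply: (le_trans (expR_le_quadratic (Ub w))).
    by rewrite exprMn addrA mulrA.
rewrite !ExD ?ExZ ?Ex_cst//; last 4 first.
- exact: integZ.
- exact: integZ.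
- exact: integ_cst.
- by apply: integD; exact: integZ.
apply: le_trans (expR_ge1Dx c); rewrite lerD2l /c lerD// ler_wpM2l//.
by rewrite mulr_ge0// sqr_ge0.
Qed.

(** Consecutive blocks of the same parity are separated by a gap of length q, which yields the
    decoupling error C q^(-nu); [s] is 0 for even and q for odd blocks. The bound on t q tau keeps
    the exponential of one block below e. *)
Lemma block_one_sided Z s : centered4 Z ->
  pr P [set w | exists2 i, (i <= p)%N & lam < partial (fun j => tpsum Z (s + j * (2 * q))) i w]
  <= err.
Proof.
move=> cZ; have [aZ LZ Z0 Z4 ZV] := cZ; case: ms => sp sf monp monf mx.
have qR : 0 < q%:R :> R by rewrite ltr0n.
(* The block preceding block j ends at s + (2j - 1) q, and block j starts q indices later. At j = 0
   the truncated subtraction gives s; mixing is only required for j > 0. *)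
apply: (le_trans (@stopping _ _ _ P (fun j => tpsum Z (s + j * (2 * q)))
  (fun j => past (s + (2 * j - 1) * q)%N) (fun j => fut (s + j * (2 * q))%N)
  p (C * q%:R `^ (- nu)) (q%:R * tau) c t lam _ _ _ t0 lam0 _ _ _ _ _ _ _)) => //.
- by rewrite mulr_ge0 ?powR_ge0// ltW.
- by rewrite mulr_ge0// ltW.
- by rewrite /c !addr_ge0 ?mulr_ge0 ?sqr_ge0 ?invr_ge0 ?exprn_ge0 ?addr_ge0 ?mulr_ge0 ?invr_ge0 ?exprn_ge0// ltW.
- move=> i i0 A D pA fD.
  have le1 : (s + (2 * i - 1) * q <= s + i * (2 * q))%N by rewrite leq_add2l; nia.
  apply: (le_trans (mx _ _ le1 A D pA fD)); apply: ler_wpM2l; first exact: ltW.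
  rewrite !powRN lef_pV2 ?posrE ?powR_gt0 ?ltr0n//.
  apply: ge0_ler_powR; rewrite ?nnegrE ?ler0n//; first by apply: ltW; apply: lt_trans nu3.
  by rewrite ler_nat; nia.
- move=> i j ji; apply: psum_smeas => l lq; apply: trunc_smeas.
  apply: smeas_sub (proj1 (aZ _)); apply: monp.
  by rewrite -addnA -addnS leq_add2l; nia.
- move=> i; apply: psum_smeas => l lq; apply: trunc_smeas.
  by apply: smeas_sub (proj2 (aZ _)); apply: monf; rewrite leq_addr.
- by move=> i w; apply: psum_norm_le => j; apply: trunc_le; exact: ltW.
- by move=> i; exact: Ex_exp_tpsum.
rewrite /err lerD2l ler_wpM2l//.
  by rewrite !mulr_ge0 ?powR_ge0// ltW.
by rewrite ler_expR lerD2r (le_trans tqtau)//; lra.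
Qed.

Lemma centered4N Z : centered4 Z -> centered4 (fun i w => - Z i w).
Proof.
move=> [aZ LZ Z0 Z4 ZV]; split => [i|i|i|i|a].
- by have [m1 m2] := aZ i; split; exact: measurableT_comp.
- exact: L4N.
- by rewrite ExN ?Z0 ?oppr0//; exact: L4_int.
- by rewrite (@Ex_ext _ _ _ P _ (fun w => Z i w ^+ 4))// => w; rewrite -mulN1r exprMn -signr_odd mul1r.
- rewrite (@Ex_ext _ _ _ P _ (fun w => psum Z a q w ^+ 2))// => w.
  by rewrite /psum sumrN sqrrN.
Qed.

Lemma tpsumN Z s w : tpsum (fun i w => - Z i w) s w = - tpsum Z s w.
Proof.
rewrite /tpsum /psum -sumrN; apply: eq_bigr => i _.
by rewrite /trunc normrN; case: ifP => _; rewrite ?oppr0.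
Qed.

(** When no summand exceeds tau truncation changes nothing, and a partial sum is made of even
    blocks, odd blocks and one incomplete block: lam + lam + q tau. Two parities and two signs give
    [4 * err]; the last term is the union bound for a summand above tau. *)
Lemma block_max Z : centered4 Z ->
  pr P [set w | exists2 n, (n <= 2 * p * q)%N & 2 * lam + q%:R * tau < `|psum Z 0 n w|] <=
  4 * err + (2 * p * q)%:R * (B / tau ^+ 4).
Proof.
move=> cZ; have cN := centered4N cZ; have [aZ LZ Z0 Z4 ZV] := cZ.
pose bad (Z' : nat -> T -> R) (s : nat) :=
  [set w | exists2 i, (i <= p)%N & lam < partial (fun j => tpsum Z' (s + j * (2 * q))) i w].
pose big := \big[setU/set0]_(i < 2 * p * q) [set w | tau ^+ 4 < Z i w ^+ 4].
have mZ i : measurable_fun setT (Z i) by case: (LZ i).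
have mbad Z' s : centered4 Z' -> measurable (bad Z' s).
  move=> [_ LZ' _ _ _].
  rewrite /bad (_ : mkset _ = \bigcup_(i in [set i | (i <= p)%N])
    [set w | lam < partial (fun j => tpsum Z' (s + j * (2 * q))) i w])//.
  apply: bigcup_measurable => i _; apply: measurable_set_lt => //.
  apply: partial_meas => j _; apply: L4_mf; apply: L4_psum => l; exact: L4_trunc.
have mtail i : measurable [set w | tau ^+ 4 < Z i w ^+ 4].
  by apply: measurable_set_lt => //; exact: measurable_funX.
have mbig : measurable big by apply: bigsetU_measurable.
have mS : measurable [set w | exists2 n, (n <= 2 * p * q)%N & 2 * lam + q%:R * tau < `|psum Z 0 n w|].
  rewrite (_ : mkset _ = \bigcup_(n in [set n | (n <= 2 * p * q)%N])
    [set w | 2 * lam + q%:R * tau < `|psum Z 0 n w|])//.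
  apply: bigcup_measurable => i _; apply: measurable_set_lt => //.
  by apply: measurableT_comp => //; apply: L4_mf; exact: L4_psum.
pose Zn := fun i w => - Z i w.
have m1 := mbad Z 0%N cZ; have m2 := mbad Z q cZ; have m3 := mbad Zn 0%N cN; have m4 := mbad Zn q cN.
have sub : [set w | exists2 n, (n <= 2 * p * q)%N & 2 * lam + q%:R * tau < `|psum Z 0 n w|] `<=`
    ((bad Z 0%N `|` bad Z q) `|` (bad Zn 0%N `|` bad Zn q)) `|` big.
  move=> w [n nN hn]; apply: contrapT => /not_orP[/not_orP[/not_orP[b1 b2] /not_orP[b3 b4]] b5].
  have Zt i : (i < 2 * p * q)%N -> `|Z i w| <= tau.
    move=> iN; rewrite leNgt; apply/negP => h; apply: b5.
    rewrite /big -(bigcup_mkord (2 * p * q) (fun i => [set w | tau ^+ 4 < Z i w ^+ 4])).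
    exists i => //=; rewrite -[ltRHS]ger0_norm ?exprn_even_ge0// normrX.
    by rewrite ltr_pXn2r ?nnegrE// ltW.
  have ple Z' s i : ~ bad Z' s w -> (i <= p)%N ->
      partial (fun j => tpsum Z' (s + j * (2 * q))) i w <= lam.
    by move=> nb ip; rewrite leNgt; apply/negP => h; apply: nb; exists i.
  have pnorm s i : ~ bad Z s w -> ~ bad Zn s w -> (i <= p)%N ->
      `|partial (fun j => tpsum Z (s + j * (2 * q))) i w| <= lam.
    move=> h1 h2 ip; rewrite ler_norml ple// andbT lerNl.
    have := ple _ _ _ h2 ip; rewrite /partial -sumrN.
    by under eq_bigr do rewrite tpsumN.
  move: hn; apply/negP; rewrite -leNgt.
  have -> : psum Z 0 n w = psum (fun i => trunc tau (Z i)) 0 n w.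
    rewrite /psum; apply: eq_bigr => i _.
    by rewrite /trunc Zt// (leq_trans (ltn_ord i)).
  rewrite {1}(divn_eq n q) psum_split psum_blocks add0n.
  rewrite (sum_even_odd (fun i => psum (fun i => trunc tau (Z i)) (i * q) q w)).
  have mp : (n %/ q <= 2 * p)%N by rewrite -(mulnK (2 * p) q0) leq_div2r.
  have h1 := pnorm 0%N (uphalf (n %/ q)) b1 b3 _.
  have h2 := pnorm q (n %/ q)./2 b2 b4 _.
  have E1 : \sum_(j < uphalf (n %/ q)) psum (fun i => trunc tau (Z i)) (j * 2 * q) q w =
      partial (fun j => tpsum Z (0 + j * (2 * q))) (uphalf (n %/ q)) w.
    by apply: eq_bigr => j _; rewrite add0n mulnA.
  have E2 : \sum_(j < (n %/ q)./2) psum (fun i => trunc tau (Z i)) ((1 + j * 2) * q) q w =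
      partial (fun j => tpsum Z (q + j * (2 * q))) (n %/ q)./2 w.
    by apply: eq_bigr => j _; rewrite mulnDl mul1n mulnA.
  rewrite E1 E2.
  have h3 : `|psum (fun i => trunc tau (Z i)) (n %/ q * q) (n %% q) w| <= q%:R * tau.
    apply: (@le_trans _ _ ((n %% q)%:R * tau)).
      by apply: psum_norm_le => i; apply: trunc_le; exact: ltW.
    by rewrite ler_wpM2r ?ler_nat ?ltW// ltnW// ltn_mod.
  apply: (le_trans (ler_normD _ _)); rewrite lerD//.
  apply: (le_trans (ler_normD _ _)); rewrite mulrDl mul1r lerD//.
    by apply: h1; rewrite leq_uphalf_double -mul2n.
  by apply: h2; rewrite leq_half_double (leq_trans mp)// -mul2n leqnSn.
apply: (le_trans (pr_mono P mS _ sub)).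
  by apply: measurableU => //; apply: measurableU; exact: measurableU.
apply: (le_trans (pr_setU_le P _ mbig)); first by apply: measurableU; exact: measurableU.
apply: lerD.
  apply: (le_trans (pr_setU_le P (measurableU _ _ m1 m2) (measurableU _ _ m3 m4))).
  have := pr_setU_le P m1 m2; have := pr_setU_le P m3 m4.
  have := block_one_sided 0 cZ; have := block_one_sided q cZ.
  have := block_one_sided 0 cN; have := block_one_sided q cN.
  by rewrite -/(bad _ _) -/(bad _ _) -/(bad _ _) -/(bad _ _); lra.
apply: (le_trans (@pr_bigsetU_le _ _ _ P (2 * p * q)
  (fun i => [set w | tau ^+ 4 < Z i w ^+ 4]) mtail)).
rewrite (_ : _ * _ = \sum_(i < 2 * p * q) (B / tau ^+ 4)); last first.
  by rewrite sumr_const card_ord mulr_natl.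
apply: ler_sum => i _.
have tp : 0 < tau ^+ 4 by rewrite exprn_gt0.
apply: (le_trans (markov_ge tp (L4_pow4 (LZ i)) _)).
  by move=> w; rewrite exprn_even_ge0.
by rewrite ler_wpM2r// invr_ge0 ltW.
Qed.

End truncated.
End blocks.

(** * Choice of the block length and of the truncation level *)

Section parameters.
Context {R : realType}.

Lemma le_of_sqr (a b : R) : 0 <= b -> a ^+ 2 <= b ^+ 2 -> a <= b.
Proof.
move=> b0 ab; rewrite leNgt; apply/negP => ba.
have : b ^+ 2 < a ^+ 2 by rewrite ltr_pXn2r ?nnegrE// (le_trans b0)// ltW.
by rewrite ltNge ab.
Qed.

Variables (x g M B V w p : R).
Let N := M * x ^+ 4 * g ^+ 64.
Let tau := x * g ^+ 24.
Let L := Num.sqrt (w * N * V).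
Let t := w / L.
Let c := t * (x * (B / tau ^+ 3)) + 2 * t ^+ 2 * (2 * (x * V) + 2 * (x ^+ 2 * (B / tau ^+ 2))).

(** Here [x] is the block length, [N] the number of summands and exp (-w) the target probability.
    With fourth moments, N / tau^4 has to be small while one block, at most x tau, stays below the
    order of sqrt N. For N = M x^4 g^64 and tau = x g^24 this means 64 < 4 * 24 and 2 * 24 < 64, and
    the surplus powers of g absorb V >= 1/g and w <= 3g. The term 2w of the third bound is 2 N t^2
    V. *)
Lemma block_parameters : 1 <= x -> 2 <= g -> 1 <= M -> 0 <= B -> g^-1 <= V ->
  1 <= w -> w <= 3 * g -> 2 * p * x = N ->
  [/\ 0 < L, t * (x * tau) <= 2^-1, p * c <= M * B + 6 * B + 2 * w,
      x * tau <= L & N * (B / tau ^+ 4) <= M * B * g ^- 2].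
Proof.
move=> x1 g2 M1 B0 gV w1 wg pN.
have g0 : 0 < g by lra.
have x0 : 0 < x by lra.
have V0 : 0 < V by apply: lt_le_trans gV; rewrite invr_gt0.
have w0 : 0 < w by lra.
have M0 : 0 < M by lra.
have [xw gw Mw ww Vw] := And5 (ltW x0) (ltW g0) (ltW M0) (ltW w0) (ltW V0).
have N0 : 0 < N by rewrite /N !mulr_gt0// exprn_gt0.
have tau0 : 0 < tau by rewrite /tau mulr_gt0// exprn_gt0.
have L0 : 0 < L by rewrite sqrtr_gt0 !mulr_gt0.
have L2 : L ^+ 2 = w * N * V by rewrite sqr_sqrtr// ltW// !mulr_gt0.
have g1 : 1 <= g by lra.
have gV1 : 1 <= V * g by rewrite -ler_pdivrMr// div1r.
have gpow n : 1 <= g ^+ n by rewrite exprn_ege1.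
have E48 : g ^+ 64 = g ^+ 48 * g * g * g ^+ 14 by rewrite -!exprSr -exprD.
have g14 : 12 <= g ^+ 14.
  have h : 16 <= g ^+ 4.
    have : 4 <= g ^+ 2 by rewrite expr2; nra.
    by rewrite (exprM _ 2 2); nra.
  have -> : g ^+ 14 = g ^+ 4 * g ^+ 10 by rewrite -exprD.
  by have := gpow 10%N; nra.
have A : x * tau <= L / (2 * w).
  rewrite ler_pdivlMr ?mulr_gt0//; apply: le_of_sqr; first exact: ltW.
  rewrite L2 (_ : (x * tau * (2 * w)) ^+ 2 = (w * x ^+ 4 * g ^+ 48) * (4 * w)); last first.
    by rewrite /tau; ring.
  rewrite (_ : w * N * V = (w * x ^+ 4 * g ^+ 48) * (M * ((V * g) * (g * g ^+ 14)))); last first.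
    by rewrite /N E48; ring.
  rewrite ler_wpM2l//; first by rewrite !mulr_ge0 ?exprn_ge0.
  have h1 : g * 12 <= g * g ^+ 14 by rewrite ler_wpM2l// ltW.
  have h2 : g * g ^+ 14 <= (V * g) * (g * g ^+ 14).
    by rewrite ler_peMl// !mulr_ge0 ?exprn_ge0.
  have h3 : (V * g) * (g * g ^+ 14) <= M * ((V * g) * (g * g ^+ 14)).
    by rewrite ler_peMl// !mulr_ge0 ?exprn_ge0.
  lra.
split => //.
- have tge0 : 0 <= t by rewrite divr_ge0// ltW.
  apply: (le_trans (ler_wpM2l tge0 A)); rewrite le_eqVlt; apply/orP; left; apply/eqP.
  by rewrite /t; field; rewrite !lt0r_neq0.
- have Nt : N * t <= 2 * M * x ^+ 2 * g ^+ 33.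
    apply: le_of_sqr; first by rewrite !mulr_ge0 ?exprn_ge0.
    rewrite (_ : (N * t) ^+ 2 = N * (w / V)); last first.
      rewrite /t exprMn expr_div_n L2; field.
      by rewrite !lt0r_neq0.
    have wV : w / V <= 3 * g * g.
      rewrite ler_pdivrMr//.
      have : 3 * g * 1 <= 3 * g * (V * g) by rewrite ler_wpM2l// mulr_ge0// ltW.
      lra.
    apply: (le_trans (ler_wpM2l (ltW N0) wV)).
    rewrite (_ : N * (3 * g * g) = (x ^+ 4 * g ^+ 66) * (3 * M)); last by rewrite /N; ring.
    rewrite (_ : (_ ^+ 2) = (x ^+ 4 * g ^+ 66) * (4 * M * M)); last by ring.
    rewrite ler_wpM2l//; first by rewrite mulr_ge0// exprn_ge0// ltW.
    nra.
  have t2 : N * t ^+ 2 * V = w.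
    by rewrite /t expr_div_n L2; field; rewrite !lt0r_neq0.
  have -> : p * c = (N * t) * (B / tau ^+ 3) / 2 + 2 * (N * t ^+ 2 * V) +
      2 * (w / V) * (x * (B / tau ^+ 2)).
    have -> : w / V = N * t ^+ 2 by rewrite -t2; field; rewrite lt0r_neq0.
    have -> : N = 2 * p * x by rewrite pN.
    by rewrite /c; field; rewrite lt0r_neq0.
  rewrite t2; have Bt n : 0 <= B / tau ^+ n by rewrite divr_ge0// exprn_ge0// ltW.
  have b1 : (N * t) * (B / tau ^+ 3) <= 2 * (M * B).
    apply: (le_trans (ler_wpM2r (Bt _) Nt)).
    rewrite /tau [leLHS]mulrA ler_pdivrMr ?exprn_gt0 ?mulr_gt0 ?exprn_gt0//.
    rewrite (_ : 2 * (M * B) * _ = (2 * M * x ^+ 2 * g ^+ 33 * B) * (x * g ^+ 39)); last by ring.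
    rewrite ler_peMr//; first by rewrite !mulr_ge0 ?exprn_ge0.
    by rewrite -[1]mulr1 ler_pM.
  have b2 : (w / V) * (x * (B / tau ^+ 2)) <= 3 * B.
    have wV : w / V <= 3 * g * g.
      rewrite ler_pdivrMr//.
      have : 3 * g * 1 <= 3 * g * (V * g) by rewrite ler_wpM2l// mulr_ge0// ltW.
      lra.
    apply: (le_trans (ler_wpM2r (mulr_ge0 (ltW x0) (Bt _)) wV)).
    rewrite /tau !mulrA ler_pdivrMr ?exprn_gt0 ?mulr_gt0 ?exprn_gt0//.
    rewrite (_ : 3 * B * _ = (3 * g * g * x * B) * (x * g ^+ 46)); last by ring.
    rewrite ler_peMr//; first by rewrite !mulr_ge0 ?exprn_ge0.
    by rewrite -[1]mulr1 ler_pM.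
  lra.
- apply: (le_trans A); rewrite ler_pdivrMr ?mulr_gt0// ler_peMr// ?ltW//; lra.
- rewrite [leLHS]mulrA ler_pdivrMr ?exprn_gt0//.
  rewrite (_ : N * B = M * B * (x ^+ 4 * g ^+ 64)); last by rewrite /N; ring.
  rewrite (_ : M * B * g ^- 2 * tau ^+ 4 = M * B * (x ^+ 4 * g ^+ 64 * g ^+ 30)); last first.
    by rewrite /tau; field; rewrite lt0r_neq0.
  rewrite ler_wpM2l//; first by rewrite mulr_ge0.
  by rewrite ler_peMr// mulr_ge0 ?exprn_ge0.
Qed.

End parameters.

Lemma expR1_le4 {R : realType} : expR 1 <= 4 :> R.
Proof.
have := @expR_le_quadratic R 2^-1; rewrite ger0_norm// lexx => /(_ isT) h.
rewrite (_ : expR 1 = expR (2^-1) * expR (2^-1)); last first.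
  by rewrite -expRD; congr expR; lra.
have := expR_ge0 (2^-1 : R); nra.
Qed.

Lemma expR_nat_le {R : realType} (n : nat) : expR n%:R <= 4 ^+ n :> R.
Proof.
rewrite -[n%:R]mulr1 mulrC expRM_natr lerXn2r ?nnegrE ?expR_ge0//.
exact: expR1_le4.
Qed.

(** Division of k by 4E + a, with a = 64 in the application: it writes 2^k as M x^4 g^64 with g =
    2^h, x = 2^(E h) and M bounded independently of k. *)
Lemma block_exponents (k h E a : nat) : (h * (4 * E + a) <= k < h.+1 * (4 * E + a))%N ->
  [/\ k = (k - h * (4 * E + a) + E * h * 4 + h * a)%N, (k - h * (4 * E + a) <= 4 * E + a)%N &
      (0 < h)%N -> (0 < a)%N -> (E * h < k)%N].
Proof. by move=> /andP[? ?]; split=> *; nia. Qed.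

(* Blocks of length 2^(E h), where 2^h is a fixed small power of 2^k and E is
   so large that nu > 3 makes the accumulated mixing error at most 2^(-2h). *)
Lemma mixing_maximal {R : realType} (C nu B : R) : 0 < C -> 3 < nu -> 0 <= B ->
  exists (E : nat) (K : R), [/\ (0 < E)%N, 0 < K &
  forall disp (T : measurableType disp) (P : probability T R) past fut,
  mixing_system P past fut C nu -> forall (Z : nat -> T -> R) (k : nat) (V w : R),
  let h := (k %/ (4 * E + 64))%N in
  centered4 P past fut B (2 ^ (E * h)) V Z -> (2 ^+ h)^-1 <= V -> 1 <= w -> w <= 3 * h%:R ->
  pr P [set v | exists2 n, (n <= 2 ^ k)%N & 7 * Num.sqrt (w * 2 ^+ k * V) < `|psum Z 0 n v|]
    <= K * (expR (- w) + (2 ^+ h) ^- 2)].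
Proof.
move=> C0 nu3 B0.
(* The 78 is 64 + 12 + 2: [p] is at most [M0 * x ^+ 3 * g ^+ 64], the factor exp (1 + p c) costs
   g^12, and g^(-2) has to remain. *)
have [E E0 Enu] : exists2 E : nat, (0 < E)%N & 3 * E%:R + 78 <= E%:R * nu.
  exists (Num.truncn (78 / (nu - 3))).+1 => //.
  have := @truncnS_gt R (78 / (nu - 3)); move: (_.+1%:R) => e.
  by rewrite ltr_pdivrMr ?subr_gt0//; lra.
pose M0 : R := 2 ^+ (4 * E + 64).
pose K1 := M0 * B + 6 * B.
have M00 : 0 < M0 by rewrite exprn_gt0.
exists E, (4 * expR K1 + (4 * M0 * C * expR (1 + K1) + M0 * B)).
have K0 : 0 <= 4 * M0 * C * expR (1 + K1) + M0 * B.
  by rewrite addr_ge0 ?mulr_ge0 ?expR_ge0// ltW.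
split => //; first by rewrite ltr_pwDl// mulr_gt0// expR_gt0.
move=> disp T P past fut ms Z k V w h cZ gV w1 wh.
have hk : (h * (4 * E + 64) <= k)%N by rewrite leq_trunc_div.
have kh : (k < h.+1 * (4 * E + 64))%N by rewrite ltn_ceil// addn_gt0 orbT.
have [kE1 kE2 kE3] := @block_exponents k h E 64 (introT andP (conj hk kh)).
clearbody h.
have h0 : (0 < h)%N.
  by rewrite lt0n; apply: contraTneq (le_trans w1 wh) => ->; rewrite mulr0 ler10.
pose g : R := 2 ^+ h; pose x : R := 2 ^+ (E * h).
have g2 : 2 <= g by rewrite /g -(prednK h0) exprS ler_peMr// exprn_ege1// ler1n.
have g0 : 0 < g by rewrite exprn_gt0.
have x0 : 0 < x by rewrite exprn_gt0.
have x1 : 1 <= x by rewrite exprn_ege1// ler1n.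
have xg : x = g ^+ E by rewrite /x /g -exprM mulnC.
pose M : R := 2 ^+ (k - h * (4 * E + 64)).
have NM : 2 ^+ k = M * x ^+ 4 * g ^+ 64.
  by rewrite /M /x /g -!exprM -!exprD -kE1.
have M1 : 1 <= M by rewrite exprn_ege1// ler1n.
have MM0 : M <= M0 by rewrite /M /M0 ler_weXn2l ?ler1n.
have kE : (E * h < k)%N by exact: kE3.
pose p := (2 ^ (k - E * h).-1)%N.
have pN : (2 * p * 2 ^ (E * h) = 2 ^ k)%N.
  by rewrite /p -expnS prednK ?subn_gt0// -expnD subnK// ltnW.
have qx : (2 ^ (E * h))%N%:R = x by rewrite natrX.
have wg : w <= 3 * g.
  apply: (le_trans wh); rewrite ler_wpM2l// /g -natrX ler_nat ltnW//.
  exact: ltn_expl.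
have pNR : 2 * p%:R * x = M * x ^+ 4 * g ^+ 64.
  by rewrite -NM -qx -!natrM -natrX pN.
have V0 : 0 < V by apply: lt_le_trans gV; rewrite invr_gt0 exprn_gt0.
have w0 : 0 < w by apply: lt_le_trans w1.
have [L0 tx pc xL NB] := block_parameters x1 g2 M1 B0 gV w1 wg pNR.
set L := Num.sqrt _ in L0 tx pc xL.
have LE : L = Num.sqrt (w * 2 ^+ k * V) by rewrite /L NM.
set t := w / L in tx pc.
have t0 : 0 <= t by rewrite divr_ge0// ltW.
(* Since t L = w and p c <= K1 + 2w, a one-sided threshold 3L leaves the exponent K1 - w. Two
   parities and the incomplete block then give 2 * 3 + 1 = 7. *)
have lam0 : 0 <= 3 * L by rewrite mulr_ge0// ltW.
have tau0 : 0 < x * g ^+ 24 by rewrite mulr_gt0// exprn_gt0.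
have q0 : (0 < 2 ^ (E * h))%N by rewrite expn_gt0.
have H := @block_max _ _ _ P _ _ _ _ C0 nu3 ms B p _ _ V t (3 * L) B0 q0 tau0 (ltW V0) t0 lam0.
rewrite qx in H; have {}H := H tx _ cZ.
set c := (X in p%:R * X) in pc.
rewrite -/c pN in H.
have sub : [set v | exists2 n, (n <= 2 ^ k)%N & 7 * Num.sqrt (w * 2 ^+ k * V) < `|psum Z 0 n v|] `<=`
  [set v | exists2 n, (n <= 2 ^ k)%N & 2 * (3 * L) + x * (x * g ^+ 24) < `|psum Z 0 n v|].
  move=> v [n nk hn]; exists n => //; apply: le_lt_trans hn.
  by rewrite -LE; lra.
have mS r : measurable [set v | exists2 n, (n <= 2 ^ k)%N & r < `|psum Z 0 n v|].
  rewrite (_ : mkset _ = \bigcup_(n in [set n | (n <= 2 ^ k)%N]) [set v | r < `|psum Z 0 n v|])//.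
  apply: bigcup_measurable => n _; apply: measurable_set_lt => //.
  apply: measurableT_comp => //; apply: L4_mf; apply: L4_psum.
  by case: cZ.
apply: (le_trans (pr_mono P (mS _) (mS _) sub)); apply: (le_trans H).
rewrite natrX NM.
have tL : t * (3 * L) = 3 * w by rewrite /t; field; rewrite lt0r_neq0.
have e1 : expR (p%:R * c - t * (3 * L)) <= expR K1 * expR (- w).
  rewrite -expRD ler_expR tL; have : M * B <= M0 * B by rewrite ler_wpM2r.
  by rewrite /K1; lra.
(* The hypothesis w <= 3h gives exp (2w) <= exp (6h) <= 4^(6h) = g^12. *)
have e2 : expR (1 + p%:R * c) <= expR (1 + K1) * g ^+ 12.
  apply: (@le_trans _ _ (expR (1 + K1) * expR (6 * h)%:R)).
    rewrite -expRD ler_expR natrM; have : M * B <= M0 * B by rewrite ler_wpM2r.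
    by rewrite /K1; lra.
  rewrite ler_wpM2l ?expR_ge0//; apply: (le_trans (expR_nat_le _)).
  rewrite /g -exprM (_ : (4 : R) = 2 ^+ 2); last by rewrite -natrX.
  by rewrite -exprM mulnA mulnC.
have e3 : p%:R * (C * x `^ (- nu)) <= M0 * C * g ^- 14.
  have xnu : x ^+ 3 * g ^+ 78 <= x `^ nu.
    rewrite {1}xg -exprM -exprD xg -!powR_mulrn ?(ltW g0)// -powRrM.
    apply: ler_powR; first lra.
    by rewrite natrD natrM; lra.
  have xp : 0 < x ^+ 3 * g ^+ 78 by rewrite mulr_gt0// exprn_gt0.
  have px : p%:R <= M0 * x ^+ 3 * g ^+ 64.
    have -> : p%:R = 2^-1 * M * x ^+ 3 * g ^+ 64.
      apply: (mulIf (lt0r_neq0 x0)); apply: (mulfI (x := 2)) => //.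
      rewrite mulrA pNR; by field.
    rewrite !ler_wpM2r ?exprn_ge0 ?(ltW x0) ?(ltW g0)//.
    lra.
  rewrite powRN; apply: (@le_trans _ _ ((M0 * x ^+ 3 * g ^+ 64) * (C * (x ^+ 3 * g ^+ 78)^-1))).
    apply: ler_pM => //; first by rewrite mulr_ge0 ?invr_ge0 ?powR_ge0// ltW.
    by rewrite ler_wpM2l ?(ltW C0)// lef_pV2 ?posrE ?powR_gt0.
  rewrite le_eqVlt; apply/orP; left; apply/eqP; field.
  by rewrite !lt0r_neq0.
have gm2 : 0 <= g ^- 2 by rewrite invr_ge0 exprn_ge0// ltW.
have e4 : p%:R * (C * x `^ (- nu)) * expR (1 + p%:R * c) <= M0 * C * expR (1 + K1) * g ^- 2.
  apply: (@le_trans _ _ ((M0 * C * g ^- 14) * (expR (1 + K1) * g ^+ 12))).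
    apply: ler_pM => //.
    by rewrite !mulr_ge0 ?powR_ge0// ltW.
  rewrite le_eqVlt; apply/orP; left; apply/eqP; field.
  by rewrite lt0r_neq0.
have e5 : M * B * g ^- 2 <= M0 * B * g ^- 2 by rewrite !ler_wpM2r.
have ew := expR_ge0 (- w).
have : 0 <= (4 * M0 * C * expR (1 + K1) + M0 * B) * expR (- w) by rewrite mulr_ge0.
have : 0 <= expR K1 * g ^- 2 by rewrite mulr_ge0// expR_ge0.
rewrite -/g; lra.
Qed.

(** * Logarithms, powers and exponentials compared *)

Section growth.
Context {R : realType}.

(** Each degree is paid for by one factor (sqrt c)^h, through Bernoulli's inequality. *)
Lemma poly_le_exp (c : R) M : 1 < c -> exists2 K, 0 < K & forall h, h.+1%:R ^+ M <= K * c ^+ h.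
Proof.
elim: M c => [|M IH] c c1.
  by exists 1 => // h; rewrite mul1r expr0 exprn_ege1// ltW.
have c0 : 0 <= c by rewrite (le_trans ler01)// ltW.
have s1 : 1 < Num.sqrt c by rewrite -sqrtr1 ltr_sqrt// (lt_trans ltr01).
have [K K0 HK] := IH _ s1.
pose d := Num.sqrt c - 1; have d0 : 0 < d by rewrite subr_gt0.
have dV : 0 < d^-1 by rewrite invr_gt0.
exists (K * (1 + d^-1)) => [|h]; first by rewrite mulr_gt0// addr_gt0.
have s0 := sqrtr_ge0 c.
have lin : h.+1%:R <= (1 + d^-1) * Num.sqrt c ^+ h.
  have bern : 1 + h%:R * d <= Num.sqrt c ^+ h.
    elim: h => [|h IHh]; first by rewrite mul0r addr0 expr0.
    rewrite exprSr (_ : Num.sqrt c = 1 + d) in IHh *; last by rewrite /d addrC subrK.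
    have : 0 <= h%:R * d * d by rewrite !mulr_ge0 ?ler0n// ltW.
    have d1 : 0 <= 1 + d by rewrite addr_ge0// ltW.
    have := ler_wpM2r d1 IHh; rewrite -[h.+1%:R]natr1; lra.
  have D : 0 <= 1 + d^-1 by rewrite addr_ge0// ltW.
  apply: le_trans (ler_wpM2l D bern); rewrite -natr1.
  rewrite (_ : (1 + d^-1) * _ = h%:R + 1 + (h%:R * d + d^-1)); last by field; rewrite lt0r_neq0.
  by rewrite lerDl addr_ge0 ?mulr_ge0 ?ler0n// ltW.
rewrite exprS (_ : c ^+ h = Num.sqrt c ^+ h * Num.sqrt c ^+ h); last first.
  by rewrite -exprMn -expr2 sqr_sqrtr.
rewrite (_ : K * _ * _ = ((1 + d^-1) * Num.sqrt c ^+ h) * (K * Num.sqrt c ^+ h)); last by ring.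
by apply: ler_pM => //; rewrite exprn_ge0 ?ler0n.
Qed.

Lemma exp_le_poly (kap : R) a M : 0 < kap -> kap < 1 -> (0 < a)%N ->
  exists2 K, 0 < K & forall k, kap ^+ (k %/ a) <= K * k.+1%:R ^- M.
Proof.
move=> kap0 kap1 a0; have [|K K0 HK] := @poly_le_exp kap^-1 M; first by rewrite invf_gt1.
exists (a%:R ^+ M * K) => [|k]; first by rewrite mulr_gt0// exprn_gt0// ltr0n.
have k0 : 0 < k.+1%:R ^+ M :> R by rewrite exprn_gt0// ltr0n.
rewrite ler_pdivlMr//.
have ha : k.+1%:R <= a%:R * (k %/ a).+1%:R :> R.
  by rewrite -natrM ler_nat mulnC ltn_ceil.
have h1 : k.+1%:R ^+ M <= (a%:R * (k %/ a).+1%:R) ^+ M :> R.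
  by rewrite lerXn2r ?nnegrE ?mulr_ge0 ?ler0n.
have kh : 0 < kap ^+ (k %/ a) by rewrite exprn_gt0.
apply: (le_trans (ler_wpM2l (ltW kh) h1)); rewrite exprMn.
apply: (le_trans (ler_wpM2l (ltW kh) (ler_wpM2l _ (HK _)))); first by rewrite exprn_ge0// ler0n.
rewrite exprVn le_eqVlt; apply/orP; left; apply/eqP; field.
by rewrite lt0r_neq0.
Qed.

Lemma near_inv_small (e : R) : 0 < e -> \forall k \near \oo, k.+1%:R^-1 <= e.
Proof.
move=> e0; near=> k; rewrite -[e]invrK lef_pV2 ?posrE ?invr_gt0 ?ltr0n//.
apply: (@le_trans _ _ k%:R); last by rewrite ler_nat.
by near: k; exact: nbhs_infty_ger.
Unshelve. all: by end_near. Qed.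

Lemma near_exp_small (kap e : R) a : 0 < kap -> kap < 1 -> (0 < a)%N -> 0 < e ->
  \forall k \near \oo, kap ^+ (k %/ a) <= e.
Proof.
move=> kap0 kap1 a0 e0; have [K K0 HK] := exp_le_poly 1 kap0 kap1 a0.
near=> k; apply: (le_trans (HK k)); rewrite expr1 mulrC -ler_pdivlMr//.
by near: k; apply: near_inv_small; rewrite divr_gt0.
Unshelve. all: by end_near. Qed.

Lemma near_log_le (M a : nat) : (0 < a)%N ->
  \forall k \near \oo, M%:R * ln k.+1%:R <= (k %/ a)%:R :> R.
Proof.
move=> a0; have e1 : expR (-1) < 1 :> R by rewrite expR_lt1; lra.
have [K K0 HK] := exp_le_poly M.+1 (expR_gt0 (-1)) e1 a0.
near=> k; rewrite -ler_expR mulrC expRM_natr lnK ?posrE ?ltr0n//.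
have k0 : 0 < k.+1%:R :> R by rewrite ltr0n.
have kM : 0 < k.+1%:R ^+ M :> R by rewrite exprn_gt0.
have := HK k; rewrite -expRM_natr mulN1r expRN -[K * _]invrK lef_pV2 ?posrE ?expR_gt0//; last first.
  by rewrite invr_gt0 mulr_gt0// invr_gt0 exprn_gt0.
apply: le_trans; rewrite invfM invrK exprSr mulrCA ler_peMr ?(ltW kM)//.
rewrite mulrC ler_pdivlMr// mul1r -[K]invrK -[leRHS]invrK lef_pV2 ?posrE ?invr_gt0//.
by near: k; apply: near_inv_small; rewrite invr_gt0.
Unshelve. all: by end_near. Qed.

Lemma near_log_ge (c : R) : \forall k \near \oo, c <= ln k.+1%:R.
Proof.
near=> k; rewrite -ler_expR lnK ?posrE ?ltr0n//.
apply: (@le_trans _ _ k%:R); last by rewrite ler_nat.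
by near: k; exact: nbhs_infty_ger.
Unshelve. all: by end_near. Qed.

End growth.

(** * The law of the iterated logarithm for a real-parameter process *)

Section process.
Context {R : realType} disp {T : measurableType disp} (P : probability T R).
Local Notation Ex := (Ex P).
Local Notation L4 := (L4 P).
Variables (past fut : nat -> set (set T)) (C nu : R) (x : nat -> R -> T -> R) (b rho : R).

(* With [rho = 2^(-xi)], [rho ^+ (2 * j)] is the square of the Hoelder bound at
   distance 2^-j, and [2 * rho ^+ 2 < 1] says that xi > 1/2. *)
Record holder_process : Prop := {
  hp_C : 0 < C ; hp_nu : 3 < nu ; hp_ms : mixing_system P past fut C nu ;
  hp_b : 0 < b ; hp_rho : 0 < rho ; hp_rho2 : 2 * rho ^+ 2 < 1 ;
  hp_adapted : forall r, adapted past fut (fun i => x i r) ;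
  hp_L4 : forall i r, L4 (x i r) ;
  hp_Ex : forall i r, Ex (x i r) = 0 ;
  hp_pow4 : forall i r, Ex (fun w => x i r w ^+ 4) <= b ^+ 2 ;
  hp_incr : forall i j r s, `|r - s| <= 2 ^- j ->
    Ex (fun w => (x i r w - x i s w) ^+ 4) <= (b * rho ^+ (2 * j)) ^+ 2 }.

Hypothesis hp : holder_process.

Definition pdiff r s : nat -> T -> R := fun i w => x i r w - x i s w.

(* At N = 2^k, [ln k.+1] plays the role of [ln (ln N)]. *)
Definition lilscale k : R := Num.sqrt (2 ^+ k * ln k.+1%:R).

Definition exceed (Z : nat -> T -> R) k (c : R) : set T :=
  [set w | exists2 n, (n <= 2 ^ k)%N & c < `|psum Z 0 n w|].

Lemma exceed_meas Z k c : (forall i, measurable_fun setT (Z i)) -> measurable (exceed Z k c).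
Proof.
move=> mZ; rewrite /exceed (_ : mkset _ = \bigcup_(n in [set n | (n <= 2 ^ k)%N])
  [set v | c < `|psum Z 0 n v|])//.
apply: bigcup_measurable => n _; apply: measurable_set_lt => //.
apply: measurableT_comp => //.
elim: n => [|n IH].
  by rewrite (_ : psum Z 0 0 = cst 0)//; apply/funext => w; rewrite psum0.
rewrite (_ : psum Z 0 n.+1 = fun w => psum Z 0 n w + Z (0 + n)%N w).
  exact: measurable_funD.
by apply/funext => w; rewrite psumS.
Qed.

Lemma exceed_sub Z k c c' : c' <= c -> exceed Z k c `<=` exceed Z k c'.
Proof. by move=> cc w [n nk hn]; exists n => //; exact: le_lt_trans cc hn. Qed.

Lemma pdiff_adapted r s : adapted past fut (pdiff r s).
Proof.
by move=> i; have [a1 a2] := hp_adapted hp r i; have [a3 a4] := hp_adapted hp s i;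
  split; exact: measurable_funB.
Qed.

Lemma pdiff_L4 r s i : L4 (pdiff r s i).
Proof. by apply: L4B; exact: hp_L4. Qed.

Lemma pdiff_Ex r s i : Ex (pdiff r s i) = 0.
Proof.
rewrite /pdiff ExB; [|exact: L4_int (hp_L4 hp _ _)|exact: L4_int (hp_L4 hp _ _)].
by rewrite !(hp_Ex hp) subrr.
Qed.

Let Kv := 1 + (1 + 80 * Num.sqrt C) * b.

Lemma pdiff_sqr j r s a q : `|r - s| <= 2 ^- j ->
  Ex (fun w => psum (pdiff r s) a q w ^+ 2) <= q%:R * (Kv * rho ^+ (2 * j)).
Proof.
move=> rs; have rj : 0 < rho ^+ (2 * j) by rewrite exprn_gt0// (hp_rho hp).
have := psum_sqr_le_unif (hp_C hp) (hp_nu hp) (hp_ms hp) (mulr_gt0 (hp_b hp) rj)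
  (pdiff_adapted r s) (pdiff_L4 r s) (pdiff_Ex r s) (fun i => hp_incr hp i rs) a q.
move/le_trans; apply; apply: ler_wpM2l => //.
rewrite mulrA; apply: ler_wpM2r; first exact: ltW.
by rewrite /Kv lerDr.
Qed.

(* Up to the level j = k / a the exponential maximal inequality applies, beyond
   it Rademacher-Menshov does. *)
Lemma increments M : exists K2 th kap K : R, [/\ 0 < K2, 0 < th < 1, 0 < kap < 1, 0 < K &
  \forall k \near \oo, forall j r s, `|r - s| <= 2 ^- j ->
    pr P (exceed (pdiff r s) k (K2 * th ^+ j * lilscale k)) <=
      K * k.+1%:R ^- M * (kap / 2) ^+ j].
Proof.
have [C0 nu3 ms b0 rho0 rho2 _ _ _ _ _] := hp.
have b20 : 0 <= b ^+ 2 by rewrite sqr_ge0.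
have [E [K0 [E0 K00 maxi]]] := mixing_maximal C0 nu3 b20.
pose a := (4 * E + 64)%N; have a_gt0 : (0 < a)%N by rewrite /a addn_gt0 orbT.
have Kv1 : 1 <= Kv.
  by rewrite /Kv lerDl mulr_ge0 ?(ltW b0)//.
have Kv0 : 0 < Kv by apply: lt_le_trans Kv1.
(* The ratio of the thresholds needs th^2 > 1/2, so that (2 th^2)^j absorbs the factor j + 1 on the
   coarse levels, and th^2 > 2 rho^2, so that the number of grid points is beaten on the fine ones.
   Both follow from th^2 > a0. *)
pose a0 := 2^-1 + rho ^+ 2; pose th := (1 + a0) / 2.
have r20 : 0 < rho ^+ 2 by rewrite exprn_gt0.
have a01 : a0 < 1 by rewrite /a0; lra.
have th0 : 0 < th by rewrite /th /a0; lra.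
have th1 : th < 1 by rewrite /th; lra.
have tha0 : a0 < th ^+ 2.
  have : 0 < (1 - a0) ^+ 2 by rewrite exprn_gt0// subr_gt0.
  by rewrite /th => ?; nra.
have th20 : 0 < th ^+ 2 by rewrite exprn_gt0.
pose kp := 2 * rho ^+ 2 / th ^+ 2.
have kp0 : 0 < kp by rewrite divr_gt0// mulr_gt0.
have kp1 : kp < 1 by rewrite ltr_pdivrMr// mul1r; move: tha0; rewrite /a0; lra.
(* By the arithmetic-geometric mean kap^2 is at least kp', hence at least kp and at least 1/2. Of
   the two factors kap gained per level, one keeps the sum over j finite and the other beats powers
   of k. *)
pose kp' := (1 + kp) / 2; pose kap := (1 + kp') / 2.
have kp'1 : kp' < 1 by rewrite /kp'; lra.
have kap0 : 0 < kap by rewrite /kap /kp'; lra.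
have kap1 : kap < 1 by rewrite /kap; lra.
have kap2 : kp' <= kap ^+ 2.
  by have := sqr_ge0 (1 - kp'); rewrite /kap; nra.
have kap2' : 2^-1 <= kap ^+ 2 by apply: le_trans kap2; rewrite /kp'; lra.
have kap2'' : kp <= kap ^+ 2 by apply: le_trans kap2; rewrite /kp'; lra.
have kaph : 2^-1 <= kap by rewrite /kap /kp'; lra.
have th22 : 1 < 2 * th ^+ 2 by move: tha0; rewrite /a0; lra.
have kpE : kp / 2 = rho ^+ 2 / th ^+ 2 by rewrite /kp; field; rewrite lt0r_neq0.
clearbody kap kp' kp th a0.
have [Kp Kp0 HKp] := poly_le_exp 1 th22.
have [Kq Kq0 HKq] := exp_le_poly (M + 2) kap0 kap1 a_gt0.
pose K22 := 49 * (M.+3%:R * Kv * Kp); pose K2 := Num.sqrt K22.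
have K220 : 0 < K22 by rewrite !mulr_gt0// ltr0n.
have K20 : 0 < K2 by rewrite sqrtr_gt0.
have K2E : K2 ^+ 2 = K22 by rewrite sqr_sqrtr// ltW.
clearbody K2.
exists K2, th, kap, (K0 * (1 + Kq) + Kv / K22 * Kq).
have Kpos1 : 0 < K0 * (1 + Kq) by rewrite mulr_gt0// addr_gt0.
have Kpos2 : 0 < Kv / K22 * Kq by rewrite mulr_gt0// divr_gt0.
split; rewrite ?th0 ?kap0 ?addr_gt0//.
have near1 := @near_log_le R M.+1 a a_gt0.
have near2 := @near_log_ge R 1.
near=> k => j r s rs.
have logh : M.+1%:R * ln k.+1%:R <= (k %/ a)%:R :> R by near: k; exact: near1.
have log1 : 1 <= ln k.+1%:R :> R by near: k; exact: near2.
have log0 : 0 < ln k.+1%:R :> R by apply: lt_le_trans log1.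
have k0 : 0 < k.+1%:R :> R by rewrite ltr0n.
have k1 : 1 <= k.+1%:R :> R by rewrite ler1n.
have Wk2 : lilscale k ^+ 2 = 2 ^+ k * ln k.+1%:R.
  by rewrite sqr_sqrtr// mulr_ge0 ?exprn_ge0// ltW.
have Wk0 : 0 < lilscale k by rewrite sqrtr_gt0 mulr_gt0 ?exprn_gt0.
have lam0 : 0 < K2 * th ^+ j * lilscale k by rewrite !mulr_gt0// exprn_gt0.
have kj0 : 0 < (kap / 2) ^+ j by rewrite exprn_gt0// divr_gt0.
have kM0 : 0 < k.+1%:R ^- M :> R by rewrite invr_gt0 exprn_gt0.
have X0 : 0 <= Kv / K22 * Kq * k.+1%:R ^- M * (kap / 2) ^+ j.
  exact: mulr_ge0 (mulr_ge0 (ltW Kpos2) (ltW kM0)) (ltW kj0).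
have kMM : k.+1%:R ^- (M + 2) <= k.+1%:R ^- M :> R.
  by rewrite lef_pV2 ?posrE ?exprn_gt0// ler_weXn2l// leq_addr.
set h := (k %/ a)%N in logh HKq.
have {}HKq := HKq k; rewrite -/h in HKq.
have rho_half : rho ^+ (2 * j) <= 2 ^- j.
  by rewrite exprM -exprVn lerXn2r ?nnegrE ?(ltW r20) ?invr_ge0//; lra.
(* Beyond level h, kp^j <= kap^j kap^h, and kap^h is below every power of 1/k; the exponent M + 2 in
   [HKq] offsets the (k + 1)^2 of Rademacher-Menshov. *)
have [jh|hj] := leqP j h; last first.
  have ZK c q : Ex (fun w => psum (pdiff r s) c q w ^+ 2) <= q%:R * (Kv * rho ^+ (2 * j)).
    exact: pdiff_sqr.
  apply: (le_trans (rademacher_menshov k (pdiff_L4 r s) lam0 ZK)).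
  rewrite !exprMn K2E Wk2 [rho ^+ (2 * j)]exprM -[(th ^+ j) ^+ 2]exprM mulnC exprM.
  have -> : k.+1%:R ^+ 2 * (2 ^ k)%N%:R * (Kv * (rho ^+ 2) ^+ j) /
     (K22 * (th ^+ 2) ^+ j * (2 ^+ k * ln k.+1%:R)) =
     k.+1%:R ^+ 2 * (Kv / K22) * (kp / 2) ^+ j / ln k.+1%:R.
    rewrite natrX kpE expr_div_n; field.
    by rewrite !lt0r_neq0// ?exprn_gt0.
  rewrite ler_pdivrMr//.
  have A0 : 0 <= Kv / K22 * k.+1%:R ^+ 2 by rewrite mulr_ge0 ?exprn_ge0 ?divr_ge0// ltW.
  have kpj : (kp / 2) ^+ j <= (kap / 2) ^+ j * kap ^+ h.
    rewrite !exprMn mulrAC; apply: ler_wpM2r; first by rewrite exprn_ge0// invr_ge0.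
    apply: (@le_trans _ _ ((kap ^+ 2) ^+ j)).
      by rewrite lerXn2r ?nnegrE ?exprn_ge0 ?(ltW kp0) ?(ltW kap0).
    rewrite -exprM mul2n -addnn exprD ler_wpM2l ?exprn_ge0 ?(ltW kap0)//.
    by rewrite ler_wiXn2l ?(ltW kap0) ?(ltW kap1)// ltnW.
  have B1 : k.+1%:R ^+ 2 * (Kv / K22) * (kp / 2) ^+ j <=
      Kv / K22 * Kq * k.+1%:R ^- M * (kap / 2) ^+ j.
    rewrite [_ ^+ 2 * _]mulrC; apply: (le_trans (ler_wpM2l A0 kpj)).
    apply: (le_trans (ler_wpM2l A0 (ler_wpM2l (ltW kj0) HKq))).
    rewrite le_eqVlt; apply/orP; left; apply/eqP; rewrite exprD; field.
    by rewrite !lt0r_neq0// exprn_gt0.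
  apply: (le_trans B1); rewrite -[leLHS]mulr1; apply: ler_pM => //.
  have KK : Kv / K22 * Kq <= K0 * (1 + Kq) + Kv / K22 * Kq by rewrite lerDr ltW.
  rewrite -[kap ^+ j * _]exprMn; exact: (ler_wpM2r (ltW kj0) (ler_wpM2r (ltW kM0) KK)).
(* The part 2j of [w] gives exp (-2j) <= (kap / 2)^j, because exp (-2) <= 1/4. Weakening rho^(2j) to
   2^(-j) in [V] keeps V >= 2^(-h) for all j <= h. *)
pose V : R := Kv * 2 ^- j; pose w : R := M.+1%:R * ln k.+1%:R + 2 * j%:R.
have V0 : 0 < V by rewrite mulr_gt0// invr_gt0 exprn_gt0.
have w1 : 1 <= w.
  rewrite /w; have : 0 <= j%:R :> R by rewrite ler0n.
  have : ln k.+1%:R <= M.+1%:R * ln k.+1%:R :> R by rewrite ler_peMl ?ler1n// ltW.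
  lra.
have jhR : j%:R <= h%:R :> R by rewrite ler_nat.
have wh : w <= 3 * h%:R by rewrite /w; lra.
have gV : (2 ^+ h)^-1 <= V.
  rewrite /V -[leLHS]mul1r; apply: ler_pM => //.
  by rewrite lef_pV2 ?posrE ?exprn_gt0// ler_weXn2l// ler1n.
have cZ : centered4 P past fut (b ^+ 2) (2 ^ (E * h))%N V (pdiff r s).
  split; [exact: pdiff_adapted|exact: pdiff_L4|exact: pdiff_Ex| |].
  - move=> i; apply: (le_trans (hp_incr hp i rs)).
    rewrite exprMn ler_piMr// exprn_ile1 ?exprn_ge0 ?(ltW rho0)// exprM exprn_ile1 ?(ltW r20)//; lra.
  - move=> c; apply: (le_trans (pdiff_sqr _ _ rs)); apply: ler_wpM2l => //.
    by rewrite /V ler_wpM2l ?(ltW Kv0).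
have := maxi _ _ _ _ _ ms _ _ _ _ cZ gV w1 wh; rewrite -/(exceed _ _ _).
have mD i : measurable_fun setT (pdiff r s i) by case: (pdiff_L4 r s i).
have thr : 7 * Num.sqrt (w * 2 ^+ k * V) <= K2 * th ^+ j * lilscale k.
  apply: le_of_sqr; first exact: ltW.
  rewrite !exprMn K2E Wk2 sqr_sqrtr; last first.
    exact: mulr_ge0 (mulr_ge0 (le_trans ler01 w1) (exprn_ge0 _ (ler0n _ 2))) (ltW V0).
  have wle : w <= M.+3%:R * j.+1%:R * ln k.+1%:R.
    rewrite /w; have hj1 : 1 <= j.+1%:R :> R by rewrite ler1n.
    have : M.+1%:R * ln k.+1%:R * 1 <= M.+1%:R * ln k.+1%:R * j.+1%:R :> R.
      by rewrite ler_wpM2l// mulr_ge0 ?ler0n// ltW.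
    have : 2 * j.+1%:R * 1 <= 2 * j.+1%:R * ln k.+1%:R :> R by rewrite ler_wpM2l ?mulr_ge0.
    have : j%:R <= j.+1%:R :> R by rewrite ler_nat.
    rewrite -[M.+3%:R]natr1 -[M.+2%:R]natr1; lra.
  have := HKp j; rewrite expr1 exprMn => Hj.
  have w2 : w * 2 ^- j <= M.+3%:R * Kp * (th ^+ 2) ^+ j * ln k.+1%:R.
    rewrite ler_pdivrMr ?exprn_gt0//; apply: (le_trans wle).
    have nn : 0 <= M.+3%:R * ln k.+1%:R :> R by rewrite mulr_ge0 ?ler0n// ltW.
    have := ler_wpM2l nn Hj; lra.
  rewrite (_ : 7 ^+ 2 * _ = (49 * 2 ^+ k * Kv) * (w * 2 ^- j)); last by rewrite /V; ring.
  rewrite -[(th ^+ j) ^+ 2]exprM mulnC exprM.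
  rewrite (_ : K22 * _ * _ = (49 * 2 ^+ k * Kv) * (M.+3%:R * Kp * (th ^+ 2) ^+ j * ln k.+1%:R)); last first.
    by rewrite /K22; ring.
  by rewrite ler_wpM2l// !mulr_ge0 ?exprn_ge0// ltW.
move=> Hm; apply: (le_trans (pr_mono P (exceed_meas _ _ mD) (exceed_meas _ _ mD) (@exceed_sub _ _ _ _ thr))).
apply: (le_trans Hm).
have ew : expR (- w) <= k.+1%:R ^- M * (kap / 2) ^+ j.
  rewrite /w opprD expRD; apply: ler_pM; rewrite ?expR_ge0//.
    rewrite expRN lef_pV2 ?posrE ?expR_gt0 ?exprn_gt0// mulrC expRM_natr lnK ?posrE//.
    by rewrite ler_weXn2l.
  rewrite -mulNr expRM_natr lerXn2r ?nnegrE ?expR_ge0 ?divr_ge0 ?(ltW kap0)//.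
  apply: (@le_trans _ _ (4^-1)); last by lra.
  rewrite expRN lef_pV2 ?posrE ?expR_gt0// (_ : (2 : R) = 1 + 1)// expRD.
  have := @expR_ge1Dx R 1; nra.
have h2 : (2 ^+ h) ^- 2 <= Kq * k.+1%:R ^- M * (kap / 2) ^+ j.
  apply: (@le_trans _ _ (kap ^+ h * (kap / 2) ^+ j)); last first.
    apply: ler_wpM2r; [exact: ltW|apply: (le_trans HKq)].
    by apply: ler_wpM2l => //; exact: ltW.
  have -> : (2 ^+ h) ^- 2 = 2^-1 ^+ h * 2^-1 ^+ h :> R.
    by rewrite exprVn -invfM -expr2.
  rewrite exprMn mulrA.
  apply: ler_pM; rewrite ?exprn_ge0 ?invr_ge0//; last first.
    by rewrite ler_wiXn2l ?invr_ge0// invf_le1// ler1n.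
  apply: (@le_trans _ _ ((kap ^+ 2) ^+ h)); first by rewrite lerXn2r ?nnegrE ?exprn_ge0 ?invr_ge0 ?(ltW kap0).
  rewrite -exprM mul2n -addnn exprD ler_wpM2l ?exprn_ge0 ?(ltW kap0)//.
  by rewrite ler_wiXn2l ?(ltW kap0) ?(ltW kap1).
have := ler_wpM2l (ltW K00) (lerD ew h2); lra.
Unshelve. all: by end_near. Qed.

(** Probability k^(-M) needs w = M ln (k + 1), and the threshold becomes 7 sqrt (M V) times the
    scale. Only the product M V matters: a smaller variance buys a larger M. The 18 comes from 49 *
    6 <= 18^2. *)
Lemma net_points (M : nat) (V s2 : R) (dom : nat -> R -> Prop) :
  (0 < M)%N -> 0 < V -> 0 < s2 -> M%:R * V <= 6 * s2 ->
  (exists q0, forall k r, dom k r -> forall q a, (q0 <= q)%N ->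
    Ex (fun w => psum (fun i => x i r) a q w ^+ 2) <= q%:R * V) ->
  exists2 K, 0 < K & \forall k \near \oo, forall r, dom k r ->
    pr P (exceed (fun i => x i r) k (18 * Num.sqrt s2 * lilscale k)) <= K * k.+1%:R ^- M.
Proof.
have [C0 nu3 ms b0 _ _ xad xL xE x4 _] := hp.
move=> Mgt0 V0 s0 MV [q0 Hq0].
have b20 : 0 <= b ^+ 2 by rewrite sqr_ge0.
have [E [K0 [E0 K00 maxi]]] := mixing_maximal C0 nu3 b20.
pose a := (4 * E + 64)%N; have a_gt0 : (0 < a)%N by rewrite /a addn_gt0 orbT.
have half0 : 0 < 2^-1 :> R by rewrite invr_gt0.
have half1 : 2^-1 < 1 :> R by rewrite invf_lt1// ltr1n.
have [Kq Kq0 HKq] := exp_le_poly M half0 half1 a_gt0.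
exists (K0 * (1 + Kq)); first by rewrite mulr_gt0// addr_gt0.
have near1 := @near_log_le R M a a_gt0.
have near2 := @near_log_ge R 1.
have near3 := near_exp_small half0 half1 a_gt0 V0.
have q1 : 0 < q0.+1%:R^-1 :> R by rewrite invr_gt0 ltr0n.
have near4 := near_exp_small half0 half1 a_gt0 q1.
near=> k => r domr.
have logh : M%:R * ln k.+1%:R <= (k %/ a)%:R :> R by near: k; exact: near1.
have log1 : 1 <= ln k.+1%:R :> R by near: k; exact: near2.
have hV : 2^-1 ^+ (k %/ a) <= V by near: k; exact: near3.
have hq : 2^-1 ^+ (k %/ a) <= q0.+1%:R^-1 :> R by near: k; exact: near4.
have {}HKq := HKq k; set h := (k %/ a)%N in logh hV hq HKq.
have log0 : 0 < ln k.+1%:R :> R by apply: lt_le_trans log1.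
have h2 : 2^-1 ^+ h = (2 ^+ h)^-1 :> R by rewrite exprVn.
have q0h : (q0 <= 2 ^ (E * h))%N.
  apply: (@leq_trans (2 ^ h)); last by rewrite leq_exp2l// leq_pmull.
  rewrite ltnW// -(@ler_nat R) natrX.
  by move: hq; rewrite h2 lef_pV2 ?posrE ?exprn_gt0 ?ltr0n.
pose w : R := M%:R * ln k.+1%:R.
have M1 : 1 <= M%:R :> R by rewrite ler1n.
have w1 : 1 <= w by rewrite -[1]mulr1 ler_pM.
have h0R : 0 <= h%:R :> R by rewrite ler0n.
have wh : w <= 3 * h%:R by rewrite /w; lra.
have cZ : centered4 P past fut (b ^+ 2) (2 ^ (E * h))%N V (fun i => x i r).
  by split => // c; exact: (Hq0 k).
have := maxi _ _ _ _ _ ms _ _ _ _ cZ _ w1 wh; rewrite -/(exceed _ _ _) -h2 => /(_ hV) Hm.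
have mD i : measurable_fun setT (x i r) by case: (xL i r).
have thr : 7 * Num.sqrt (w * 2 ^+ k * V) <= 18 * Num.sqrt s2 * lilscale k.
  apply: le_of_sqr; first by rewrite !mulr_ge0 ?sqrtr_ge0.
  have p2 : 0 <= 2 ^+ k :> R by rewrite exprn_ge0.
  rewrite !exprMn !sqr_sqrtr ?(ltW s0) ?mulr_ge0 ?(ltW V0) ?(ltW log0) ?(le_trans ler01 w1)//.
  have := ler_wpM2l (mulr_ge0 p2 (ltW log0)) MV.
  have : 0 <= 2 ^+ k * ln k.+1%:R * s2 by rewrite !mulr_ge0 ?(ltW log0) ?(ltW s0).
  rewrite /w; lra.
apply: (le_trans (pr_mono P (exceed_meas _ _ mD) (exceed_meas _ _ mD) (@exceed_sub _ _ _ _ thr))).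
apply: (le_trans Hm); rewrite -mulrA; apply: ler_wpM2l; first exact: ltW.
have ew : expR (- w) = k.+1%:R ^- M.
  by rewrite expRN /w mulrC expRM_natr lnK ?posrE ?ltr0n.
rewrite ew mulrDl mul1r lerD2l.
rewrite [leLHS](_ : _ = 2^-1 ^+ h * 2^-1 ^+ h); last by rewrite h2 -invfM -expr2.
apply: le_trans HKq; rewrite ler_piMr ?exprn_ge0 ?(ltW half0)//.
by rewrite exprn_ile1 ?(ltW half0) ?(ltW half1).
Unshelve. all: by end_near. Qed.

End process.

(** * Dyadic chaining and summation over k *)

Section chaining.
Context {R : realType}.

Definition grid (L j i : nat) : R := i%:R / 2 ^+ j - L%:R.

Lemma grid_refine L j i : grid L j.+1 (2 * i) = grid L j i.
Proof.
rewrite /grid exprS natrM; congr (_ - _); field.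
by rewrite expf_neq0.
Qed.

(** The point r is approached by its binary truncations, counted from -L. At each level the
    truncation stays or moves to the next odd point, so only increments between neighbours 2i and 2i
    + 1 occur; continuity carries the bound to r. *)
Lemma dyadic_chaining (f : R -> R) (L j0 : nat) (c0 c1 : R) (lam : nat -> R) :
  continuous f -> (forall j, 0 <= lam j) ->
  (forall i, (i <= 2 * L * 2 ^ j0)%N -> `|f (grid L j0 i)| <= c0) ->
  (forall j i, (i <= 2 * L * 2 ^ (j0 + j))%N ->
    `|f (grid L (j0 + j).+1 (2 * i).+1) - f (grid L (j0 + j).+1 (2 * i))| <= lam j) ->
  (forall n, \sum_(j < n) lam j <= c1) ->
  forall r, `|r| <= L%:R -> `|f r| <= c0 + c1.
Proof.
move=> cf lam0 f0 fj sl r rL.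
have r0 : 0 <= r + L%:R by move: rL; rewrite ler_norml => /andP[? _]; lra.
have r1 : r + L%:R <= 2 * L%:R by move: rL; rewrite ler_norml => /andP[_ ?]; lra.
pose idx j := Num.truncn ((r + L%:R) * 2 ^+ j).
have p2 j : 0 < 2 ^+ j :> R by rewrite exprn_gt0.
have idxP j : (idx j)%:R <= (r + L%:R) * 2 ^+ j < (idx j).+1%:R.
  by apply: truncn_itv; rewrite mulr_ge0// ltW.
have idx_le j : (idx j <= 2 * L * 2 ^ j)%N.
  rewrite -(@ler_nat R) !natrM natrX; have /andP[h _] := idxP j.
  by apply: (le_trans h); rewrite ler_wpM2r// ltW.
have idxS j : idx j.+1 = (2 * idx j)%N \/ idx j.+1 = (2 * idx j).+1.
  have /andP[h1 h2] := idxP j; have /andP[h3 h4] := idxP j.+1.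
  have a1 : (2 * idx j < (idx j.+1).+1)%N.
    rewrite -(@ltr_nat R) natrM; apply: le_lt_trans h4.
    by rewrite exprS mulrCA ler_wpM2l.
  have a2 : (idx j.+1 < 2 * (idx j).+1)%N.
    rewrite -(@ltr_nat R) natrM; apply: (le_lt_trans h3).
    by rewrite exprS mulrCA ltr_pM2l.
  move: a1 a2; rewrite mulnS; move: (idx j.+1) (idx j) => a c; lia.
have bound n : `|f (grid L (j0 + n) (idx (j0 + n)%N))| <= c0 + \sum_(j < n) lam j.
  elim: n => [|n IH]; first by rewrite addn0 big_ord0 addr0; exact: f0.
  rewrite addnS big_ord_recr /= addrA.
  have := fj n (idx (j0 + n)%N) (idx_le _); have := lam0 n.
  case: (idxS (j0 + n)%N) => ->; first by rewrite grid_refine; lra.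
  rewrite [grid L _.+1 (2 * _)%N]grid_refine => _ h.
  rewrite -[X in `|X|](subrK (f (grid L (j0 + n) (idx (j0 + n)%N)))) addrC.
  by apply: (le_trans (ler_normD _ _)); exact: lerD.
apply/ler_addgt0Pr => e e0.
have /cvgrPdist_lt/(_ e e0)/nbhs_ballP[d /= d0 Hd] := cf r.
have [n nd] : exists n, 2^-1 ^+ n < d :> R.
  have h0 : 0 < 2^-1 :> R by rewrite invr_gt0.
  have h1 : 2^-1 < 1 :> R by rewrite invf_lt1// ltr1n.
  have d20 : 0 < d / 2 by rewrite divr_gt0.
  have [n _ Hn] := near_exp_small h0 h1 (ltn0Sn 0) d20.
  exists n; have := Hn n (leqnn n); rewrite /= divn1 => /le_lt_trans; apply; lra.
have := Hd (grid L (j0 + n) (idx (j0 + n)%N)).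
have gr : `|r - grid L (j0 + n) (idx (j0 + n)%N)| < d.
  apply: le_lt_trans nd; rewrite /grid.
  rewrite (_ : r - _ = (r + L%:R) - (idx (j0 + n)%N)%:R / 2 ^+ (j0 + n)); last by ring.
  have /andP[h1 h2] := idxP (j0 + n)%N.
  rewrite -(@ler_pM2r _ (2 ^+ (j0 + n)))// -{2}[2 ^+ (j0 + n)]ger0_norm ?(ltW (p2 _))//.
  rewrite -normrM mulrBl divfK ?lt0r_neq0//.
  rewrite (_ : 2^-1 ^+ n * _ = 2 ^+ j0); last first.
    by rewrite exprVn exprD mulrCA mulVf ?lt0r_neq0// mulr1.
  apply: (@le_trans _ _ 1); last by rewrite exprn_ege1// ler1n.
  rewrite ler_norml; move: h1 h2; rewrite -natr1 => h1 h2; apply/andP; split; lra.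
rewrite /ball /= => /(_ gr) fe.
have := bound n; have := sl n.
have := lerB_normD (f r) 0; have := ler_normD (f r - f (grid L (j0 + n) (idx (j0 + n)%N))) (f (grid L (j0 + n) (idx (j0 + n)%N))).
rewrite subrK; lra.
Qed.

Lemma geom_sum_le (z : R) n : 0 <= z -> z < 1 -> \sum_(j < n) z ^+ j <= (1 - z)^-1.
Proof.
move=> z0 z1; rewrite -[leRHS]mul1r ler_pdivlMr ?subr_gt0//.
elim: n => [|n IH]; first by rewrite big_ord0 mul0r.
suff -> : (\sum_(j < n.+1) z ^+ j) * (1 - z) = 1 - z ^+ n.+1 by rewrite gerBl exprn_ge0.
elim: n.+1 => [|k IHk]; first by rewrite big_ord0 mul0r subrr.
by rewrite big_ord_recr /= mulrDl IHk exprSr; ring.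
Qed.

Lemma sum_inv_sqr_le n : \sum_(k < n) k.+1%:R ^- 2 <= 2 :> R.
Proof.
case: n => [|n]; first by rewrite big_ord0.
suff H : \sum_(k < n.+1) k.+1%:R ^- 2 <= 2 - n.+1%:R^-1 :> R.
  by apply: (le_trans H); rewrite gerBl invr_ge0.
elim: n => [|n IH]; first by rewrite big_ord1 expr1n invr1; lra.
rewrite big_ord_recr /=; apply: (le_trans (lerD IH (lexx _))).
have a0 : 0 < n.+1%:R :> R by rewrite ltr0n.
rewrite -[n.+2%:R]natr1; move: (n.+1%:R) a0 => a a0.
have a1 : 0 < a + 1 by lra.
rewrite -addrA lerD2l -subr_ge0.
rewrite (_ : _ - _ = (a * (a + 1) ^+ 2)^-1); first by rewrite invr_ge0 mulr_ge0 ?exprn_ge0 ?ltW.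
by field; rewrite !lt0r_neq0.
Qed.

End chaining.

Section almost_sure.
Context {R : realType} disp {T : measurableType disp} (P : probability T R).

Lemma borel_cantelli_sqr (G : nat -> set T) (K : R) :
  (forall k, measurable (G k)) -> (\forall k \near \oo, pr P (G k) <= K * k.+1%:R ^- 2) ->
  {ae P, forall w, \forall k \near \oo, ~ G k w}.
Proof.
move=> mG [k0 _ HG].
(* Emptying the events before [k0] makes the probability bound hold for every k without changing the
   upper limit of the events. *)
pose G' k := if (k0 <= k)%N then G k else set0.
have mG' k : measurable (G' k) by rewrite /G'; case: ifP.
have K0 : 0 <= K.
  have := HG k0 (leqnn k0); rewrite /= => /(le_trans (pr_ge0 P _)).
  by rewrite pmulr_lge0// invr_gt0 exprn_gt0// ltr0n.
have prG k : pr P (G' k) <= K * k.+1%:R ^- 2.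
  rewrite /G'; case: ifPn => [kk|_]; first exact: HG.
  by rewrite /pr measure0 mulr_ge0// invr_ge0 exprn_ge0.
exists (lim_sup_set G'); split.
- by apply: bigcapT_measurable => n; apply: bigcup_measurable.
- apply: lim_sup_set_cvg0 => //.
  apply: (@le_lt_trans _ _ (K * 2)%:E); last exact: ltry.
  apply: lime_le; first by apply: is_cvg_nneseries => *; exact: measure_ge0.
  apply: nearW => n; rewrite big_mkord.
  rewrite (eq_bigr (fun k : 'I_n => (pr P (G' k))%:E)); last by move=> k _; rewrite EFin_pr.
  rewrite sumEFin lee_fin; apply: (@le_trans _ _ (\sum_(k < n) K * k.+1%:R ^- 2)).
    by apply: ler_sum => k _; exact: prG.
  by rewrite -mulr_sumr ler_wpM2l// sum_inv_sqr_le.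
- move=> w /= H n _; apply: contrapT => Hn; apply: H.
  exists (maxn n k0) => // k /=; rewrite geq_max => /andP[nk k0k] Gk.
  by apply: Hn; exists k => //; rewrite /G' k0k.
Qed.

End almost_sure.

Section process_bound.
Context {R : realType} disp {T : measurableType disp} (P : probability T R).
Local Notation Ex := (Ex P).

Lemma pr_bigsetU_cst n (A : nat -> set T) (c : R) : (forall i, measurable (A i)) ->
  (forall i, (i < n)%N -> pr P (A i) <= c) ->
  pr P (\big[setU/set0]_(i < n) A i) <= n%:R * c.
Proof.
move=> mA Ac; apply: (le_trans (@pr_bigsetU_le _ _ _ P n A mA)).
rewrite (_ : n%:R * c = \sum_(i < n) c); last by rewrite sumr_const card_ord mulr_natl.
by apply: ler_sum => i _; exact: Ac.
Qed.

Lemma bigsetU_notin n (A : nat -> set T) w i : ~ (\big[setU/set0]_(i < n) A i) w ->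
  (i < n)%N -> ~ A i w.
Proof. by move=> H iN Ai; apply: H; rewrite -bigcup_mkord; exists i. Qed.

Variables (past fut : nat -> set (set T)) (C nu : R) (x : nat -> R -> T -> R) (b rho : R).
Hypothesis hp : holder_process P past fut C nu x b rho.
Hypothesis xcont : forall i w, continuous (fun r => x i r w).
Variables (s2 : R) (ell : nat -> nat) (A m : nat).
Hypothesis s20 : 0 < s2.
Hypothesis longrun : exists q0, forall r q a, (q0 <= q)%N ->
  Ex (fun w => psum (fun i => x i r) a q w ^+ 2) <= q%:R * (3 * s2).
Hypothesis ell_le : forall k, (ell k <= A * k.+1 ^ m)%N.
Hypothesis far_small : forall e : R, 0 < e -> exists y : nat, forall k r,
  y%:R <= `|r| <= (ell k)%:R -> forall a q,
  Ex (fun w => psum (fun i => x i r) a q w ^+ 2) <= q%:R * e.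

Lemma psum_cont n w : continuous (fun r => psum (fun i => x i r) 0 n w).
Proof.
elim: n => [|n IH].
  rewrite (_ : (fun r => _) = cst 0); first exact: cst_continuous.
  by apply/funext => r; rewrite psum0.
rewrite (_ : (fun r => _) = (fun r => psum (fun i => x i r) 0 n w + x (0 + n)%N r w)).
  by move=> r; apply: cvgD; [exact: IH|exact: xcont].
by apply/funext => r; rewrite psumS.
Qed.

Lemma psum_pdiff r s n w :
  psum (fun i => x i r) 0 n w - psum (fun i => x i s) 0 n w = psum (pdiff x r s) 0 n w.
Proof. by rewrite /psum -sumrB. Qed.

(** The 19 is 18 for the net of mesh 2^(-j0) plus 1 for all finer increments. The mesh does not
    depend on k; only the length of the interval does. *)
Theorem process_lil : {ae P, forall w, \forall k \near \oo, forall n r,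
  (n <= 2 ^ k)%N -> `|r| <= (ell k)%:R ->
  `|psum (fun i => x i r) 0 n w| <= 19 * Num.sqrt s2 * lilscale k}.
Proof.
have [K2 [th [kap [K1 [K20 /andP[th0 th1] /andP[kap0 kap1] K10 near_incr]]]]] :=
  increments hp (m + 2).
have sg0 : 0 < Num.sqrt s2 by rewrite sqrtr_gt0.
have th1' : 0 < 1 - th by rewrite subr_gt0.
have kap1' : 0 < 1 - kap by rewrite subr_gt0.
(* [K2] is a model constant; starting the chaining at [j0] reduces the whole geometric sum of
   thresholds to sqrt s2. *)
have [j0 j0P] : exists j0, K2 * th ^+ j0 / (1 - th) <= Num.sqrt s2.
  have e0 : 0 < Num.sqrt s2 * (1 - th) / K2 by rewrite divr_gt0// mulr_gt0.
  have [n _ Hn] := near_exp_small th0 th1 (ltn0Sn 0) e0.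
  exists n; have := Hn n (leqnn n); rewrite /= divn1 ler_pdivlMr//.
  by rewrite ler_pdivrMr// mulrC.
have V30 : 0 < 3 * s2 by rewrite mulr_gt0.
have h32 : 2%:R * (3 * s2) <= 6 * s2 by lra.
have hq3 : exists q0, forall (k : nat) (r : R), True -> forall q a, (q0 <= q)%N ->
    Ex (fun w => psum (fun i => x i r) a q w ^+ 2) <= q%:R * (3 * s2).
  by have [q0 Hq] := longrun; exists q0 => k r _ q a; exact: Hq.
have [K3 K30 near_net] := net_points hp (isT : (0 < 2)%N) V30 s20 h32 hq3.
have m20 : 0 < (m + 2)%:R :> R by rewrite ltr0n addn_gt0 orbT.
(* The far net has of the order of k^m points, hence the exponent m + 2; this variance rate keeps
   the product in [net_points] at 6 s2. For the points within Y the exponent 2 and the rate 3 s2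
   suffice. *)
have Ve : 0 < 6 * s2 / (m + 2)%:R by rewrite divr_gt0// mulr_gt0.
have [Y HY] := far_small Ve.
pose dom k (r : R) := Y%:R <= `|r| <= (ell k)%:R.
have mgt0 : (0 < m + 2)%N by rewrite addn_gt0 orbT.
have hM : (m + 2)%:R * (6 * s2 / (m + 2)%:R) <= 6 * s2 by rewrite mulrC divfK// lt0r_neq0.
have hq4 : exists q0, forall (k : nat) (r : R), dom k r -> forall q a, (q0 <= q)%N ->
    Ex (fun w => psum (fun i => x i r) a q w ^+ 2) <= q%:R * (6 * s2 / (m + 2)%:R).
  by exists 0%N => k r dr q a _; exact: (HY k).
have [K4 K40 near_far] := net_points hp mgt0 Ve s20 hM hq4.
pose X r := fun i => x i r.
have mX r i : measurable_fun setT (X r i) by case: (hp_L4 hp i r).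
have mD r s i : measurable_fun setT (pdiff x r s i) by case: (pdiff_L4 hp r s i).
pose near_set k i := exceed (X (grid Y j0 i)) k (18 * Num.sqrt s2 * lilscale k).
pose far_set k i := if Y%:R <= `|grid (ell k) j0 i : R| <= (ell k)%:R
  then exceed (X (grid (ell k) j0 i)) k (18 * Num.sqrt s2 * lilscale k) else set0.
pose incr_set k j i := exceed (pdiff x (grid (ell k) (j0 + j).+1 (2 * i).+1)
  (grid (ell k) (j0 + j).+1 (2 * i))) k (K2 * th ^+ (j0 + j).+1 * lilscale k).
pose near_union k := \big[setU/set0]_(i < (2 * Y * 2 ^ j0).+1) near_set k i.
pose far_union k := \big[setU/set0]_(i < (2 * ell k * 2 ^ j0).+1) far_set k i.
pose incr_union k j := \big[setU/set0]_(i < (2 * ell k * 2 ^ (j0 + j)).+1) incr_set k j i.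
pose G k := (near_union k `|` far_union k) `|` \bigcup_j incr_union k j.
have m1 k i : measurable (near_set k i) by apply: exceed_meas.
have m2 k i : measurable (far_set k i).
  by rewrite /far_set; case: ifP => // _; apply: exceed_meas.
have m3 k j i : measurable (incr_set k j i) by apply: exceed_meas.
have M1 k : measurable (near_union k) by apply: bigsetU_measurable.
have M2 k : measurable (far_union k) by apply: bigsetU_measurable.
have M3 k j : measurable (incr_union k j) by apply: bigsetU_measurable.
have M4 k : measurable (\bigcup_j incr_union k j) by exact: bigcup_measurable.
have mG k : measurable (G k) by apply: measurableU => //; exact: measurableU.
have ellR k : 2 * (ell k)%:R + 1 <= (2 * A%:R + 1) * k.+1%:R ^+ m :> R.
  have : (ell k)%:R <= A%:R * k.+1%:R ^+ m :> R by rewrite -natrX -natrM ler_nat.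
  have : 1 <= k.+1%:R ^+ m :> R by rewrite exprn_ege1// ler1n.
  lra.
have count k j : (2 * ell k * 2 ^ j).+1%:R <= (2 * A%:R + 1) * k.+1%:R ^+ m * 2 ^+ j :> R.
  apply: (@le_trans _ _ ((2 * (ell k)%:R + 1) * 2 ^+ j)); last by rewrite ler_wpM2r.
  have : 1 <= 2 ^+ j :> R by rewrite exprn_ege1// ler1n.
  rewrite -[(2 * ell k * 2 ^ j).+1%:R]natr1 !natrM natrX; lra.
pose KG := (2 * Y * 2 ^ j0).+1%:R * K3 + (2 * A%:R + 1) * 2 ^+ j0 * K4 +
  (2 * A%:R + 1) * K1 / (1 - kap).
have A0 : 0 <= 2 * A%:R + 1 :> R by rewrite addr_ge0 ?mulr_ge0.
have near_G : \forall k \near \oo, pr P (G k) <= KG * k.+1%:R ^- 2.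
  near=> k.
  have Hnear (r : R) : pr P (exceed (fun i => x i r) k (18 * Num.sqrt s2 * lilscale k)) <=
      K3 * k.+1%:R ^- 2.
    by move: r (I : True); near: k; exact: near_net.
  have Hfar (r : R) : dom k r ->
      pr P (exceed (fun i => x i r) k (18 * Num.sqrt s2 * lilscale k)) <= K4 * k.+1%:R ^- (m + 2).
    by move: r; near: k; exact: near_far.
  have Hincr j (r s : R) : `|r - s| <= 2 ^- j ->
      pr P (exceed (pdiff x r s) k (K2 * th ^+ j * lilscale k)) <=
      K1 * k.+1%:R ^- (m + 2) * (kap / 2) ^+ j.
    by move: j r s; near: k; exact: near_incr.
  have k0 : 0 < k.+1%:R :> R by rewrite ltr0n.
  have kE : k.+1%:R ^+ m * k.+1%:R ^- (m + 2) = k.+1%:R ^- 2 :> R.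
    move: (k.+1%:R) k0 => a a0; rewrite exprD invfM mulrA divff ?mul1r//.
    by rewrite expf_neq0// lt0r_neq0.
  have k20 : 0 <= k.+1%:R ^- 2 :> R by rewrite invr_ge0 exprn_ge0.
  have b1 : pr P (near_union k) <= (2 * Y * 2 ^ j0).+1%:R * (K3 * k.+1%:R ^- 2).
    apply: pr_bigsetU_cst => // i _.
    exact: Hnear.
  have b2 : pr P (far_union k) <= (2 * A%:R + 1) * 2 ^+ j0 * K4 * k.+1%:R ^- 2.
    apply: (@le_trans _ _ ((2 * ell k * 2 ^ j0).+1%:R * (K4 * k.+1%:R ^- (m + 2)))).
      apply: pr_bigsetU_cst => // i _; rewrite /far_set; case: ifP => [|_]; last first.
        by rewrite /pr measure0 mulr_ge0 ?(ltW K40)// invr_ge0 exprn_ge0.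
      exact: Hfar.
    have Kk : 0 <= K4 * k.+1%:R ^- (m + 2) by rewrite mulr_ge0 ?(ltW K40)// invr_ge0 exprn_ge0.
    apply: (le_trans (ler_wpM2r Kk (count k j0))).
    by rewrite -kE; lra.
  have b3 : pr P (\bigcup_j incr_union k j) <= (2 * A%:R + 1) * K1 / (1 - kap) * k.+1%:R ^- 2.
    apply: pr_bigcup_le => // n.
    apply: (@le_trans _ _ (\sum_(j < n) (2 * A%:R + 1) * K1 * k.+1%:R ^- 2 * kap ^+ j)).
      apply: ler_sum => j _.
      apply: (@le_trans _ _ ((2 * ell k * 2 ^ (j0 + j)).+1%:R *
          (K1 * k.+1%:R ^- (m + 2) * (kap / 2) ^+ (j0 + j).+1))).
        apply: pr_bigsetU_cst => // i _.
        have : `|grid (ell k) (j0 + j).+1 (2 * i).+1 - grid (ell k) (j0 + j).+1 (2 * i)| <=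
            2 ^- (j0 + j).+1 :> R.
          rewrite /grid -[(2 * i).+1%:R]natr1 (_ : _ - _ - _ = (2 ^+ (j0 + j).+1)^-1); last by ring.
          by rewrite ger0_norm// invr_ge0 exprn_ge0.
        exact: Hincr.
      have Kk : 0 <= K1 * k.+1%:R ^- (m + 2) * (kap / 2) ^+ (j0 + j).+1.
        by rewrite !mulr_ge0 ?(ltW K10) ?invr_ge0 ?exprn_ge0// divr_ge0// ltW.
      apply: (le_trans (ler_wpM2r Kk (count k (j0 + j)%N))).
      rewrite -kE expr_div_n exprSr.
      (* The denominators 2^(j0+j+1) cancel the number of grid points, leaving a geometric series in
         kap. *)
      have kapj : kap ^+ (j0 + j) * kap <= kap ^+ j * 2.
        apply: ler_pM; rewrite ?exprn_ge0 ?(ltW kap0)//; last lra.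
        by rewrite ler_wiXn2l ?(ltW kap0) ?(ltW kap1)// leq_addl.
      have W0 : 0 <= (2 * A%:R + 1) * K1 * (k.+1%:R ^+ m / k.+1%:R ^+ (m + 2)) / 2.
        by rewrite kE !mulr_ge0// ltW.
      have := ler_wpM2l W0 kapj.
      rewrite [X in X <= _ -> _](_ : _ = (2 * A%:R + 1) * k.+1%:R ^+ m * 2 ^+ (j0 + j) *
        (K1 / k.+1%:R ^+ (m + 2) * (kap ^+ (j0 + j) * kap / 2 ^+ (j0 + j).+1))); last first.
        rewrite exprS; field; rewrite !lt0r_neq0 ?exprn_gt0//.
      move/le_trans; apply; lra.
    have K0 : 0 <= (2 * A%:R + 1) * K1 * k.+1%:R ^- 2 by rewrite !mulr_ge0// ltW.
    rewrite -mulr_sumr; apply: (le_trans (ler_wpM2l K0 (geom_sum_le n (ltW kap0) kap1))).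
    by rewrite mulrAC.
  rewrite /KG; apply: (le_trans (pr_setU_le P (measurableU _ _ (M1 k) (M2 k)) (M4 k))).
  apply: (le_trans (lerD (le_trans (pr_setU_le P (M1 k) (M2 k)) (lerD b1 b2)) b3)).
  by rewrite !mulrDl mulrA.
apply: filterS (borel_cantelli_sqr mG near_G) => w.
apply: filterS => k nG n r nk rL.
have W0 : 0 <= lilscale k :> R by exact: sqrtr_ge0.
rewrite (_ : 19 * _ * _ = 18 * Num.sqrt s2 * lilscale k + Num.sqrt s2 * lilscale k); last by ring.
have nG1 : ~ near_union k w by move=> h; apply: nG; left; left.
have nG2 : ~ far_union k w by move=> h; apply: nG; left; right.
have nG3 j : ~ incr_union k j w by move=> h; apply: nG; right; exists j.
have lew Z c : ~ exceed Z k c w -> `|psum Z 0 n w| <= c.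
  by move=> h; rewrite leNgt; apply/negP => h'; apply: h; exists n.
apply: (@dyadic_chaining _ (fun r => psum (fun i => x i r) 0 n w) (ell k) j0 _ _
  (fun j => K2 * th ^+ (j0 + j).+1 * lilscale k)) rL.
- exact: psum_cont.
- by move=> j; rewrite !mulr_ge0 ?exprn_ge0 ?(ltW th0) ?(ltW K20).
- move=> i iL; apply: lew.
  have p2 : 0 < 2 ^+ j0 :> R by rewrite exprn_gt0.
  have iR : i%:R / 2 ^+ j0 <= 2 * (ell k)%:R :> R.
    by rewrite ler_pdivrMr// -natrX -!natrM ler_nat.
  have i0 : 0 <= i%:R / 2 ^+ j0 :> R by rewrite divr_ge0// ltW.
  have [Yg|Yg] := leP Y%:R `|grid (ell k) j0 i : R|.
    have := bigsetU_notin nG2 (iL : (i < _.+1)%N).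
    rewrite /far_set Yg /= ifT//; rewrite /grid ler_norml; apply/andP; split; lra.
  move: Yg; rewrite ltr_norml /grid => /andP[g1 g2].
  have LY : ((ell k - Y) * 2 ^ j0 <= i)%N.
    have [lY|Yl] := leqP (ell k) Y.
      by move: lY; rewrite -subn_eq0 => /eqP ->; rewrite mul0n.
    rewrite -(@ler_nat R) natrM natrX natrB ?(ltnW Yl)// -ler_pdivlMr//; lra.
  (* The same point indexed from -Y instead of -l_k; [le'] shows that the natural-number subtraction
     is exact. *)
  pose i' := (i + Y * 2 ^ j0 - ell k * 2 ^ j0)%N.
  have le' : (ell k * 2 ^ j0 <= i + Y * 2 ^ j0)%N.
    by move: LY; rewrite mulnBl leq_subLR addnC.
  have gE : grid (ell k) j0 i = grid Y j0 i' :> R.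
    rewrite /grid /i' natrB// natrD !natrM natrX; field.
    by rewrite lt0r_neq0.
  rewrite -/(grid (ell k) j0 i) gE; apply: (bigsetU_notin nG1).
  rewrite ltnS -(@ler_nat R) !natrM natrX -ler_pdivrMr//.
  have : i'%:R / 2 ^+ j0 - Y%:R = i%:R / 2 ^+ j0 - (ell k)%:R :> R by rewrite -/(grid Y j0 i') -gE.
  lra.
- move=> j i iL; rewrite psum_pdiff; apply: lew.
  exact: (bigsetU_notin (nG3 j) (iL : (i < _.+1)%N)).
- move=> l; rewrite -mulr_suml ler_wpM2r//.
  apply: (@le_trans _ _ (K2 * th ^+ j0 * \sum_(j < l) th ^+ j)).
    rewrite mulr_sumr; apply: ler_sum => j _; rewrite -mulrA -exprD.
    by rewrite ler_wpM2l ?(ltW K20)// ler_wiXn2l ?(ltW th0) ?(ltW th1).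
  apply: le_trans j0P; apply: ler_wpM2l; last exact: geom_sum_le (ltW th0) th1.
  by rewrite mulr_ge0 ?exprn_ge0 ?(ltW th0) ?(ltW K20).
Unshelve. all: by end_near. Qed.

End process_bound.

(** * Function-valued variables and their coordinates *)

Section evaluation.
Context {R : realType} (I : set R) (d : nat).

Lemma eval_continuous (u : I) : continuous (fun f : C0 I d => val f u).
Proof.
move=> f.
apply: (@continuous_comp _ {uniform I -> 'rV[R]_d} _ (fun f : C0 I d => val f)
  (fun g : {uniform I -> 'rV[R]_d} => g u)).
  exact: initial_continuous.
have := @pointwise_uniform_cvg I 'rV[R]_d (val f) (nbhs (val f : {uniform I -> 'rV[R]_d})) _.
move=> /(_ _ (fun A h => h)) /pointwise_cvgP; exact.
Qed.

End evaluation.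

Section alpha_mixing_system.
Context {R : realType} disp {T : measurableType disp} (P : probability T R).
Variables (E : Type) (G : set (set E)) (Y : nat -> T -> E).

Definition pastY a : set (set T) :=
  \bigcup_(i in [set i | (i < a)%N]) preimage_set_system setT (Y i) G.
Definition futY b : set (set T) :=
  \bigcup_(i in [set i | (b <= i)%N]) preimage_set_system setT (Y i) G.

(** The past before index 0 is generated by no variable, so its sigma-algebra has to be known to be
    trivial. *)
Lemma sigma_set0 (A : set T) : <<s (set0 : set (set T)) >> A -> A = set0 \/ A = setT.
Proof.
have H : sigma_algebra setT [set A : set T | A = set0 \/ A = setT].
  split => [|B [->|->]|F HF]; first by left.
  - by right; rewrite setD0.
  - by left; rewrite setDv.
  - have [[i Fi]|nF] := pselect (exists i, F i = setT).
      by right; apply/seteqP; split=> // w _; exists i => //; rewrite Fi.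
    left; apply/seteqP; split=> // w [i _]; case: (HF i) => [->//|Fi].
    by case: nF; exists i.
by move: A; apply: smallest_sub => // A [].
Qed.

Hypothesis mY : forall n, random_element G (Y n).

Lemma gen_measurable (D : set nat) :
  submeas (\bigcup_(i in D) preimage_set_system setT (Y i) G).
Proof.
apply: smallest_sub; first exact: sigma_algebra_measurable.
by move=> A [i _ [B GB <-]]; rewrite setTI; exact: mY.
Qed.

Lemma alpha_mixing_system (C nu : R) :
  0 <= C -> (forall k, (0 < k)%N -> (alpha_coef P G Y k <= (C * k%:R `^ (- nu))%:E)%E) ->
  mixing_system P pastY futY C nu.
Proof.
move=> C0 HC; split.
- by move=> n; exact: gen_measurable.
- by move=> n; exact: gen_measurable.
- move=> m n mn; apply: sub_sigma_algebra2.
  by move=> A [i im GA]; exists i => //; exact: leq_trans mn.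
- move=> m n mn; apply: sub_sigma_algebra2.
  by move=> A [i im GA]; exists i => //; exact: leq_trans im.
move=> [|a] b ab A B pA fB.
  have -> : pr P (A `&` B) = pr P A * pr P B; last first.
    by rewrite subrr normr0 mulr_ge0// powR_ge0.
  have : <<s (set0 : set (set T)) >> A.
    by move: pA; congr (<<s _ >> A); apply/seteqP; split=> // D [].
  move/sigma_set0 => [->|->]; first by rewrite set0I /pr measure0 mul0r.
  by rewrite setTI {2}/pr probability_setT mul1r.
have mA : measurable A by exact: (gen_measurable pA).
have mB : measurable B by exact: (gen_measurable fB).
rewrite -lee_fin; apply: le_trans (HC _ (ltn0Sn _)).
apply: ereal_sup_ubound; exists a, A, B; split.
- exact: pA.
(* Indices below a + 1 are those up to a, so the separation in the mixing coefficient is b - a, one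
   more than the gap. *)
- have -> : (a + (b - a.+1).+1 = b)%N by rewrite -addSnnS subnKC.
  exact: fB.
by rewrite -!EFin_pr//; exact: measurableI.
Qed.

Lemma preimage_smeas_past (f : E -> R) n :
  (forall B, measurable B -> G (f @^-1` B)) ->
  smeas (pastY n.+1) (f \o Y n) /\ smeas (futY n) (f \o Y n).
Proof.
by move=> mf; split=> _ B mB; apply: sub_sigma_algebra; exists n => //=;
  exists (f @^-1` B) => //; exact: mf.
Qed.

End alpha_mixing_system.

Section coordinates.
Context {R : realType} disp {T : measurableType disp} (I : set R) (d : nat).

(** Sets with a Borel preimage form a sigma-algebra, and it contains the open intervals. *)
Lemma borel_preimage (E : topologicalType) (f : E -> R) (B : set R) :
  continuous f -> measurable B -> borel (f @^-1` B).
Proof.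
move=> cf; have H : sigma_algebra setT (image_set_system setT f (@borel E)).
  exact/sigma_algebra_image/smallest_sigma_algebra.
have : @measurable _ R `<=` image_set_system setT f (@borel E).
  rewrite -[@measurable _ R]/((@ocitv R).-sigma.-measurable) RGenOpens.measurableE.
  apply: smallest_sub => // A [x [y ->]]; rewrite /image_set_system /= setTI.
  apply: sub_sigma_algebra; apply: open_comp => //; exact: interval_open.
by move=> /(_ B)/[apply]; rewrite /image_set_system /= setTI.
Qed.

Lemma coord_borel (k : 'I_d) (u : I) (B : set R) : measurable B ->
  borel ((fun f : C0 I d => val f u ord0 k) @^-1` B).
Proof.
apply: borel_preimage => f.
apply: (@continuous_comp _ 'rV[R]_d _ (fun f : C0 I d => val f u) (fun M => M ord0 k)).
  exact: eval_continuous.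
exact: coord_continuous.
Qed.

Lemma borel_setT (E : topologicalType) : borel (@setT E).
Proof. by apply: sub_sigma_algebra; exact: openT. Qed.

Lemma prod_random_element (E F : topologicalType) (X : T -> E) (Y : T -> F) :
  random_element (@borel E) X -> random_element (@borel F) Y ->
  random_element (prod_sigma (@borel E) (@borel F)) (fun w => (X w, Y w)).
Proof.
move=> mX mY; rewrite /random_element /prod_sigma.
have H : sigma_algebra setT (image_set_system setT (fun w => (X w, Y w)) (@measurable _ T)).
  exact/sigma_algebra_image/sigma_algebra_measurable.
suff : <<s [set A `*` B | A in @borel E & B in @borel F] >> `<=`
    image_set_system setT (fun w => (X w, Y w)) (@measurable _ T).
  by move=> S B /S; rewrite /image_set_system /= setTI.
apply: smallest_sub => // _ [A bA [B bB <-]]; rewrite /image_set_system /= setTI.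
rewrite (_ : _ @^-1` _ = X @^-1` A `&` Y @^-1` B)//.
by apply: measurableI; [exact: mX|exact: mY].
Qed.

Lemma prod_sigma_fst (E F : topologicalType) (A : set E) :
  borel A -> prod_sigma (@borel E) (@borel F) (fst @^-1` A).
Proof.
move=> bA; apply: sub_sigma_algebra; exists A => //; exists setT.
  exact: borel_setT.
by apply/seteqP; split=> [[x y] /= []|[x y]].
Qed.

(** For c >= 0 the set is a union of open sets over u in D, uncountable but still open. For c < 0 it
    is the whole space, since 0 takes part in the supremum. *)
Lemma supnorm_borel (D : set I) (c : R) :
  borel [set f : C0 I d | (c%:E < supnorm D (val f))%E].
Proof.
have [c0|c0] := ltP c 0.
  rewrite (_ : mkset _ = setT).
    exact: borel_setT.
  apply/seteqP; split=> // f _ /=; apply: (@lt_le_trans _ _ 0%E); first by rewrite lte_fin.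
  by apply: ereal_sup_ubound; left.
apply: sub_sigma_algebra.
rewrite (_ : mkset _ = \bigcup_(u in D) [set f : C0 I d | c < `|val f u|]).
  apply: bigcup_open => u _.
  apply: (@open_comp _ _ (fun f : C0 I d => `|val f u|) [set x : R | c < x]); last exact: open_gt.
  move=> f _; apply: (@continuous_comp _ 'rV[R]_d _ (fun f : C0 I d => val f u) (fun M => `|M|)).
    exact: eval_continuous.
  exact: norm_continuous.
apply/seteqP; split=> [f /=|f [u Du /= cf]].
  move/ereal_sup_gt => [_ [->|[u Du <-]]]; first by rewrite lte_fin ltNge c0.
  by rewrite lte_fin => cf; exists u.
apply: (@lt_le_trans _ _ (`|val f u|)%:E); first by rewrite lte_fin.
by apply: ereal_sup_ubound; right; exists u.
Qed.

End coordinates.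

Section lower_integral.
Context {R : realType} disp {T : measurableType disp} (P : probability T R).
Local Notation Ex := (Ex P).
Local Notation L4 := (L4 P).

(* No measurability is needed: the integral of a nonnegative function is a
   supremum over the simple functions below it. *)
Lemma le_integral_nonmeas (f g : T -> \bar R) : (forall w, (0 <= f w <= g w)%E) ->
  (\int[P]_w f w <= \int[P]_w g w)%E.
Proof.
move=> fg; have f0 w : (0 <= f w)%E by have /andP[] := fg w.
have g0 w : (0 <= g w)%E by have /andP[h1 h2] := fg w; exact: le_trans h2.
rewrite !ge0_integralTE//; apply: le_ereal_sup => _ [h hf <-]; exists h => // w.
by have /andP[_ h2] := fg w; exact: le_trans (hf w) h2.
Qed.

(** Pointwise t^4 <= 1 + t^J. The J-th moment is controlled through a bound [h] such as a power of
    the supremum norm. *)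
Lemma moment4_le (f : T -> R) (h : T -> \bar R) (J c : R) : 4 <= J -> 0 <= c ->
  measurable_fun setT f -> (forall w, ((`|f w| `^ J)%:E <= h w)%E) ->
  (\int[P]_w h w <= c%:E)%E -> L4 f /\ Ex (fun w => f w ^+ 4) <= 1 + c.
Proof.
move=> J4 c0 mf fh hc.
have mJ : measurable_fun setT (fun w => `|f w| `^ J).
  by apply: (measurableT_comp (measurable_powR J)); exact: measurableT_comp.
have fc : (\int[P]_w (`|f w| `^ J)%:E <= c%:E)%E.
  by apply: le_trans hc; apply: le_integral_nonmeas => w; rewrite fh lee_fin powR_ge0.
have iJ : integ P (fun w => `|f w| `^ J).
  apply/integrableP; split; first exact/measurable_EFinP.
  under eq_integral do rewrite /= ger0_norm ?powR_ge0//.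
  exact: le_lt_trans fc (ltry _).
have pw w : f w ^+ 4 <= 1 + `|f w| `^ J.
  have -> : f w ^+ 4 = `|f w| ^+ 4 by rewrite -normrX ger0_norm// exprn_even_ge0.
  have [f1|f1] := leP `|f w| 1.
    apply: (@le_trans _ _ 1); first exact: exprn_ile1.
    by rewrite lerDl powR_ge0.
  rewrite -powR_mulrn//; apply: (@le_trans _ _ (`|f w| `^ J)); last by rewrite lerDr.
  by apply: ler_powR => //; exact: ltW.
have i1J : integ P (fun w => 1 + `|f w| `^ J) by apply: integD => //; exact: integ_cst.
have Lf : L4 f.
  split=> //; apply: integ_le i1J _; first exact: measurable_funX.
  by move=> w; rewrite ger0_norm ?exprn_even_ge0.
split=> //; apply: (le_trans (Ex_le (L4_pow4 Lf) i1J pw)).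
rewrite ExD ?Ex_cst//; last exact: integ_cst.
by rewrite lerD2l -lee_fin EFin_Ex.
Qed.

Lemma Ex_pow4_ge (f : T -> R) : L4 f -> Ex f ^+ 4 <= Ex (fun w => f w ^+ 4).
Proof.
move=> Lf; have i2 := L4_sqr Lf; have i4 := L4_pow4 Lf.
set c := Ex (fun w => f w ^+ 2).
have h1 : Ex f ^+ 2 <= c by exact: Ex_sqr.
have h2 : c ^+ 2 <= Ex (fun w => f w ^+ 4).
  have : 0 <= Ex (fun w => (f w ^+ 2 - c) ^+ 2) by apply: Ex_ge0 => w; rewrite sqr_ge0.
  rewrite (@Ex_ext _ _ _ P _ (fun w => f w ^+ 4 + (- (2 * c) * f w ^+ 2 + c ^+ 2))); last first.
    by move=> w; ring.
  rewrite ExD//; last by apply: integD; [exact: integZ|exact: integ_cst].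
  rewrite ExD; [|exact: integZ|exact: integ_cst].
  by rewrite ExZ// Ex_cst -/c; lra.
apply: le_trans h2; rewrite (exprM _ 2 2) lerXn2r ?nnegrE ?sqr_ge0//.
by apply: Ex_ge0 => w; rewrite sqr_ge0.
Qed.

(** 16 = 8 + 8: [pow4D_le], then Jensen for the fourth power of the mean. *)
Lemma Ex_center4 (f : T -> R) : L4 f ->
  Ex (fun w => (f w - Ex f) ^+ 4) <= 16 * Ex (fun w => f w ^+ 4).
Proof.
move=> Lf; have i4 := L4_pow4 Lf.
apply: (@le_trans _ _ (Ex (fun w => 8 * f w ^+ 4 + 8 * Ex f ^+ 4))).
  apply: Ex_le => [||w].
  - by apply: L4_pow4; apply: L4B => //; exact: L4_cst.
  - by apply: integD; [exact: integZ|exact: integ_cst].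
  - have := pow4D_le (f w) (- Ex f).
    by rewrite (_ : (- Ex f) ^+ 4 = Ex f ^+ 4) ?mulrDr//; ring.
rewrite ExD; [|exact: integZ|exact: integ_cst].
by rewrite ExZ// Ex_cst; have := Ex_pow4_ge Lf; lra.
Qed.

End lower_integral.

Section row_norm.
Context {R : realType} (d : nat).

Lemma entry_le_norm (M : 'rV[R]_d) (k : 'I_d) : `|M ord0 k| <= `|M|.
Proof.
have -> : `|M| = mx_norm M by [].
rewrite mx_normrE.
exact: (le_bigmax _ (fun ij : 'I_1 * 'I_d => `|M ij.1 ij.2|) (ord0, k)).
Qed.

Lemma norm_le_entries (M : 'rV[R]_d) (c : R) : 0 <= c ->
  (forall k, `|M ord0 k| <= c) -> `|M| <= c.
Proof.
move=> c0 Mc; have -> : `|M| = mx_norm M by [].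
rewrite mx_normrE; apply: bigmax_le => // -[i k] _ /=.
by rewrite (ord1 i).
Qed.

End row_norm.

(** * Centered coordinates as processes on the line *)

Section coordinate_process.
Context {R : realType} disp {T : measurableType disp} (P : probability T R).
Context (I : set R) (d : nat).
Local Notation Ex := (Ex P).
Local Notation L4 := (L4 P).
Variables (past fut : nat -> set (set T)) (X : nat -> T -> C0 I d).
Variables (C1 nu xi J C2 : R) (k : 'I_d) (emb : R -> I).

Hypotheses (C10 : 0 < C1) (nu3 : 3 < nu) (ms : mixing_system P past fut C1 nu).
Hypothesis coord_adapted : forall n u,
  smeas (past n.+1) (Defs.coord (X n) k u) /\ smeas (fut n) (Defs.coord (X n) k u).
Hypotheses (J4 : 4 < J) (xi2 : 1 / 2 < xi) (C20 : 0 < C2).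
Hypothesis moment : forall n, (\int[P]_w (supnorm setT (val (X n w)) `^ J) <= C2%:E)%E.
Hypothesis holder : forall n u v, u != v -> (holder_moment P (X n) xi J u v <= C2%:E)%E.
Hypothesis stat : weakly_stationary P X.
Hypothesis emb_lip : forall r s, `|val (emb r) - val (emb s)| <= `|r - s|.

Let crd n u := Defs.coord (X n) k u.

Lemma coord_meas n u : measurable_fun setT (crd n u).
Proof. by case: ms => sp _ _ _ _; exact: smeas_meas (sp _) (proj1 (coord_adapted n u)). Qed.

Lemma coord_le_supnorm n u w : (`|crd n u w|%:E <= supnorm setT (val (X n w)))%E.
Proof.
apply: (@le_trans _ _ (`|val (X n w) u|)%:E); first by rewrite lee_fin entry_le_norm.
by apply: ereal_sup_ubound; right; exists u.
Qed.

Lemma supnorm_ge0 (D : set I) (f : I -> 'rV[R]_d) : (0 <= supnorm D f)%E.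
Proof. by apply: ereal_sup_ubound; left. Qed.

Lemma coord_moment4 n u : L4 (crd n u) /\ Ex (fun w => crd n u w ^+ 4) <= 1 + C2.
Proof.
apply: (moment4_le (ltW J4) (ltW C20) (coord_meas n u) _ (moment n)) => w.
rewrite -poweR_EFin; apply: gt0_ler_poweR.
- by apply: ltW; apply: lt_trans J4.
- by rewrite in_itv /= lee_fin normr_ge0 leey.
- by rewrite in_itv /= supnorm_ge0 leey.
- exact: coord_le_supnorm.
Qed.

Lemma coord_L4 n u : L4 (crd n u). Proof. by case: (coord_moment4 n u). Qed.

Definition holder_ratio : R := 2 `^ (- xi).

Lemma holder_ratio_gt0 : 0 < holder_ratio. Proof. exact: powR_gt0. Qed.

Lemma holder_ratio_sqr : 2 * holder_ratio ^+ 2 < 1.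
Proof.
rewrite /holder_ratio -powR_mulrn ?powR_ge0// -powRrM.
have {1}-> : (2 : R) = 2 `^ 1 by rewrite powRr1.
rewrite -powRD; last by rewrite pnatr_eq0 implybT.
rewrite -[ltRHS](powRr0 (2 : R)).
have h : 1 + - xi * 2 < 0 by have := xi2; lra.
by rewrite /powR pnatr_eq0 /= ltr_expR ltr_pM2r// ln_gt0// ltr1n.
Qed.

(** [moment4_le] is applied to the Hoelder quotient and the result multiplied back by |u - v|^(4
    xi), at most [holder_ratio ^+ (4 * j)]. *)
Lemma coord_incr4 n j u v : `|val u - val v| <= 2 ^- j ->
  Ex (fun w => (crd n u w - crd n v w) ^+ 4) <= (1 + C2) * holder_ratio ^+ (4 * j).
Proof.
move=> uv; have r0 := holder_ratio_gt0.
have c0 : 0 <= 1 + C2 by rewrite addr_ge0// ltW.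
have [->|uv'] := eqVneq u v.
  rewrite (@Ex_ext _ _ _ P _ (fun=> 0)) ?Ex_cst; first by rewrite mulr_ge0// exprn_ge0// ltW.
  by move=> w; rewrite subrr expr0n.
have duv : 0 < `|val u - val v|.
  by rewrite normr_gt0 subr_eq0; apply: contra uv' => /eqP/val_inj/eqP.
set D := `|val u - val v| `^ xi.
have D0 : 0 < D by rewrite powR_gt0.
have Dj : D <= holder_ratio ^+ j.
  have -> : holder_ratio ^+ j = (2 ^- j) `^ xi.
    rewrite /holder_ratio -powR_mulrn ?powR_ge0// -powRrM mulNr mulrC -mulNr.
    rewrite powRrM powRN powR_mulrn//.
  apply: ge0_ler_powR => //; first by apply: ltW; apply: lt_trans xi2; lra.
  by rewrite nnegrE invr_ge0 exprn_ge0.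
have me : measurable_fun setT (fun w => D^-1 * (crd n u w - crd n v w)).
  apply: measurable_funM; first exact: measurable_cst.
  by apply: measurable_funB; exact: coord_meas.
have [] := moment4_le (ltW J4) (ltW C20) me _ (holder n uv').
  move=> w; rewrite lee_fin; apply: ge0_ler_powR; rewrite ?nnegrE//.
    by apply: ltW; apply: lt_trans J4.
  rewrite -/D normrM ger0_norm ?invr_ge0 ?(ltW D0)// mulrC ler_wpM2r ?invr_ge0 ?(ltW D0)//.
  by have := entry_le_norm (val (X n w) u - val (X n w) v) k; rewrite !mxE.
move=> _; rewrite (@Ex_ext _ _ _ P _ (fun w => D^-1 ^+ 4 * (crd n u w - crd n v w) ^+ 4)); last first.
  by move=> w; rewrite exprMn.
have iL : integ P (fun w => (crd n u w - crd n v w) ^+ 4).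
  by apply: L4_pow4; apply: L4B; exact: coord_L4.
rewrite ExZ// exprVn => h.
have D4 : 0 < D ^+ 4 by rewrite exprn_gt0.
have -> : Ex (fun w => (crd n u w - crd n v w) ^+ 4) =
    D ^+ 4 * (D ^- 4 * Ex (fun w => (crd n u w - crd n v w) ^+ 4)).
  by rewrite mulrA divff ?mul1r// lt0r_neq0.
apply: (le_trans (ler_wpM2l (ltW D4) h)); rewrite mulrC ler_wpM2l// mulnC exprM.
by rewrite lerXn2r ?nnegrE ?exprn_ge0 ?(ltW r0) ?(ltW D0).
Qed.

(* [emb] extends the parameter set to the whole line: the identity, or the
   projection on a compact interval. *)
Definition cproc n r w : R := crd n (emb r) w - Ex (crd n (emb r)).

Definition cbound : R := 4 * Num.sqrt (1 + C2).

Lemma cbound_gt0 : 0 < cbound.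
Proof. by rewrite mulr_gt0// sqrtr_gt0 addr_gt0. Qed.

Lemma cbound_sqr : cbound ^+ 2 = 16 * (1 + C2).
Proof. by rewrite exprMn sqr_sqrtr ?addr_ge0 ?(ltW C20)//; ring. Qed.

Lemma cproc_L4 n r : L4 (cproc n r).
Proof. by apply: L4B; [exact: coord_L4|exact: L4_cst]. Qed.

Lemma cproc_holder : holder_process P past fut C1 nu cproc cbound holder_ratio.
Proof.
split => //.
- exact: cbound_gt0.
- exact: holder_ratio_gt0.
- exact: holder_ratio_sqr.
- move=> r i; have [a1 a2] := coord_adapted i (emb r).
  by split; apply: measurable_funB => //; exact: measurable_cst.
- exact: cproc_L4.
- move=> i r; rewrite /cproc ExB; [|exact/L4_int/coord_L4|exact: integ_cst].
  by rewrite Ex_cst subrr.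
- move=> i r; apply: (le_trans (Ex_center4 (coord_L4 i (emb r)))).
  by rewrite cbound_sqr ler_wpM2l//; case: (coord_moment4 i (emb r)).
- move=> i j r s rs.
  have Lu := coord_L4 i (emb r); have Lv := coord_L4 i (emb s).
  rewrite (@Ex_ext _ _ _ P _ (fun w => ((crd i (emb r) w - crd i (emb s) w) -
      Ex (fun w => crd i (emb r) w - crd i (emb s) w)) ^+ 4)); last first.
    by move=> w; rewrite ExB ?(L4_int Lu) ?(L4_int Lv)// /cproc; congr (_ ^+ 4); ring.
  apply: (le_trans (Ex_center4 (L4B Lu Lv))).
  rewrite exprMn cbound_sqr -exprM -mulrA ler_wpM2l//.
  have := coord_incr4 i (le_trans (emb_lip r s) rs).
  by rewrite (_ : (2 * j * 2) = 4 * j)%N//; lia.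
Qed.

Lemma coord_cont n w : continuous (fun r => crd n (emb r) w).
Proof.
have [cf _] : C0 I d (val (X n w)) by apply/set_mem; exact: (valP (X n w)).
move=> r.
have ce : continuous emb.
  apply: (@continuous_comp_initial _ _ _ (set_val : I -> R)) => r'.
  apply/cvgrPdist_lt => e e0; near=> t.
  by apply: le_lt_trans (emb_lip r' t) _; near: t; exact: cvgr_dist_lt.
apply: (@continuous_comp _ 'rV[R]_d _ (fun r => val (X n w) (emb r)) (fun M => M ord0 k)).
  exact: (continuous_comp (ce r) (cf (emb r))).
exact: coord_continuous.
Unshelve. all: by end_near. Qed.


Lemma cov_cproc n m r :
  cov P (crd n (emb r)) (crd m (emb r)) = Ex (fun w => cproc n r w * cproc m r w).
Proof. by rewrite /cov covariance.unlock expectation.unlock. Qed.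

Lemma cproc_longrun (s2 : R) : 0 < s2 -> (forall u, longrun_cov P X k k u u <= s2) ->
  exists q0, forall r q a, (q0 <= q)%N ->
  Ex (fun w => psum (fun i => cproc i r) a q w ^+ 2) <= q%:R * (3 * s2).
Proof.
move=> s20 lr; have hp := cproc_holder.
pose B := 80 * cbound * Num.sqrt C1.
have b0 := cbound_gt0.
have B0 : 0 <= B by rewrite !mulr_ge0 ?sqrtr_ge0 ?(ltW b0).
exists (Num.truncn ((B / s2) ^+ 2)).+1 => r q a hq.
pose gam h := Ex (fun w => cproc 0%N r w * cproc h r w).
have gamE i h : Ex (fun w => cproc i r w * cproc (i + h)%N r w) = gam h.
  by rewrite /gam -!cov_cproc; case: stat => _ ->.
have Lc i := cproc_L4 i r.
have Bq : B <= s2 * Num.sqrt q%:R.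
  rewrite mulrC -ler_pdivrMr//; apply: le_of_sqr; first exact: sqrtr_ge0.
  rewrite sqr_sqrtr//; apply: ltW; apply: lt_le_trans (truncnS_gt _) _.
  by rewrite ler_nat.
have gle h : (0 < h)%N -> `|gam h| <= 10 * cbound * cdecay C1 h.
  move=> h0; have := covar_le C10 nu3 ms b0 (hp_adapted hp r) Lc (hp_Ex hp ^~ r) (hp_pow4 hp ^~ r) h0.
  by rewrite subn0.
(* The [limn] in the long-run covariance is the value of a series only if that series converges; the
   covariance decay makes it converge absolutely. *)
have csum : cvgn (series (fun h => gam h.+1)).
  apply: (@normed_cvg _ R^o); apply: nondecreasing_is_cvgn.
    apply: nondecreasing_series => n _ _; exact: normr_ge0.
  exists (10 * cbound * (4 * Num.sqrt C1)) => _ [n _ <-].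
  change (series (fun h => `|gam h.+1| : R) n <= 10 * cbound * (4 * Num.sqrt C1)).
  rewrite seriesEord.
  apply: (@le_trans _ _ (\sum_(h < n) 10 * cbound * cdecay C1 (1 + h))).
    by apply: ler_sum => h _; rewrite add1n; exact: gle.
  rewrite -mulr_sumr ler_wpM2l//; first by rewrite mulr_ge0// ltW.
  by have := cdecay_sum_le C1 n (ltn0Sn 0); rewrite sqrtr1 divr1.
have gl : \sum_(1 <= h < n) gam h @[n --> \oo] --> limn (series (fun h => gam h.+1)).
  rewrite -(cvg_shiftS (fun n => \sum_(1 <= h < n) gam h)).
  have -> : (fun n => \sum_(1 <= h < n.+1) gam h) = series (fun h => gam h.+1).
    by apply/funext => n; rewrite /series /= big_add1.
  exact: csum.
set l := limn _ in gl.
have c_le : gam 0%N + 2 * l <= s2.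
  apply: le_trans (lr (emb r)); rewrite /longrun_cov cov_cproc lerD2l.
  rewrite le_eqVlt; apply/orP; left; apply/eqP; apply/esym/cvg_lim => //.
  rewrite (_ : (fun N => _) = (fun N => 2 * \sum_(1 <= n < N) gam n)).
    by apply: cvgMl_tmp.
  apply/funext => n; rewrite mulr_sumr; apply: eq_bigr => i _.
  rewrite !cov_cproc -/(gam i) (@Ex_ext _ _ _ P _ (fun w => cproc 0%N r w * cproc i r w)).
    by rewrite -/(gam i); ring.
  by move=> w; rewrite mulrC.
have glim : gam 0%N + 2 * \sum_(1 <= h < n) gam h @[n --> \oo] --> gam 0%N + 2 * l.
  by apply: cvgD; [exact: cvg_cst|apply: cvgMl_tmp].
exact: (psum_sqr_le_longrun C10 nu3 ms b0 (hp_adapted hp r) Lc (hp_Ex hp ^~ r)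
  (hp_pow4 hp ^~ r) gamE glim c_le).
Qed.

Section tails.
Variables (kappa C5 : R).
Hypotheses (kappa0 : 0 < kappa) (C50 : 0 < C5).
Hypothesis tails : forall n, tail_decay P (X n) kappa C5.

Lemma coord_sqr_tail n u (y : R) : 0 < y -> y < `|val u| ->
  Ex (fun w => crd n u w ^+ 2) <= C5 * expR (- (y `^ kappa)).
Proof.
move=> y0 yu; rewrite -lee_fin EFin_Ex; last by apply: L4_sqr; exact: coord_L4.
apply: le_trans (tails n y0); apply: le_integral_nonmeas => w.
rewrite lee_fin sqr_ge0 /=.
have le1 : (`|crd n u w|%:E <= supnorm (tail y) (val (X n w)))%E.
  apply: (@le_trans _ _ (`|val (X n w) u|)%:E); first by rewrite lee_fin entry_le_norm.
  by apply: ereal_sup_ubound; right; exists u.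
rewrite -[crd n u w ^+ 2]real_normK ?num_real// expr2 EFinM.
by apply: lee_pmul => //; rewrite lee_fin.
Qed.

Lemma cproc_sqr_tail n r (y : R) : 0 < y -> y < `|val (emb r)| ->
  Ex (fun w => cproc n r w ^+ 2) <= C5 * expR (- (y `^ kappa)).
Proof.
move=> y0 yr; apply: le_trans (coord_sqr_tail n y0 yr).
have Lc := coord_L4 n (emb r); have I2 := L4_sqr Lc; have I1 := L4_int Lc.
rewrite (@Ex_ext _ _ _ P _ (fun w => crd n (emb r) w ^+ 2 +
  (- (2 * Ex (crd n (emb r))) * crd n (emb r) w + Ex (crd n (emb r)) ^+ 2))); last first.
  by move=> w; rewrite /cproc; ring.
rewrite ExD//; last by apply: integD; [exact: integZ|exact: integ_cst].
rewrite ExD; [|exact: integZ|exact: integ_cst].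
by rewrite ExZ// Ex_cst; have := sqr_ge0 (Ex (crd n (emb r))); lra.
Qed.

Lemma cproc_far_small (e : R) : (forall r, val (emb r) = r) -> 0 < e -> exists y : nat, forall r,
  y%:R <= `|r| -> forall a q, Ex (fun w => psum (fun i => cproc i r) a q w ^+ 2) <= q%:R * e.
Proof.
move=> embE e0; have hp := cproc_holder; have b0 := cbound_gt0.
pose B := 80 * cbound * Num.sqrt C1.
have B0 : 0 <= B by rewrite !mulr_ge0 ?sqrtr_ge0 ?(ltW b0).
(* Half of e pays for the lags beyond H; the other half, divided by 1 + 2H, is the second moment
   allowed to each variable. *)
pose H := (Num.truncn ((B / (e / 2)) ^+ 2)).+1.
have BH : B / Num.sqrt H.+1%:R <= e / 2.
  rewrite ler_pdivrMr ?sqrtr_gt0 ?ltr0n// mulrC -ler_pdivrMr ?divr_gt0//.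
  apply: le_of_sqr; first exact: sqrtr_ge0.
  rewrite sqr_sqrtr//; apply: ltW; apply: lt_le_trans (truncnS_gt _) _.
  by rewrite ler_nat.
pose e' := e / 2 / (1 + 2 * H%:R).
have H0 : 0 < 1 + 2 * H%:R :> R by rewrite ltr_pwDl// mulr_ge0.
have e'0 : 0 < e' by rewrite !divr_gt0.
pose L := `|ln (C5 / e')| + 1.
have L0 : 0 < L by rewrite ltr_wpDl.
pose Y := (Num.truncn (L `^ kappa^-1)).+1.
have Y0 : 0 < Y%:R :> R by rewrite ltr0n.
exists Y.+1 => r rY a q.
have small i : Ex (fun w => cproc i r w ^+ 2) <= e'.
  apply: (le_trans (@cproc_sqr_tail i r Y%:R Y0 _)).
    by rewrite embE; apply: lt_le_trans rY; rewrite ltr_nat.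
  have LY : L <= Y%:R `^ kappa.
    have -> : L = (L `^ kappa^-1) `^ kappa by rewrite -powRrM mulVf ?lt0r_neq0// powRr1// ltW.
    apply: ge0_ler_powR; rewrite ?nnegrE ?powR_ge0 ?ltW//.
    exact: truncnS_gt.
  rewrite expRN ler_pdivrMr ?expR_gt0// mulrC -ler_pdivrMr//.
  rewrite -[leLHS]lnK ?posrE ?divr_gt0// ler_expR; apply: le_trans LY.
  by apply: (le_trans (ler_norm _)); rewrite /L lerDl.
have := psum_sqr_le_small C10 nu3 ms b0 (hp_adapted hp r) (cproc_L4 ^~ r) (hp_Ex hp ^~ r)
  (hp_pow4 hp ^~ r) H e'0 small a q.
move/le_trans; apply; apply: ler_wpM2l => //.
have -> : e' + 2 * (H%:R * e' + 40 * cbound * Num.sqrt C1 / Num.sqrt H.+1%:R) =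
  e' * (1 + 2 * H%:R) + B / Num.sqrt H.+1%:R by rewrite /B; ring.
by rewrite /e' divfK ?lt0r_neq0//; lra.
Qed.

End tails.

End coordinate_process.

(** The kernel on the diagonal is the variance of a coordinate of W at time 1, hence at most its
    second moment, and time 1 is among those over which the supremum defining sigma runs. *)
Lemma brownian_variance_le {R : realType} disp {T : measurableType disp} (P : probability T R)
    (I : set R) (d : nat) (c : 'I_d -> 'I_d -> I -> I -> R) (W : R -> T -> C0 I d) (s2 : R) :
  brownian_motion P c W -> bm_sigma2 P W = s2%:E -> forall k u, c k k u u <= s2.
Proof.
move=> bm sE k u; rewrite -(bm_cov bm).
pose f := Defs.coord (W 1) k u.
have mf : measurable_fun setT f.
  move=> _ B mB; rewrite setTI.
  have h01 : (0 <= 1 :> R) && (1 <= 1 :> R) by rewrite ler01 lexx.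
  exact: (bm_measurable bm h01 (coord_borel k u mB)).
have f2 : (\int[P]_w (f w ^+ 2)%:E <= s2%:E)%E.
  rewrite -sE; apply: le_integral_nonmeas => w; rewrite lee_fin sqr_ge0 /=.
  rewrite -[f w ^+ 2]real_normK ?num_real// expr2 EFinM.
  have le1 : (`|f w|%:E <= ereal_sup [set supnorm setT (val (W x w)) | x in `[0%R, 1%R]%classic])%E.
    apply: (@le_trans _ _ (supnorm setT (val (W 1 w)))).
      apply: (@le_trans _ _ (`|val (W 1 w) u|)%:E); first by rewrite lee_fin entry_le_norm.
      by apply: ereal_sup_ubound; right; exists u.
    by apply: ereal_sup_ubound; exists 1 => //=; rewrite in_itv /= ler01 lexx.
  by apply: lee_pmul => //; rewrite lee_fin.
have I2 : integ P (fun w => f w ^+ 2).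
  apply/integrableP; split; first by apply/measurable_EFinP; exact: measurable_funX.
  under eq_integral do rewrite /= ger0_norm ?sqr_ge0//.
  exact: le_lt_trans f2 (ltry _).
have I1 : integ P f.
  apply: (@integ_le _ _ _ _ _ (fun w => 1 + f w ^+ 2)) => //.
    by apply: integD => //; exact: integ_cst.
  by move=> w; rewrite ler_norml; apply/andP; split; nra.
rewrite /cov covariance.unlock expectation.unlock.
change (Ex P (fun w => (f w - Ex P f) * (f w - Ex P f)) <= s2).
rewrite (@Ex_ext _ _ _ P _ (fun w => f w ^+ 2 + (- (2 * Ex P f) * f w + Ex P f ^+ 2))); last first.
  by move=> w; ring.
rewrite ExD//; last by apply: integD; [exact: integZ|exact: integ_cst].
rewrite ExD; [|exact: integZ|exact: integ_cst].
rewrite ExZ// Ex_cst; have := sqr_ge0 (Ex P f).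
have : Ex P (fun w => f w ^+ 2) <= s2 by rewrite -lee_fin EFin_Ex.
lra.
Qed.

(** With 2^m <= N < 2^(m+1) and k = m + 1, one has 2^k <= 2N, and ln (k + 1) <= 2 ln (ln N) because
    m + 2 <= (m/2)^2 <= (ln N)^2 for m >= 7. Under the square root this loses 4, so the scale loses
    2. *)
Lemma lilscale_le {R : realType} (Q : nat -> Prop) : (\forall k \near \oo, Q k) ->
  \forall N \near \oo, exists k, [/\ Q k, (N <= 2 ^ k)%N, (0 < N%:R * ln (ln N%:R) :> R) &
    lilscale k <= 2 * Num.sqrt (N%:R * ln (ln N%:R)) :> R].
Proof.
move=> [k0 _ Hk]; exists (2 ^ (k0 + 7))%N => // N /= hN.
have N0 : (0 < N)%N by apply: leq_trans hN; rewrite expn_gt0.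
pose m := trunc_log 2 N.
have /andP[mN Nm] : (2 ^ m <= N < 2 ^ m.+1)%N by exact: trunc_log_bounds.
have km : (k0 + 7 <= m)%N by exact: trunc_log_max.
exists m.+1.
have NR : 0 < N%:R :> R by rewrite ltr0n.
have ln2 : 2^-1 <= ln 2 :> R.
  rewrite -ler_expR lnK ?posrE//.
  have := @expR_le_quadratic R 2^-1; rewrite ger0_norm// lexx => /(_ isT) h.
  by apply: (le_trans h); rewrite expr2; lra.
have m7 : 7 <= m%:R :> R by rewrite ler_nat (leq_trans _ km)// leq_addl.
have lnN : m%:R / 2 <= ln N%:R :> R.
  apply: (@le_trans _ _ (ln (2 ^+ m))).
    by rewrite lnXn// -[ln 2 *+ m]mulr_natl ler_wpM2l.
  by rewrite ler_ln ?posrE ?exprn_gt0// -natrX ler_nat.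
have lnN0 : 0 < ln N%:R :> R by lra.
have m2 : m.+2%:R <= ln N%:R ^+ 2 :> R.
  rewrite -[m.+2%:R]natr1 -natr1; have : (m%:R / 2) ^+ 2 <= ln N%:R ^+ 2 :> R.
    by rewrite lerXn2r ?nnegrE ?(ltW lnN0)//; lra.
  nra.
have key : ln m.+2%:R <= 2 * ln (ln N%:R) :> R.
  have -> : 2 * ln (ln N%:R) = ln (ln N%:R ^+ 2) :> R by rewrite lnXn// mulr_natl.
  by rewrite ler_ln ?posrE ?exprn_gt0 ?ltr0n.
have lnm : 0 < ln m.+2%:R :> R by rewrite ln_gt0// ltr1n.
have lln : 0 < ln (ln N%:R) :> R by lra.
have NL : 0 < N%:R * ln (ln N%:R) :> R by rewrite mulr_gt0.
split=> //; first by apply: Hk => /=; lia.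
  exact: ltnW.
apply: le_of_sqr; first by rewrite mulr_ge0 ?sqrtr_ge0.
rewrite exprMn !sqr_sqrtr ?(ltW NL)//; last by rewrite mulr_ge0 ?exprn_ge0 ?(ltW lnm).
have p2 : 2 ^+ m.+1 <= 2 * N%:R :> R by rewrite exprS ler_wpM2l// -natrX ler_nat.
have : 2 ^+ m.+1 * ln m.+2%:R <= (2 * N%:R) * (2 * ln (ln N%:R)) :> R.
  by apply: ler_pM => //; exact: ltW.
by rewrite (_ : (2 : R) ^+ 2 = 4); [lra|rewrite -natrX].
Qed.

Section conclusion.
Context {R : realType} disp {T : measurableType disp} (P : probability T R).
Context (I : set R) (d : nat) (X : nat -> T -> C0 I d).

Definition csum k n u w : R :=
  \sum_(i < n) (Defs.coord (X i) k u w - Ex P (Defs.coord (X i) k u)).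

Lemma limsup_le (sg : R) (w : T) : 0 <= sg ->
  (\forall k \near \oo, forall l n u, (n <= 2 ^ k)%N -> `|csum l n u w| <= 20 * sg * lilscale k) ->
  (limn_esup (fun N => supnorm setT (fun u =>
     ((Num.sqrt (N%:R * ln (ln N%:R)))^-1 *:
       \sum_(i < N) (val (X i w) u - mean P (X i) u))%R)) <= (40 * sg)%:E)%E.
Proof.
move=> sg0 H; have [N0 _ HN] := @lilscale_le R _ H.
rewrite /limn_esup limf_esupE; apply: ge_ereal_inf; exists (ereal_sup [set supnorm setT (fun u =>
     ((Num.sqrt (N%:R * ln (ln N%:R)))^-1 *:
       \sum_(i < N) (val (X i w) u - mean P (X i) u))%R) | N in [set N | (N0 <= N)%N]]).
  by exists [set N | (N0 <= N)%N] => //; exists N0.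
apply: ge_ereal_sup => _ [N /= hN <-].
have [k [Qk Nk NL le_k]] := HN N hN.
have s0 : 0 < Num.sqrt (N%:R * ln (ln N%:R)) :> R by rewrite sqrtr_gt0.
apply: ge_ereal_sup => _ [->|[u _ <-]]; rewrite lee_fin; first by rewrite mulr_ge0.
rewrite normrZ ger0_norm ?invr_ge0 ?(ltW s0)// mulrC ler_pdivrMr//.
apply: norm_le_entries => [|l]; first by rewrite !mulr_ge0 ?(ltW s0).
have -> : (\sum_(i < N) (val (X i w) u - mean P (X i) u)) ord0 l = csum l N u w.
  rewrite summxE; apply: eq_bigr => i _; rewrite !mxE.
  by rewrite ?/mean ?mxE expectation.unlock.
apply: (le_trans (Qk l N u Nk)).
have := ler_wpM2l (mulr_ge0 (ler0n R 20) sg0) le_k; lra.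
Qed.

End conclusion.

(** * Compact intervals and the line *)

Section domains.
Context {R : realType} disp {T : measurableType disp} (P : probability T R).
Context (d : nat).
Local Notation Ex := (Ex P).
Variables (past fut : nat -> set (set T)) (C1 nu xi J C2 s2 : R).
Hypotheses (C10 : 0 < C1) (nu3 : 3 < nu) (ms : mixing_system P past fut C1 nu).
Hypotheses (J4 : 4 < J) (xi2 : 1 / 2 < xi) (C20 : 0 < C2) (s20 : 0 < s2).

Record regular (I : set R) (X : nat -> T -> C0 I d) : Prop := {
  reg_adapted : forall k n u,
    smeas (past n.+1) (Defs.coord (X n) k u) /\ smeas (fut n) (Defs.coord (X n) k u) ;
  reg_moment : forall n, (\int[P]_w (supnorm setT (val (X n w)) `^ J) <= C2%:E)%E ;
  reg_holder : forall n u v, u != v -> (holder_moment P (X n) xi J u v <= C2%:E)%E ;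
  reg_stat : weakly_stationary P X ;
  reg_longrun : forall k u, longrun_cov P X k k u u <= s2 }.

Lemma coord_lil (I : set R) (X : nat -> T -> C0 I d) (emb : R -> I) (ell : nat -> nat) A m l :
  regular X -> (forall r s, `|val (emb r) - val (emb s)| <= `|r - s|) ->
  (forall k, (ell k <= A * k.+1 ^ m)%N) ->
  (forall e : R, 0 < e -> exists y : nat, forall k r, y%:R <= `|r| <= (ell k)%:R ->
     forall a q, Ex (fun w => psum (fun i => cproc P X l emb i r) a q w ^+ 2) <= q%:R * e) ->
  {ae P, forall w, \forall k \near \oo, forall n r, (n <= 2 ^ k)%N -> `|r| <= (ell k)%:R ->
    `|csum P X l n (emb r) w| <= 19 * Num.sqrt s2 * lilscale k}.
Proof.
move=> [ad mo ho st lr] emb_lip ell_le far.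
have hp := cproc_holder C10 nu3 ms (ad l) J4 xi2 C20 mo ho emb_lip.
have cc i w : continuous (fun r => cproc P X l emb i r w).
  move=> r; apply: cvgB; first exact: coord_cont.
  (* The mean function is continuous because the fourth power of a mean increment is at most the
     fourth moment of the increment, which the Hoelder bound controls. *)
  suff : continuous (fun r => Ex (Defs.coord (X i) l (emb r))) by exact.
  move=> {}r; apply/cvgrPdist_le => e e0.
  have b0 := hp_b hp; have rho0 := hp_rho hp; have rho2 := hp_rho2 hp.
  have rho1 : holder_ratio xi < 1.
    by rewrite -(@ltr_pXn2r _ 2) ?nnegrE ?(ltW rho0)// expr1n; have := sqr_ge0 (holder_ratio xi); lra.
  have C21 : 0 < 1 + C2 by rewrite addr_gt0.
  have ec : 0 < e / (1 + C2) by rewrite divr_gt0.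
  have [j _ Hj] := near_exp_small rho0 rho1 (ltn0Sn 0) ec.
  have {}Hj := Hj j (leqnn j); rewrite /= divn1 in Hj.
  have p0 : 0 < 2 ^- j :> R by rewrite invr_gt0 exprn_gt0.
  near=> t.
  have rt : `|r - t| <= 2 ^- j by near: t; exact: cvgr_dist_le.
  have Lr := coord_L4 ms (ad l) J4 C20 mo i (emb r).
  have Lt := coord_L4 ms (ad l) J4 C20 mo i (emb t).
  rewrite -ExB ?(L4_int Lr) ?(L4_int Lt)//.
  have L4d := L4B Lr Lt.
  have h4 := le_trans (Ex_pow4_ge L4d)
    (coord_incr4 ms (ad l) J4 xi2 C20 mo ho i (le_trans (emb_lip r t) rt)).
  have rj0 : 0 <= holder_ratio xi ^+ j by rewrite exprn_ge0// ltW.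
  set D := Ex _ in h4 *.
  have D4 : `|D| ^+ 4 <= e ^+ 4.
    rewrite -normrX ger0_norm ?exprn_even_ge0//; apply: (le_trans h4).
    rewrite mulnC exprM.
    have : (holder_ratio xi ^+ j) ^+ 4 <= (e / (1 + C2)) ^+ 4.
      by rewrite lerXn2r ?nnegrE ?(ltW ec).
    move/(ler_wpM2l (ltW C21))/le_trans; apply.
    rewrite expr_div_n mulrCA ler_piMr ?exprn_ge0 ?(ltW e0)//.
    rewrite ler_pdivrMr ?exprn_gt0// mul1r -{1}[1 + C2]expr1 ler_eXn2l//.
    by rewrite ltrDl.
  by rewrite leNgt; apply/negP => eD; move: D4; apply/negP; rewrite -ltNge ltr_pXn2r ?nnegrE ?(ltW e0).
have lrun := cproc_longrun C10 nu3 ms (ad l) J4 xi2 C20 mo ho st emb_lip s20 (lr l).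
have := process_lil hp cc s20 lrun ell_le far.
apply: filterS => w; apply: filterS => k Hk n r nk rk; have := Hk n r nk rk.
by rewrite /psum.
Unshelve. all: by end_near. Qed.

Lemma compact_lil (a b : R) (X : nat -> T -> C0 `[a, b]%classic d) : a <= b -> regular X ->
  {ae P, forall w, \forall k \near \oo, forall l n u, (n <= 2 ^ k)%N ->
    `|csum P X l n u w| <= 20 * Num.sqrt s2 * lilscale k}.
Proof.
move=> ab reg.
pose clamp r := if r < a then a else if b < r then b else r.
have clampI r : `[a, b]%classic (clamp r).
  rewrite /= in_itv /= /clamp; case: ltP => h1; first by rewrite lexx.
  by case: ltP => h2; rewrite ?lexx ?ab ?h1.
pose emb r : `[a, b]%classic := SigSub (mem_set (clampI r)).
have emb_lip r s : `|val (emb r) - val (emb s)| <= `|r - s|.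
  have h1 := ler_norm (r - s); have h2 := ler_norm (s - r); rewrite distrC in h2.
  rewrite /= /clamp ler_norml; apply/andP.
  by case: (ltP r a) => ?; case: (ltP b r) => ?; case: (ltP s a) => ?; case: (ltP b s) => ?; split; lra.
pose L := (Num.truncn (`|a| + `|b|)).+1.
have uL (u : `[a, b]%classic) : `|val u| <= L%:R.
  apply: ltW; apply: le_lt_trans (truncnS_gt _).
  have /andP[h1 h2] : a <= val u <= b by have := set_mem (valP u); rewrite /= in_itv.
  have := ler_norm b; have := ler_norm (- a); rewrite normrN.
  have := normr_ge0 a; have := normr_ge0 b.
  by move=> *; rewrite ler_norml; apply/andP; split; lra.
have embK (u : `[a, b]%classic) : emb (val u) = u.
  apply: val_inj => /=; have := set_mem (valP u); rewrite /= in_itv /= => /andP[h1 h2].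
  by rewrite /clamp ltNge h1 /= ltNge h2.
have all_l : forall l : 'I_d, {ae P, forall w, \forall k \near \oo, forall n r,
    (n <= 2 ^ k)%N -> `|r| <= L%:R ->
    `|csum P X l n (emb r) w| <= 19 * Num.sqrt s2 * lilscale k}.
  move=> l; apply: (@coord_lil _ X emb (fun=> L) L 0 l reg emb_lip) => [k|e e0].
    by rewrite expn0 muln1.
  (* [ell] is constantly L, so beyond L + 1 the far region is empty. *)
  exists L.+1 => k r /andP[h1 h2]; have := le_trans h1 h2.
  by rewrite ler_nat ltnn.
have : {ae P, forall w, forall l : 'I_d, \forall k \near \oo, forall n r,
    (n <= 2 ^ k)%N -> `|r| <= L%:R ->
    `|csum P X l n (emb r) w| <= 19 * Num.sqrt s2 * lilscale k} by exact: filter_forall.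
apply: filterS => w Hw.
have : \forall k \near \oo, forall l n r, (n <= 2 ^ k)%N -> `|r| <= L%:R ->
    `|csum P X l n (emb r) w| <= 19 * Num.sqrt s2 * lilscale k by exact: filter_forall.
apply: filterS => k Hk l n u nk.
have := Hk l n (val u) nk (uL u); rewrite embK => /le_trans; apply.
by rewrite ler_wpM2r ?sqrtr_ge0// ler_wpM2r ?sqrtr_ge0// ler_nat.
Qed.

Section line.
Variables (kappa C5 : R).
Hypotheses (kappa0 : 0 < kappa) (C50 : 0 < C5).
Variable X : nat -> T -> C0 (@setT R) d.
Hypotheses (reg : regular X) (mX : forall n, random_element (@borel (C0 (@setT R) d)) (X n)).
Hypothesis tails : forall n, tail_decay P (X n) kappa C5.

(** Chosen so that p kappa >= 2: then l_k^kappa is at least (k + 1)^2, and the tails decay faster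
    than any fixed geometric rate. *)
Let p := (Num.truncn (2 / kappa)).+1.
Let ell k := (k.+1 ^ p)%N.

Lemma ell_pow k : (5 <= k)%N -> 6 * k.+1%:R <= (ell k)%:R `^ kappa.
Proof.
move=> k5; have k6 : 6 <= k.+1%:R :> R by rewrite ler_nat.
rewrite natrX -powR_mulrn// -powRrM.
have p2 : 2 <= p%:R * kappa.
  by rewrite -ler_pdivrMr//; apply: ltW; exact: truncnS_gt.
apply: (@le_trans _ _ (k.+1%:R `^ 2%:R)).
  by rewrite powR_mulrn// expr2 ler_wpM2r.
by apply: ler_powR => //; rewrite ler1n.
Qed.

(** Of the factor 2^(-5k), Chebyshev at level 2^(-k) uses 2^(-2k) and the union over 2^k indices
    uses 2^(-k); exp (-(k+1)) gives summability and absorbs [C5]. *)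
Lemma exp_ell_le k : (5 <= k)%N ->
  C5 * expR (- ((ell k)%:R `^ kappa)) <= C5 * expR (- (k.+1%:R)) * 2 ^- (5 * k).
Proof.
move=> k5; rewrite -mulrA ler_wpM2l ?(ltW C50)//.
apply: (@le_trans _ _ (expR (- (6 * k.+1%:R)))); first by rewrite ler_expR lerN2 ell_pow.
rewrite (_ : - (6 * k.+1%:R) = - k.+1%:R + - (5 * k.+1)%N%:R); last by rewrite natrM; ring.
rewrite expRD ler_wpM2l ?expR_ge0// expRN lef_pV2 ?posrE ?expR_gt0 ?exprn_gt0//.
apply: (@le_trans _ _ (2 ^+ (5 * k.+1))); first by rewrite ler_weXn2l ?ler1n// leq_mul2l leqnSn orbT.
rewrite -[(5 * k.+1)%N%:R]mulr1 mulrC expRM_natr lerXn2r ?nnegrE ?expR_ge0//.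
by have := @expR_ge1Dx R 1; lra.
Qed.

Lemma tail_prob i k : (5 <= k)%N ->
  pr P [set w | ((2 ^- k)%:E < supnorm (tail (ell k)%:R) (val (X i w)))%E] <=
  C5 * expR (- k.+1%:R) * 2 ^- (3 * k).
Proof.
move=> k5; set A := mkset _; set c : R := 2 ^- k.
have c0 : 0 < c by rewrite invr_gt0 exprn_gt0.
have mA : measurable A by exact: (mX i (supnorm_borel _ _)).
have l0 : 0 < (ell k)%:R :> R by rewrite ltr0n expn_gt0.
have h : c ^+ 2 * pr P A <= C5 * expR (- ((ell k)%:R `^ kappa)).
  rewrite -(Ex_indic P mA) -ExZ; last exact: integ_indic.
  rewrite -lee_fin EFin_Ex; last by apply: integZ; exact: integ_indic.
  apply: le_trans (tails i l0); apply: le_integral_nonmeas => w.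
  rewrite indicE; case: (boolP (w \in A)) => [|_]; last first.
    by rewrite mulr0 lexx /=; apply: mule_ge0; exact: supnorm_ge0.
  rewrite inE => /ltW cs; rewrite mulr1 expr2 EFinM mule_ge0 ?lee_fin ?(ltW c0)//=.
  by apply: lee_pmul => //; rewrite lee_fin (ltW c0).
have {}h := le_trans h (exp_ell_le k5).
have -> : pr P A = c ^- 2 * (c ^+ 2 * pr P A).
  by rewrite mulrA mulVf ?mul1r// lt0r_neq0// exprn_gt0.
apply: (le_trans (ler_wpM2l _ h)); first by rewrite invr_ge0 sqr_ge0.
rewrite mulrCA ler_wpM2l ?mulr_ge0 ?expR_ge0 ?(ltW C50)//.
rewrite /c exprVn invrK -exprM -[5%N]/(2 + 3)%N mulnDl exprD invfM mulnC mulrA.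
by rewrite mulfV ?mul1r// expf_neq0.
Qed.

Lemma tail_ae : {ae P, forall w, \forall k \near \oo, forall i, (i < 2 ^ k)%N ->
  (supnorm (tail (ell k)%:R) (val (X i w)) <= (2 ^- k)%:E)%E}.
Proof.
pose A k i := [set w | ((2 ^- k : R)%:E < supnorm (tail (ell k)%:R) (val (X i w)))%E].
have mA k i : measurable (A k i) by exact: (mX i (supnorm_borel _ _)).
pose G k := \big[setU/set0]_(i < 2 ^ k) A k i.
have mG k : measurable (G k) by apply: bigsetU_measurable.
have e1 : expR (-1) < 1 :> R by rewrite expR_lt1; lra.
have [K K0 HK] := exp_le_poly 2 (expR_gt0 (-1)) e1 (ltn0Sn 0).
have nG : \forall k \near \oo, pr P (G k) <= C5 * K * k.+1%:R ^- 2.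
  exists 5%N => // k /= k5.
  apply: (le_trans (pr_bigsetU_cst (mA k) (fun i _ => tail_prob i k5))).
  have -> : (2 ^ k)%N%:R * (C5 * expR (- k.+1%:R) * 2 ^- (3 * k)) =
      C5 * (expR (- k.+1%:R) * 2 ^- (2 * k)) :> R.
    rewrite natrX -[3%N]/(1 + 2)%N mulnDl mul1n exprD; field.
    by rewrite !expf_neq0.
  rewrite -mulrA ler_wpM2l ?(ltW C50)//; apply: le_trans (HK k); rewrite divn1.
  rewrite -expRM_natr mulN1r.
  apply: (@le_trans _ _ (expR (- k%:R) * 1)); last by rewrite mulr1.
  apply: ler_pM; rewrite ?expR_ge0//; first by rewrite ler_expR lerN2 ler_nat.
  by rewrite invf_le1 ?exprn_gt0// exprn_ege1// ler1n.
apply: filterS (borel_cantelli_sqr mG nG) => w; apply: filterS => k nGk i ik.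
by rewrite leNgt; apply/negP => h; apply: (bigsetU_notin nGk ik).
Qed.

Lemma line_lil : {ae P, forall w, \forall k \near \oo, forall l n u, (n <= 2 ^ k)%N ->
  `|csum P X l n u w| <= 20 * Num.sqrt s2 * lilscale k}.
Proof.
have [ad mo ho st lr] := reg.
pose emb r : @setT R := SigSub (mem_set (Logic.I : setT r)).
have emb_lip r s : `|val (emb r) - val (emb s)| <= `|r - s| by [].
have embK u : emb (val u) = u by exact: val_inj.
have all_l : forall l : 'I_d, {ae P, forall w, \forall k \near \oo, forall n r,
    (n <= 2 ^ k)%N -> `|r| <= (ell k)%:R ->
    `|csum P X l n (emb r) w| <= 19 * Num.sqrt s2 * lilscale k}.
  move=> l; apply: (@coord_lil _ X emb ell 1 p l reg emb_lip) => [k|e e0].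
    by rewrite mul1n.
  have embE r : val (emb r) = r by [].
  have [y Hy] := cproc_far_small C10 nu3 ms (ad l) J4 xi2 C20 mo ho emb_lip kappa0 C50 tails embE e0.
  by exists y => k r /andP[yr _]; exact: Hy.
have sg0 : 0 < Num.sqrt s2 by rewrite sqrtr_gt0.
have e1 : expR (-1) < 1 :> R by rewrite expR_lt1; lra.
have C5V : 0 < C5^-1 by rewrite invr_gt0.
have near1 := near_exp_small (expR_gt0 (-1)) e1 (ltn0Sn 0) C5V.
have near2 := @near_log_ge R ((2 / Num.sqrt s2) ^+ 2).
have : {ae P, forall w, forall l : 'I_d, \forall k \near \oo, forall n r,
    (n <= 2 ^ k)%N -> `|r| <= (ell k)%:R ->
    `|csum P X l n (emb r) w| <= 19 * Num.sqrt s2 * lilscale k} by exact: filter_forall.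
apply: filterS2 tail_ae => w Tw Hw0.
have Hw : \forall k \near \oo, forall l n r, (n <= 2 ^ k)%N -> `|r| <= (ell k)%:R ->
    `|csum P X l n (emb r) w| <= 19 * Num.sqrt s2 * lilscale k by exact: filter_forall.
near=> k => l n u nk.
have Tk : forall i, (i < 2 ^ k)%N -> (supnorm (tail (ell k)%:R) (val (X i w)) <= (2 ^- k)%:E)%E.
  by near: k; exact: Tw.
have Hk : forall l n r, (n <= 2 ^ k)%N -> `|r| <= (ell k)%:R ->
    `|csum P X l n (emb r) w| <= 19 * Num.sqrt s2 * lilscale k by near: k; exact: Hw.
have k5 : (5 <= k)%N by near: k; exact: nbhs_infty_ge.
have ek : expR (-1) ^+ (k %/ 1) <= C5^-1 by near: k; exact: near1.
have lk : (2 / Num.sqrt s2) ^+ 2 <= ln k.+1%:R by near: k; exact: near2.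
have W0 : 0 <= lilscale k :> R by exact: sqrtr_ge0.
have [ul|ul] := leP `|val u| (ell k)%:R.
  have := Hk l n (val u) nk ul; rewrite embK => /le_trans; apply.
  by rewrite ler_wpM2r// ler_wpM2r ?(ltW sg0)// ler_nat.
have p2 : 0 < 2 ^+ k :> R by rewrite exprn_gt0.
have c1 i : (i < n)%N -> `|Defs.coord (X i) l u w| <= 2 ^- k.
  move=> i_n; rewrite -lee_fin; apply: le_trans (Tk i (leq_trans i_n nk)).
  apply: (@le_trans _ _ (`|val (X i w) u|)%:E); first by rewrite lee_fin entry_le_norm.
  by apply: ereal_sup_ubound; right; exists u.
have l0 : 0 < (ell k)%:R :> R by rewrite ltr0n expn_gt0.
have c2 i : `|Ex (Defs.coord (X i) l u)| <= 2 ^- k.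
  apply: le_of_sqr; first by rewrite invr_ge0 ltW.
  rewrite real_normK ?num_real//.
  have Lc := coord_L4 ms (ad l) J4 C20 mo i u.
  apply: (le_trans (Ex_sqr Lc)).
  apply: (le_trans (coord_sqr_tail ms (ad l) J4 C20 mo tails i l0 ul)).
  apply: (le_trans (exp_ell_le k5)); rewrite -[leRHS]mul1r.
  apply: ler_pM; rewrite ?invr_ge0 ?exprn_ge0//.
  - by rewrite mulr_ge0 ?expR_ge0// ltW.
  - rewrite -ler_pdivlMl// mulr1; apply: le_trans ek; rewrite divn1 -expRM_natr mulN1r.
    by rewrite ler_expR lerN2 ler_nat.
  - by rewrite exprVn lef_pV2 ?posrE ?exprn_gt0// -exprM ler_weXn2l ?ler1n// mulnC leq_mul2r orbT.
(* Outside [-l_k, l_k] there are at most 2^k summands, each at most 2 * 2^(-k) after centering, so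
   the sum is at most 2, which the scale eventually exceeds. *)
apply: (@le_trans _ _ 2).
  apply: (le_trans (ler_norm_sum _ _ _)).
  apply: (@le_trans _ _ (\sum_(i < n) (2 * 2 ^- k))).
    apply: ler_sum => i _; apply: (le_trans (ler_normB _ _)).
    by have := c1 i (ltn_ord i); have := c2 i; lra.
  rewrite sumr_const card_ord -[_ *+ n]mulr_natl mulrCA ler_piMr// ler_pdivrMr// mul1r.
  by rewrite -natrX ler_nat.
have k1 : 1 <= 2 ^+ k :> R by rewrite exprn_ege1// ler1n.
have : 2 / Num.sqrt s2 <= lilscale k.
  have ln0 : 0 <= ln k.+1%:R :> R by apply: le_trans lk; exact: sqr_ge0.
  apply: le_of_sqr => //; rewrite sqr_sqrtr; last by rewrite mulr_ge0// ltW.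
  by apply: (le_trans lk); rewrite ler_peMl.
rewrite ler_pdivrMr// => h; apply: (le_trans h).
have : 0 <= lilscale k * Num.sqrt s2 by rewrite mulr_ge0 ?(ltW sg0).
lra.
Unshelve. all: by end_near. Qed.

End line.

End domains.
Theorem corollary2 (R : realType) :
  exists Cmin : R, 0 < Cmin /\
  forall C : R, Cmin <= C ->
  forall (d : nat) (I : set R)
    (disp : measure_display) (T : measurableType disp) (P : probability T R)
    (S : nat -> metricType R) (A : forall M, C0 I d * S M -> C0 I d)
    (X : nat -> T -> C0 I d) (delta : forall M, nat -> T -> S M)
    (Mseq : nat -> nat) (J xi nu gamma C1 C2 C3 : R)
    (disp' : measure_display) (T' : measurableType disp')
    (P' : probability T' R) (W : R -> T' -> C0 I d),
  (0 < d)%N ->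
  sparse_model A X delta Mseq ->
  assumptionA P X delta (sparse A X delta) Mseq J xi nu gamma C1 C2 C3 ->
  assumptionB P X (sparse A X delta) ->
  (forall N i w, (0 < N)%N -> sparse A X delta (Mseq N) i w = X i w) ->
  brownian_motion P' (longrun_cov P X) W ->
  (0 < bm_sigma2 P' W)%E ->
  {ae P, forall w,
    (limn_esup (fun N => supnorm setT (fun u =>
        ((Num.sqrt (N%:R * ln (ln N%:R)))^-1 *:
          \sum_(i < N) (val (X i w) u - mean P (X i) u))%R))
      <= C%:E * sqrte (bm_sigma2 P' W))%E}.
Proof.
(* 40 = 2 * 20: the factor 20 is the bound along N = 2^k, and 2 is the loss in passing to all N. *)
exists 40; split=> // C C40 d I disp T P S A X delta Mseq J xi nu gamma C1 C2 C3 disp' T' P' W.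
move=> _ sm hA hB _ bm s2_gt0.
have C_gt0 : 0 < C by exact: lt_le_trans C40.
case sE : (bm_sigma2 P' W) s2_gt0 => [s2| |]//; last first.
  by move=> _; apply: filterE => w; rewrite /= gt0_muley ?lte_fin// leey.
rewrite lte_fin => s20.
have [C10 nu0 C20 _ _] := A_const_pos hA.
have [J4 xi2 nuJ] := A_exponents hA.
have nu3 : 3 < nu.
  apply: lt_trans nuJ; rewrite ltrDl divr_gt0//; lra.
(* A single value of M is enough: the mixing of the pairs passes to X through the first
   projection. *)
pose Y n w := (X n w, delta 0%N n w).
pose G := prod_sigma (@borel (C0 I d)) (@borel (S 0%N)).
have mY n : random_element G (Y n).
  by apply: prod_random_element; [exact: sm_X sm n|exact: sm_delta sm 0%N n].
have ms : mixing_system P (pastY G Y) (futY G Y) C1 nu.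
  by apply: alpha_mixing_system => //; [exact: ltW|exact: A_rate hA 0%N].
have reg : regular P (pastY G Y) (futY G Y) xi J C2 s2 X.
  split.
  - move=> k n u.
    apply: (preimage_smeas_past Y (G := G) (f := (fun f : C0 I d => val f u ord0 k) \o fst)) => B mB.
    exact: prod_sigma_fst (coord_borel k u mB).
  - exact: A_moment hA.
  - exact: A_holder hA.
  - exact: A_stationary hA.
  - exact: brownian_variance_le bm sE.
have lil : {ae P, forall w, \forall k \near \oo, forall l n u, (n <= 2 ^ k)%N ->
    `|csum P X l n u w| <= 20 * Num.sqrt s2 * lilscale k}.
  have mX := sm_X sm.
  move: (pastY G Y) (futY G Y) ms reg => past fut ms.
  have {hB} : (exists a b : R, a <= b /\ I = `[a, b]%classic) \/
    (I = setT /\ exists kappa C5 : R,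
      [/\ 0 < kappa, 0 < C5 & forall n, tail_decay P (X n) kappa C5]).
    by case: hB => [|[IE [kappa [C5 [? ? ? _]]]]]; [left|right; split=> //; exists kappa, C5].
  (* The types depend on [I], which can be replaced by an interval or the line only once the other
     data living on it are cleared. *)
  move: X mX {Y G A delta W sm hA bm mY sE} => X mX; case=> [[a [b [ab IE]]]|[IE [kappa [C5 [kappa0 C50]]]]].
    by move: X {mX}; rewrite IE => X; exact: (compact_lil C10 nu3 ms J4 xi2 C20 s20 ab).
  by move: X mX; rewrite IE => X mX tails reg; exact: (line_lil C10 nu3 ms J4 xi2 C20 s20 kappa0 C50 reg mX tails).
apply: filterS lil => w /limsup_le => /(_ (sqrtr_ge0 s2)) h.
by apply: (le_trans h); rewrite /= -EFinM lee_fin ler_wpM2r ?sqrtr_ge0.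
Qed.
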